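(* Let $s\ge1$ and, for each $N$, let $X^{(N)}_1,\dots,X^{(N)}_s$ be an independent family of complex $N\times N$ Wishart matrices with parameter $M=M(N)$. Assume that $\lim_N M/N=c>0$ and that $\lim_N(M-Nc)=c'$ exists. Then $\{X^{(N)}_1,\dots,X^{(N)}_s\}_N$ are asymptotically infinitesimally free, and the infinitesimal free cumulants of the limit infinitesimal distribution of each $X_i^{(N)}$ are $\kappa'_n=c'$ for all $n\ge1$. The limit infinitesimal distribution of each $X_i^{(N)}$ is $(\mu,\mu')$, where $\mu$ is the Marchenko-Pastur distribution with parameter $c$ and $\mu'$ is the signed measure $$d\mu'(x)=-c'\begin{cases}\delta_0-\dfrac{x+1-c}{2\pi x\sqrt{(b-x)(x-a)}}\,dx & c<1\\[2ex] \dfrac12\delta_0-\dfrac{1}{2\pi\sqrt{x(4-x)}}\,dx & c=1\\[2ex] -\dfrac{x+1-c}{2\pi x\sqrt{(b-x)(x-a)}}\,dx & c>1\end{cases}$$ where $a=(1-\sqrt c)^2$, $b=(1+\sqrt c)^2$, and the absolutely continuous parts are supported on $[a,b]$.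
   Context: Complex Wishart matrix: $X=\frac1N G^*G$ with $G$ an $M\times N$ random matrix with independent standard complex Gaussian entries ($\mathrm{E}g=0$, $\mathrm{E}g^2=0$, $\mathrm{E}|g|^2=1$). $\mathrm{tr}=\frac1N\mathrm{Tr}$. The Marchenko-Pastur distribution with parameter $c$ is $\max(1-c,0)\,\delta_0+\frac{\sqrt{(b-x)(x-a)}}{2\pi x}\mathbf 1_{[a,b]}(x)\,dx$; all of its free cumulants equal $c$. An infinitesimal probability space $(\mathcal{A},\varphi,\varphi')$ is a unital complex algebra with linear functionals $\varphi,\varphi'$, $\varphi(1)=1$, $\varphi'(1)=0$. Unital subalgebras $\mathcal{A}_1,\dots,\mathcal{A}_s$ are infinitesimally free if for all $n\geq 1$ and all $a_i\in\mathcal{A}_{j_i}$ ($1\le i\le n$) with neighbouring indices $j_i\ne j_{i+1}$ and $\varphi(a_i)=0$ for all $i$: (1) $\varphi(a_1\cdots a_n)=0$; (2) $\varphi'(a_1\cdots a_n)=0$ for $n$ even, and for $n=2m+1$, $\varphi'(a_1\cdots a_n)=\varphi(a_1a_n)\varphi(a_2a_{n-1})\cdots\varphi(a_ma_{m+2})\varphi'(a_{m+1})$. Elements are infinitesimally free if the unital algebras they generate are. The ensembles are asymptotically infinitesimally free if there are infinitesimally free $x_1,\dots,x_s$ in some infinitesimal probability space such that for all $n\geq 1$ and $i_1,\dots,i_n\in\{1,\dots,s\}$ $$\lim_N\mathrm{E}(\mathrm{tr}(X^{(N)}_{i_1}\cdots X^{(N)}_{i_n}))=\varphi(x_{i_1}\cdots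 x_{i_n}),$$ $$\lim_N N\big(\mathrm{E}(\mathrm{tr}(X^{(N)}_{i_1}\cdots X^{(N)}_{i_n}))-\varphi(x_{i_1}\cdots x_{i_n})\big)=\varphi'(x_{i_1}\cdots x_{i_n}).$$ The limit infinitesimal distribution of $X_i^{(N)}$ is $(\mu,\mu')$ means $m_n:=\varphi(x_i^n)=\int t^n\,d\mu(t)$ and $m'_n:=\varphi'(x_i^n)=\int t^n\,d\mu'(t)$ for all $n$. Free cumulants $\kappa_n$ and infinitesimal free cumulants $\kappa'_n$ are determined by: for all $n\ge1$, $m_n=\sum_{\pi\in NC(n)}\prod_{V\in\pi}\kappa_{|V|}$ and $m'_n=\sum_{\pi\in NC(n)}\sum_{V\in\pi}\kappa'_{|V|}\prod_{W\in\pi,W\ne V}\kappa_{|W|}$, where $NC(n)$ is the set of non-crossing partitions of $\{1,\dots,n\}$. *)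

(* Defs.v *)
From HB Require Import structures.
From mathcomp Require Import all_boot all_order all_algebra.
From mathcomp Require Import all_classical all_reals all_analysis.
From mathcomp Require Import complex.

Set Implicit Arguments.
Unset Strict Implicit.
Unset Printing Implicit Defensive.

Import Order.TTheory GRing.Theory Num.Theory numFieldNormedType.Exports.

Local Open Scope classical_set_scope.
Local Open Scope ring_scope.
Local Open Scope complex_scope.

Section probability.
Context (R : realType) (d : measure_display) (T : measurableType d).
Variable P : probability T R.

(* A complex random variable is handled as a pair of real random variables,
   i.e. C is identified with R * R carrying the product Borel sigma-algebra. *)
Definition ReIm (z : R[i]) : measurableTypeR R * measurableTypeR R :=
  (complex.Re z, complex.Im z).

Definition events_of (Z : T -> R[i]) : set (set T) :=
  preimage_set_system setT (ReIm \o Z) measurable.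

Definition events_of_mx m n (X : T -> 'M[R[i]]_(m, n)) : set (set T) :=
  <<s \bigcup_(kl in [set: 'I_m * 'I_n]) events_of (fun t => X t kl.1 kl.2) >>.

Definition mutually_independent (I : finType) (F : I -> set (set T)) :=
  forall (J : {set I}) (A : I -> set T), (forall i, i \in J -> F i (A i)) ->
  P (\bigcap_(i in [set` J]) A i) = (\prod_(i in J) P (A i))%E.

(* Real and imaginary parts are independent N(0, 1/2); [normal_prob] takes the
   standard deviation. Hence E g = E g^2 = 0 and E |g|^2 = 1. *)
Definition std_complex_gaussian (g : T -> R[i]) :=
  measurable_fun setT (ReIm \o g) /\
  forall B, measurable B ->
    P ((ReIm \o g) @^-1` B) =
    (normal_prob 0 (Num.sqrt 2^-1) \x normal_prob 0 (Num.sqrt 2^-1))%E B.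

(* The entries of a Wishart matrix are not independent, so independence of
   Wishart matrices is expressed by [events_of_mx], not through G. *)
Definition complex_wishart (N M : nat) (X : T -> 'M[R[i]]_N) :=
  exists G : T -> 'M[R[i]]_(M, N),
    [/\ forall k l, std_complex_gaussian (fun t => G t k l),
        mutually_independent
          (fun kl : 'I_M * 'I_N => events_of (fun t => G t kl.1 kl.2)) &
        forall t, X t = N%:R^-1 *: ((map_mx (@conjc R) (G t))^T *m G t)].

Definition Cexpectation (Z : T -> R[i]) : R[i] :=
  fine 'E_P[fun t => complex.Re (Z t)] +i* fine 'E_P[fun t => complex.Im (Z t)].

End probability.

Definition ntr (R : realType) (N : nat) (A : 'M[R[i]]_N) : R[i] :=
  N%:R^-1 * \tr A.

Record inf_prob_space (R : realType) := InfProbSpace {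
  ips_alg :> algType R[i] ;
  ips_phi : {scalar ips_alg} ;
  ips_phi' : {scalar ips_alg} ;
  ips_phi1 : ips_phi 1 = 1 ;
  ips_phi'1 : ips_phi' 1 = 0 }.

Definition gen_subalg (C : comNzRingType) (A : algType C) (x : A) : set A :=
  smallest (fun B : set A => GRing.subalg_closed (mem B)) [set x].

(* Indices start at 0: a 0, ..., a (n - 1) stand for a_1, ..., a_n. *)
Definition inf_free (R : realType) (S : inf_prob_space R) (I : Type)
    (B : I -> set S) :=
  forall (n : nat) (j : nat -> I) (a : nat -> S), (0 < n)%N ->
  (forall k, (k < n)%N -> B (j k) (a k)) ->
  (forall k, (k.+1 < n)%N -> j k <> j k.+1) ->
  (forall k, (k < n)%N -> ips_phi S (a k) = 0) ->
  [/\ ips_phi S (\prod_(k < n) a k) = 0,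
      ~~ odd n -> ips_phi' S (\prod_(k < n) a k) = 0 &
      forall m, n = m.*2.+1 ->
        ips_phi' S (\prod_(k < n) a k) =
        (\prod_(k < m) ips_phi S (a k * a (m.*2 - k)%N)) * ips_phi' S (a m)].

Definition inf_free_elements (R : realType) (S : inf_prob_space R) (I : Type)
  (x : I -> S) := inf_free (fun i => gen_subalg (x i)).

Section asymptotics.
Context (R : realType) (s : nat) (d : nat -> measure_display).
Context (T : forall N, measurableType (d N)) (P : forall N, probability (T N) R).
Variable X : forall N, 'I_s -> T N -> 'M[R[i]]_N.

Definition word_moment n (w : 'I_n -> 'I_s) (N : nat) : R[i] :=
  Cexpectation (P N) (fun t => ntr (\prod_(k < n) X (w k) t)).

Definition inf_limit (S : inf_prob_space R) (x : 'I_s -> S) :=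
  forall n (w : 'I_n -> 'I_s), (0 < n)%N ->
  let l := ips_phi S (\prod_(k < n) x (w k)) in
  let l' := ips_phi' S (\prod_(k < n) x (w k)) in
  ((word_moment w N : R[i]^o) @[N --> \oo] --> (l : R[i]^o)) /\
  ((N%:R * (word_moment w N - l) : R[i]^o) @[N --> \oo] --> (l' : R[i]^o)).

Definition asymptotically_inf_free :=
  exists (S : inf_prob_space R) (x : 'I_s -> S),
    inf_free_elements x /\ inf_limit x.

End asymptotics.

Definition noncrossing n (p : {set {set 'I_n}}) : bool :=
  [forall V in p, forall W in p,
    [forall i in V, forall j in W, forall k in V, forall l in W,
      [&& i < j, j < k & k < l]%N ==> (V == W)]].

Definition NC n : {set {set {set 'I_n}}} :=
  [set p : {set {set 'I_n}} | finset.partition p [set: 'I_n]%SET && noncrossing p]%SET.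

(* k and k' are the (infinitesimal) free cumulants of the moments m and m'. *)
Definition inf_free_cumulants (C : comNzRingType) (m m' k k' : nat -> C) :=
  forall n, (0 < n)%N ->
  m n = \sum_(p in NC n) \prod_(V in p) k #|V| /\
  m' n = \sum_(p in NC n) \sum_(V in p)
    k' #|V| * \prod_(W in p | W != V) k #|W|.

Section distributions.
Context (R : realType).
Implicit Types c x : R.

(* Integral against a signed measure, through its Jordan decomposition. *)
Definition charge_integral (nu : {charge set (measurableTypeR R) -> \bar R})
    (f : R -> R) (v : R) :=
  exists (D N : set (measurableTypeR R)) (nuDN : hahn_decomposition nu D N),
  [/\ (jordan_pos nuDN).-integrable setT (EFin \o f),
      (jordan_neg nuDN).-integrable setT (EFin \o f) &
      v = \int[jordan_pos nuDN]_t f t - \int[jordan_neg nuDN]_t f t].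

Definition inf_distribution (S : inf_prob_space R) (x : S)
    (mu : probability (measurableTypeR R) R)
    (mu' : {charge set (measurableTypeR R) -> \bar R}) :=
  forall n : nat,
  [/\ mu.-integrable setT (EFin \o (fun t : R => t ^+ n)),
      ips_phi S (x ^+ n) = (\int[mu]_t (t ^+ n))%:C &
      exists2 v : R, charge_integral mu' (fun t => t ^+ n) v &
                     ips_phi' S (x ^+ n) = v%:C].

Definition edge_l c : R := (1 - Num.sqrt c) ^+ 2.
Definition edge_r c : R := (1 + Num.sqrt c) ^+ 2.

(* The measure with density f on [a, b]. *)
Definition ac_part c (f : R -> R) (A : set R) : \bar R :=
  (\int[lebesgue_measure]_(x in A `&` `[edge_l c, edge_r c]%classic) (f x)%:E)%E.

Definition mp_density c x : R :=
  Num.sqrt ((edge_r c - x) * (x - edge_l c)) / (2 * pi * x).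

Definition marchenko_pastur c (A : set R) : \bar R :=
  ((Num.max (1 - c) 0)%R%:E * \d_(0%R : R) A + ac_part c (mp_density c) A)%E.

Definition mu'_density c x : R :=
  (x + 1 - c) / (2 * pi * x * Num.sqrt ((edge_r c - x) * (x - edge_l c))).

Definition mu'_density1 x : R := (2 * pi * Num.sqrt (x * (4 - x)))^-1.

Definition wishart_mu' c (c' : R) (A : set R) : \bar R :=
  ((- c')%R%:E *
   (if (c < 1)%R then \d_(0%R : R) A - ac_part c (mu'_density c) A
    else if c == 1%R then (2^-1)%R%:E * \d_(0%R : R) A - ac_part c mu'_density1 A
    else - ac_part c (mu'_density c) A))%E.

End distributions.

(* Main.v *)
(* Gaussian integration by parts gives a loop equation for the expectations of
   products of normalized traces of words.  Up to terms of order 1/N^2 it closes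
   on products, so the expected trace of a word w is p_w(M/N) + o(1/N), where p_w
   is the polynomial given by the planar recursion ([wval]).  As
   M/N = c + c'/N + o(1/N), this yields phi(w) = p_w(c) and phi'(w) = c' p_w'(c).
   The planar recursion is a Schwinger-Dyson equation which makes the
   noncommutative indeterminates free over the ring of polynomials in c, and
   differentiating this freeness in c gives infinitesimal freeness.

   Summing x^(number of blocks) over noncrossing partitions satisfies the same
   recursion; its value and its derivative at c give the cumulants c and c'.

   For the densities, x = 1 + c + 2 sqrt(c) cos t turns all moments into
   coefficients of powers of (1 + X)(X + c), which also express p_n and p_n'. *)

Require Import Defs.
From HB Require Import structures.
From mathcomp Require Import all_boot all_order all_algebra.
From mathcomp Require Import all_classical all_reals all_analysis.
From mathcomp Require Import complex.
From mathcomp Require Import measurable_realfun.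
From mathcomp Require mpoly monalg.
From mathcomp Require Import ring lra zify.

Set Implicit Arguments.
Unset Strict Implicit.
Unset Printing Implicit Defensive.

Import Order.TTheory GRing.Theory Num.Theory numFieldNormedType.Exports.

Local Open Scope classical_set_scope.
Local Open Scope ring_scope.
Local Open Scope complex_scope.

(** * Moments of complex random variables *)

(** Expectations are replaced by linear functionals on formal commutative polynomials in the
    entries: differentiation becomes algebraic, integrability is settled once by requiring all
    moments, and independence only serves to factor monomials. After integration by parts the
    Gaussian entries recombine into Wishart entries, so [G] survives only in the ratio [M / N].

    Splitting a trace creates two, so the induction must run over products of traces; asymptotic
    factorization comes with it and no variance estimate is made. The error [o(1/N)] is measured
    against the polynomial at [M / N]; passing to [c] afterwards is the sole source of [c'].

    An element centred at [c] need not be centred as a polynomial in [c]. The infinitesimal state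
    measures, to first order, the cost of recentring: one factor drops out at a time, and only the
    removal of the middle one leaves a word that can collapse. Recentring needs scalars depending on
    [c], while the derivative of the state is linear over constants only; hence one algebra with two
    scalar structures.

    The limit space in the second claim is arbitrary; uniqueness of limits fixes its moments. *)

Section all_moments.
Context (R : realType) (d : measure_display) (T : measurableType d).
Variable P : probability T R.
Implicit Types f g h u : T -> R.

(** Integrability of every power gives a class closed under products, through the bound of [|f g|]
    by [f ^+ 2 + g ^+ 2]; integrability alone would not be stable. *)
Definition all_moments f := measurable_fun setT f /\
  forall n, P.-integrable setT (EFin \o (fun t => f t ^+ n)).

Lemma all_moments_integrable f : all_moments f -> P.-integrable setT (EFin \o f).
Proof.
by move=> [_ /(_ 1)]; under eq_fun do rewrite expr1.
Qed.

Lemma all_moments_cst c : all_moments (cst c).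
Proof.
split; first exact: measurable_cst.
by move=> n; exact: (@finite_measure_integrable_cst _ _ _ P _ (c ^+ n)%R).
Qed.

Lemma all_momentsX f n : all_moments f -> all_moments (fun t => f t ^+ n).
Proof.
move=> [mf fi]; split; first exact: measurable_funX.
by move=> m; under eq_fun do rewrite -exprM; exact: fi.
Qed.

Lemma integrable_prod_all_moments f g : all_moments f -> all_moments g ->
  P.-integrable setT (EFin \o (fun t => f t * g t)).
Proof.
move=> fm gm.
apply: (@le_integrable _ _ _ P _ measurableT _
   (EFin \o (fun t => f t ^+ 2 + g t ^+ 2))).
- by apply/measurable_EFinP/measurable_funM; [apply: fm.1|apply: gm.1].
- move=> t _; rewrite /= lee_fin [leRHS]ger0_norm ?addr_ge0 ?sqr_ge0//.
  by rewrite ler_norml; apply/andP; split; nra.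
- have := @integrableD _ _ _ P _ measurableT _ _ (fm.2 2) (gm.2 2).
  by apply: eq_integrable.
Qed.

Lemma all_momentsM f g : all_moments f -> all_moments g ->
  all_moments (fun t => f t * g t).
Proof.
move=> fm gm; split; first by apply: measurable_funM; [apply: fm.1|apply: gm.1].
move=> n; under eq_fun do rewrite exprMn.
by apply: integrable_prod_all_moments; exact: all_momentsX.
Qed.

Lemma all_momentsD f g : all_moments f -> all_moments g ->
  all_moments (fun t => f t + g t).
Proof.
move=> fm gm; split; first by apply: measurable_funD; [apply: fm.1|apply: gm.1].
move=> n; under eq_fun do rewrite exprDn.
under eq_fun do under eq_bigr do rewrite -mulr_natl.
have -> : (EFin \o fun t => \sum_(i < n.+1) 'C(n, i)%:R * (f t ^+ (n - i) * g t ^+ i))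
  = (fun t => \sum_(i < n.+1) (('C(n, i)%:R)%:E * (f t ^+ (n - i) * g t ^+ i)%:E))%E.
  by apply/funext => t /=; rewrite -sumEFin.
apply: integrable_sum => // i _; apply: integrableZl => //.
by apply: integrable_prod_all_moments; exact: all_momentsX.
Qed.

Lemma all_momentsZ k f : all_moments f -> all_moments (fun t => k * f t).
Proof. by apply: all_momentsM; exact: all_moments_cst. Qed.

Lemma all_momentsN f : all_moments f -> all_moments (fun t => - f t).
Proof. by move=> /(all_momentsZ (-1)); under eq_fun do rewrite mulN1r. Qed.

Lemma all_momentsB f g : all_moments f -> all_moments g ->
  all_moments (fun t => f t - g t).
Proof. by move=> fm /all_momentsN; exact: all_momentsD. Qed.

Lemma all_moments_indic (A : set T) : measurable A ->
  all_moments (\1_A : T -> R).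
Proof.
move=> mA; split; first exact: measurable_indic.
case=> [|n]; first by under eq_fun do rewrite expr0; exact: (all_moments_cst 1).2 1.
have -> : (fun t => (\1_A : T -> R) t ^+ n.+1) = \1_A.
  by apply/funext => t; rewrite indicE; case: (_ \in _); rewrite ?expr1n ?expr0n.
by apply: integrable_indic.
Qed.

Lemma all_moments_norm f : all_moments f -> all_moments (fun t => `|f t|).
Proof.
move=> fm; split; first by apply: measurableT_comp => //; exact: fm.1.
move=> n; apply: (@le_integrable _ _ _ P _ measurableT _ _ _ _ (fm.2 n)).
  apply/measurable_EFinP/measurable_funX; apply: measurableT_comp => //; exact: fm.1.
by move=> t _; rewrite /= lee_fin !normrX normr_id.
Qed.

(* Both [f^+] and [f^-] are half the sum or difference of [f] and [|f|]. *)
Lemma maxr0E (x : R) : Num.max x 0 = 2^-1 * (x + `|x|).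
Proof. by case: (leP 0 x) => h; [rewrite ger0_norm//|rewrite ltr0_norm//]; lra. Qed.

Lemma all_moments_max0 f : all_moments f -> all_moments (fun t => Num.max (f t) 0).
Proof.
move=> fm; under eq_fun do rewrite maxr0E.
by apply/all_momentsZ/all_momentsD => //; exact: all_moments_norm.
Qed.

Definition Ex f : R := \int[P]_t f t.

Lemma ExD f g : all_moments f -> all_moments g ->
  Ex (fun t => f t + g t) = Ex f + Ex g.
Proof.
by move=> fm gm; apply: RintegralD => //; exact: all_moments_integrable.
Qed.

Lemma ExB f g : all_moments f -> all_moments g ->
  Ex (fun t => f t - g t) = Ex f - Ex g.
Proof.
by move=> fm gm; apply: RintegralB => //; exact: all_moments_integrable.
Qed.

Lemma ExZ k f : all_moments f -> Ex (fun t => k * f t) = k * Ex f.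
Proof. by move=> fm; apply: RintegralZl => //; exact: all_moments_integrable. Qed.

Lemma Ex_cst k : Ex (cst k) = k.
Proof. by rewrite /Ex Rintegral_cst//= probability_setT /= mulr1. Qed.

Lemma Ex_indic (A : set T) : measurable A -> Ex \1_A = fine (P A).
Proof. by move=> mA; rewrite /Ex /Rintegral integral_indic// setIT. Qed.

End all_moments.

Import HBNNSimple.

(** * Factorization of expectations under independence *)

Section independence_step.
Context (R : realType) (d : measure_display) (T : measurableType d).
Variable P : probability T R.
Implicit Types f g h u : T -> R.

Lemma all_moments_sum (I : Type) (r : seq I) (F : I -> T -> R) :
  (forall i, all_moments P (F i)) ->
  all_moments P (fun t => \sum_(i <- r) F i t).
Proof.
move=> Fm; elim: r => [|i r IH].
  by under eq_fun do rewrite big_nil; exact: all_moments_cst.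
by under eq_fun do rewrite big_cons; exact: all_momentsD.
Qed.

Lemma Ex_sum (I : Type) (r : seq I) (F : I -> T -> R) :
  (forall i, all_moments P (F i)) ->
  Ex P (fun t => \sum_(i <- r) F i t) = \sum_(i <- r) Ex P (F i).
Proof.
move=> Fm; elim: r => [|i r IH].
  by under eq_fun do rewrite big_nil; rewrite big_nil; exact: Ex_cst.
under eq_fun do rewrite big_cons; rewrite big_cons ExD ?IH//.
exact: all_moments_sum.
Qed.

Lemma Ex_dominated_cvg (f_ : nat -> T -> R) f g :
  (forall n, measurable_fun setT (f_ n)) -> measurable_fun setT f ->
  (forall t, f_ n t @[n --> \oo] --> f t) ->
  P.-integrable setT (EFin \o g) -> (forall n t, `|f_ n t| <= g t) ->
  Ex P (f_ n) @[n --> \oo] --> Ex P f.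
Proof.
move=> mf_ mf f_f ig f_g.
have [] := @dominated_convergence _ _ _ P setT measurableT
    (fun n => EFin \o f_ n) (EFin \o f) (EFin \o g).
- by move=> n; apply/measurable_EFinP.
- exact/measurable_EFinP.
- by apply/aeW => t _; apply/fine_cvgP; split; [exact: nearW|exact: f_f].
- exact: ig.
- by apply/aeW => t n _ /=; rewrite lee_fin.
move=> fi _ cvgf.
apply: fine_cvg; rewrite fineK; first exact: cvgf.
exact: integrable_fin_num.
Qed.

(** The hypothesis tests [h] only against events of [u]. Simple approximations of [u] are
    combinations of such events, and dominated convergence with bound [|h u|] passes to the limit.
    Since [h] stays arbitrary, factors can be separated one at a time. *)
Let ExM_indep_ge0 h u : all_moments P h -> all_moments P u ->
  (forall t, 0 <= u t) ->
  (forall B : set R, measurable B ->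
    Ex P (fun t => h t * \1_(u @^-1` B) t) = Ex P h * Ex P \1_(u @^-1` B)) ->
  Ex P (fun t => h t * u t) = Ex P h * Ex P u.
Proof.
move=> hm um u0 hu.
pose f (x : R) := (Num.max x 0)%:E.
have mf : measurable_fun (setT : set R) f.
  by apply/measurable_EFinP/measurable_maxr.
have f0 (x : R) : setT x -> (0 <= f x)%E.
  by move=> _; rewrite /f lee_fin le_max lexx orbT.
pose s n : R -> R := nnsfun_approx measurableT mf n.
have s0 n x : 0 <= s n x by exact: fun_ge0.
have sle n t : s n (u t) <= u t.
  have := @le_approx _ _ _ setT f n (u t) f0 I.
  by rewrite -(nnsfun_approxE measurableT mf) /f lee_fin max_l.
have scvg t : s n (u t) @[n --> \oo] --> u t.
  have := @cvg_nnsfun_approx _ _ _ _ measurableT f mf f0 (u t) I.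
  by move=> /fine_cvgP[_]; rewrite /f/= max_l.
have ms n : measurable_fun setT (fun t => s n (u t)).
  by apply: measurableT_comp; [exact: measurable_funP|exact: um.1].
have uB (B : set R) : measurable B -> measurable (u @^-1` B).
  by move=> mB; rewrite -[X in measurable X]setTI; exact: um.1.
have sm n : exists (m : nat) (y : 'I_m -> R) (B : 'I_m -> set R),
    (forall i, measurable (B i)) /\
    forall x, s n x = \sum_(i < m) y i * \1_(B i) x.
  eexists; eexists; eexists; split; last first.
    by move=> x; rewrite /s fimfunEord.
  move=> i /=; apply: measurable_funPTI; exact: measurable_set1.
have Esn n : Ex P (fun t => h t * s n (u t)) = Ex P h * Ex P (fun t => s n (u t)).
  have [m [y [B [mB sE]]]] := sm n.
  under eq_fun do rewrite sE mulr_sumr.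
  under [X in _ = _ * Ex P X]eq_fun do rewrite sE.
  have Bm i : all_moments P (fun t => \1_(B i) (u t) : R).
    by apply: (@all_moments_indic _ _ _ P (u @^-1` (B i))); apply: uB.
  have Bm' i : all_moments P (fun t => y i * \1_(B i) (u t)) by exact: all_momentsZ.
  have {}hu i : Ex P (fun t => h t * \1_(B i) (u t)) =
    Ex P h * Ex P (fun t => \1_(B i) (u t)) by exact: hu.
  rewrite Ex_sum; last by move=> i; exact: all_momentsM.
  rewrite Ex_sum//.
  rewrite mulr_sumr; apply: eq_bigr => i _.
  rewrite ExZ ?Bm// mulrCA -hu// -ExZ; last exact: all_momentsM.
  by congr Ex; apply/funext => t; rewrite mulrCA.
have c1 : Ex P (fun t => h t * s n (u t)) @[n --> \oo] --> Ex P (fun t => h t * u t).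
  apply: (@Ex_dominated_cvg _ _ (fun t => `|h t * u t|)).
  - by move=> n; apply: measurable_funM => //; exact: hm.1.
  - exact: (all_momentsM hm um).1.
  - by move=> t; apply: cvgM; [exact: cvg_cst|exact: scvg].
  - exact/all_moments_integrable/all_moments_norm/all_momentsM.
  - by move=> n t; rewrite !normrM ler_wpM2l// !ger0_norm.
have c2 : Ex P (fun t => h t * s n (u t)) @[n --> \oo] --> Ex P h * Ex P u.
  under eq_fun do rewrite Esn.
  apply: cvgM; first exact: cvg_cst.
  apply: (@Ex_dominated_cvg _ _ u) => //; first exact: um.1.
    exact/all_moments_integrable.
  by move=> n t; rewrite ger0_norm.
by rewrite -(cvg_lim _ c1)// (cvg_lim _ c2).
Qed.

(** The positive and negative parts of [u] are functions of [u], so their events are events of [u]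
    and the nonnegative case applies to both. *)
Lemma ExM_indep h u : all_moments P h -> all_moments P u ->
  (forall B : set R, measurable B ->
    Ex P (fun t => h t * \1_(u @^-1` B) t) = Ex P h * Ex P \1_(u @^-1` B)) ->
  Ex P (fun t => h t * u t) = Ex P h * Ex P u.
Proof.
move=> hm um hu.
pose p (a : R) t := Num.max (a * u t) 0.
have pm a : all_moments P (p a) by exact/all_moments_max0/all_momentsZ.
have Ep a : Ex P (fun t => h t * p a t) = Ex P h * Ex P (p a).
  apply: ExM_indep_ge0 => // [t|B mB]; first by rewrite le_max lexx orbT.
  pose q (x : R) := Num.max (a * x) 0.
  have -> : p a @^-1` B = u @^-1` (q @^-1` B) by [].
  apply: hu; rewrite -[X in measurable X]setTI.
  by apply: measurable_maxr => //; exact: measurable_funM.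
have uE : u = fun t => p 1 t - p (-1) t.
  by apply/funext => t; rewrite /p mul1r mulN1r; case: (leP 0 (u t)) => h0;
    [rewrite max_r ?subr0 ?oppr_le0// | rewrite max_l ?sub0r ?opprK// ltW ?oppr_gt0].
rewrite [in RHS]uE ExB// mulrBr -!Ep -ExB; do ?exact: all_momentsM.
by congr Ex; apply/funext => t; rewrite -mulrBr; congr (_ * _); rewrite {1}uE.
Qed.

End independence_step.

Section complex_expectation.
Context (R : realType) (d : measure_display) (T : measurableType d).
Variable P : probability T R.
Implicit Types Z W h : T -> R[i].

Definition all_cmoments Z :=
  all_moments P (fun t => complex.Re (Z t)) /\
  all_moments P (fun t => complex.Im (Z t)).

Lemma CexpectationE Z : Cexpectation P Z =
  Ex P (fun t => complex.Re (Z t)) +i* Ex P (fun t => complex.Im (Z t)).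
Proof. by rewrite /Cexpectation unlock. Qed.

Lemma ReM (x y : R[i]) : complex.Re (x * y) =
  complex.Re x * complex.Re y - complex.Im x * complex.Im y.
Proof. by case: x => a b; case: y. Qed.

Lemma ImM (x y : R[i]) : complex.Im (x * y) =
  complex.Re x * complex.Im y + complex.Im x * complex.Re y.
Proof. by case: x => a b; case: y. Qed.

Lemma ReD (x y : R[i]) : complex.Re (x + y) = complex.Re x + complex.Re y.
Proof. by case: x => a b; case: y. Qed.

Lemma ImD (x y : R[i]) : complex.Im (x + y) = complex.Im x + complex.Im y.
Proof. by case: x => a b; case: y. Qed.

Lemma complex_eqP (x y : R[i]) :
  complex.Re x = complex.Re y -> complex.Im x = complex.Im y -> x = y.
Proof. by case: x => a b; case: y => a' b' /= -> ->. Qed.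

Lemma all_cmoments_cst z : all_cmoments (cst z).
Proof. by split; exact: all_moments_cst. Qed.

Lemma all_cmomentsD Z W : all_cmoments Z -> all_cmoments W ->
  all_cmoments (fun t => Z t + W t).
Proof.
move=> [Zr Zi] [Wr Wi]; split.
  by under eq_fun do rewrite ReD; exact: all_momentsD.
by under eq_fun do rewrite ImD; exact: all_momentsD.
Qed.

Lemma all_cmomentsM Z W : all_cmoments Z -> all_cmoments W ->
  all_cmoments (fun t => Z t * W t).
Proof.
move=> [Zr Zi] [Wr Wi]; split.
  by under eq_fun do rewrite ReM; apply: all_momentsB; exact: all_momentsM.
by under eq_fun do rewrite ImM; apply: all_momentsD; exact: all_momentsM.
Qed.

Lemma all_cmomentsZ k Z : all_cmoments Z -> all_cmoments (fun t => k * Z t).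
Proof. by apply: all_cmomentsM; exact: all_cmoments_cst. Qed.

Lemma all_cmoments_prod (I : Type) (r : seq I) (p : pred I) (F : I -> T -> R[i]) :
  (forall i, all_cmoments (F i)) ->
  all_cmoments (fun t => \prod_(i <- r | p i) F i t).
Proof.
move=> Fm; elim: r => [|i r IH].
  by under eq_fun do rewrite big_nil; exact: all_cmoments_cst.
by under eq_fun do rewrite big_cons; case: (p i) => //; exact: all_cmomentsM.
Qed.

Lemma all_cmomentsX Z n : all_cmoments Z -> all_cmoments (fun t => Z t ^+ n).
Proof.
move=> Zm; elim: n => [|n IH]; first exact: all_cmoments_cst.
by under eq_fun do rewrite exprS; exact: all_cmomentsM.
Qed.

Lemma all_cmoments_real f : all_moments P f -> all_cmoments (fun t => (f t)%:C).
Proof. by move=> fm; split => //; exact: all_moments_cst. Qed.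

Lemma CexpectationD Z W : all_cmoments Z -> all_cmoments W ->
  Cexpectation P (fun t => Z t + W t) = Cexpectation P Z + Cexpectation P W.
Proof.
move=> [Zr Zi] [Wr Wi]; rewrite !CexpectationE.
under [X in Ex P X +i* _]eq_fun do rewrite ReD.
under [X in _ +i* Ex P X]eq_fun do rewrite ImD.
by rewrite !ExD.
Qed.

Lemma Cexpectation_cst z : Cexpectation P (cst z) = z.
Proof. by rewrite CexpectationE !Ex_cst; case: z. Qed.

Lemma CexpectationZ k Z : all_cmoments Z ->
  Cexpectation P (fun t => k * Z t) = k * Cexpectation P Z.
Proof.
move=> [Zr Zi]; rewrite !CexpectationE.
under [X in Ex P X +i* _]eq_fun do rewrite ReM.
under [X in _ +i* Ex P X]eq_fun do rewrite ImM.
rewrite ExB ?ExD; do ?exact: all_momentsZ.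
by rewrite !ExZ//; apply: complex_eqP; rewrite ?ReM ?ImM.
Qed.

Lemma Cexpectation_real f : Cexpectation P (fun t => (f t)%:C) = (Ex P f)%:C.
Proof. by rewrite CexpectationE (Ex_cst P 0). Qed.

(** A complex product is made of four real ones. Cylinders over the two coordinates are Borel sets
    of the plane, so the hypothesis covers the events of the real and of the imaginary part of
    [Z]. *)
Lemma CexpectationM_indep h Z : all_cmoments h -> all_cmoments Z ->
  (forall B, measurable B ->
    Cexpectation P (fun t => h t * (\1_((@ReIm R \o Z) @^-1` B) t)%:C) =
    Cexpectation P h * (Ex P \1_((@ReIm R \o Z) @^-1` B))%:C) ->
  Cexpectation P (fun t => h t * Z t) = Cexpectation P h * Cexpectation P Z.
Proof.
move=> [hr hi] [Zr Zi] hZ.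
have hZ' B : measurable B ->
    Ex P (fun t => complex.Re (h t) * \1_((@ReIm R \o Z) @^-1` B) t) =
      Ex P (fun t => complex.Re (h t)) * Ex P \1_((@ReIm R \o Z) @^-1` B) /\
    Ex P (fun t => complex.Im (h t) * \1_((@ReIm R \o Z) @^-1` B) t) =
      Ex P (fun t => complex.Im (h t)) * Ex P \1_((@ReIm R \o Z) @^-1` B).
  move=> mB; have := hZ B mB; rewrite !CexpectationE.
  under [X in Ex P X +i* _]eq_fun do rewrite ReM /= mulr0 subr0.
  under [X in _ +i* Ex P X = _]eq_fun do rewrite ImM /= mulr0 add0r.
  by case; rewrite !mulr0 subr0 add0r.
have mfst (B : set R) : measurable B ->
    measurable ((fst : measurableTypeR R * measurableTypeR R -> _) @^-1` B).
  by move=> mB; rewrite -[X in measurable X]setTI; exact: measurable_fst.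
have msnd (B : set R) : measurable B ->
    measurable ((snd : measurableTypeR R * measurableTypeR R -> _) @^-1` B).
  by move=> mB; rewrite -[X in measurable X]setTI; exact: measurable_snd.
rewrite !CexpectationE.
under [X in Ex P X +i* _]eq_fun do rewrite ReM.
under [X in _ +i* Ex P X = _]eq_fun do rewrite ImM.
rewrite ExB ?ExD; do ?exact: all_momentsM.
have rr : Ex P (fun t => complex.Re (h t) * complex.Re (Z t)) =
    Ex P (fun t => complex.Re (h t)) * Ex P (fun t => complex.Re (Z t)).
  by apply: ExM_indep => // B /mfst /hZ' [].
have ii : Ex P (fun t => complex.Im (h t) * complex.Im (Z t)) =
    Ex P (fun t => complex.Im (h t)) * Ex P (fun t => complex.Im (Z t)).
  by apply: ExM_indep => // B /msnd /hZ' [].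
have ri : Ex P (fun t => complex.Re (h t) * complex.Im (Z t)) =
    Ex P (fun t => complex.Re (h t)) * Ex P (fun t => complex.Im (Z t)).
  by apply: ExM_indep => // B /msnd /hZ' [].
have ir : Ex P (fun t => complex.Im (h t) * complex.Re (Z t)) =
    Ex P (fun t => complex.Im (h t)) * Ex P (fun t => complex.Re (Z t)).
  by apply: ExM_indep => // B /mfst /hZ' [].
by rewrite rr ii ri ir; apply: complex_eqP; rewrite ?ReM ?ImM.
Qed.

Section product.
Variables (I : finType) (F : I -> set (set T)) (f : I -> T -> R[i]).
Hypothesis indepF : mutually_independent P F.
Hypothesis measF : forall i A, F i A -> measurable A.
Hypothesis fm : forall i, all_cmoments (f i).
Hypothesis fF : forall i B, measurable B -> F i ((@ReIm R \o f i) @^-1` B).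

(** Mixed form for the induction: the factors of [r] are still functions, those of [J] are already
    events. Splitting off [f i] tests the rest against an event of [f i], which moves [i] from [r]
    into [J]. *)
Let Cexpectation_prod_indic (r : seq I) (J : {set I}) (A : I -> set T) :
  uniq r -> {in r, forall i, i \notin J} -> (forall i, i \in J -> F i (A i)) ->
  Cexpectation P (fun t => (\prod_(i <- r) f i t) *
    (\1_(\bigcap_(i in [set` J]) A i) t)%:C) =
  (\prod_(i <- r) Cexpectation P (f i)) *
    (fine (P (\bigcap_(i in [set` J]) A i)))%:C.
Proof.
have mcap (K : {set I}) (B : I -> set T) : (forall i, i \in K -> F i (B i)) ->
    measurable (\bigcap_(i in [set` K]) B i).
  move=> KB; apply: fin_bigcap_measurable; first exact: finite_finset.
  by move=> i iK; apply: measF (KB i iK).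
elim: r J A => [|i r IH] J A /=.
  move=> _ _ AJ; rewrite big_nil mul1r.
  under eq_fun do rewrite big_nil mul1r.
  by rewrite Cexpectation_real Ex_indic//; exact: mcap.
move=> /andP[ir ur] riJ AJ.
have iJ : i \notin J by apply: riJ; rewrite inE eqxx.
have rJ : {in r, forall j, j \notin J}.
  by move=> j jr; apply: riJ; rewrite inE jr orbT.
pose h t := (\prod_(j <- r) f j t) * (\1_(\bigcap_(i in [set` J]) A i) t)%:C.
have hm : all_cmoments h.
  apply: all_cmomentsM; first exact: all_cmoments_prod.
  by apply/all_cmoments_real/all_moments_indic/mcap.
rewrite big_cons -mulrA -(IH J A)//.
under eq_fun do rewrite big_cons -mulrA mulrC.
rewrite (@CexpectationM_indep h (f i))//; first by rewrite mulrC.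
move=> B mB.
(* The family of events extended by the test event of [f i]. *)
pose A' j := if j == i then (@ReIm R \o f i) @^-1` B else A j.
have A'J j : j \in J -> A' j = A j.
  by rewrite /A'; case: eqP => // -> ; rewrite (negPf iJ).
have A'F j : j \in (i |: J)%SET -> F j (A' j).
  rewrite !inE /A'; case: eqP => [-> _|_ /= jJ]; first exact: fF.
  exact: AJ.
have capE : \bigcap_(j in [set` (i |: J)%SET]) A' j =
    \bigcap_(j in [set` J]) A j `&` (@ReIm R \o f i) @^-1` B.
  apply/seteqP; split => t /=.
    move=> h1; split=> [j jJ|].
      by rewrite -A'J//; apply: h1; rewrite /= !inE jJ orbT.
    by have := h1 i; rewrite /A' eqxx /=; apply; rewrite !inE eqxx.
  move=> [h1 h2] j; rewrite /= !inE /A'; case: eqP => [_ _|_ /= jJ] //.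
  exact: h1.
have mi : measurable ((@ReIm R \o f i) @^-1` B) by apply/measF/fF.
rewrite Ex_indic//.
have -> : (fun t => h t * (\1_((@ReIm R \o f i) @^-1` B) t)%:C) = (fun t =>
    (\prod_(j <- r) f j t) * (\1_(\bigcap_(j in [set` (i |: J)%SET]) A' j) t)%:C).
  apply/funext => t; rewrite capE indicI /h -mulrA; congr (_ * _).
  by rewrite /= rmorphM.
rewrite IH//; last first.
  move=> j jr; rewrite !inE negb_or rJ// andbT; apply: contraNneq ir => <-.
  exact: jr.
rewrite IH// -mulrA -rmorphM; congr (_ * _%:C).
have := indepF A'F; rewrite big_setU1//= => ->.
rewrite fineM ?fin_num_measure//; last 2 first.
- by rewrite /A' eqxx.
- rewrite (eq_bigr (fun j => P (A j))) ?indepF//; last by move=> j /A'J ->.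
  rewrite -indepF// fin_num_measure//; exact: mcap.
rewrite (eq_bigr (fun j => P (A j))); last by move=> j /A'J ->.
by rewrite -indepF// mulrC /A' eqxx.
Qed.

Lemma Cexpectation_prod_indep :
  Cexpectation P (fun t => \prod_i f i t) = \prod_i Cexpectation P (f i).
Proof.
have := @Cexpectation_prod_indic (index_enum I) finset.set0 (fun=> setT)
  (index_enum_uniq _).
have -> : \bigcap_(i in [set` (finset.set0 : {set I})]) [set: T] = setT.
  by apply/seteqP; split => // t _ i.
rewrite probability_setT /= mulr1 => <-; last 2 first.
- by move=> i _; rewrite inE.
- by move=> i; rewrite inE.
by congr (Cexpectation P _); apply/funext => t; rewrite indicT mulr1.
Qed.

End product.
End complex_expectation.

(** * Gaussian integration by parts *)

Section density.
Context (R : realType) (d : measure_display) (T : measurableType d).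
Variables (nu : {finite_measure set T -> \bar R})
  (mu : {sigma_finite_measure set T -> \bar R}) (h : T -> R).
Hypothesis h0 : forall x, 0 <= h x.
Hypothesis hint : mu.-integrable setT (EFin \o h).
Hypothesis nuE : forall A, measurable A -> nu A = (\int[mu]_(x in A) (h x)%:E)%E.

(** [h] and the Radon-Nikodym derivative of [nu] have the same integral over every measurable set,
    so they agree almost everywhere and the change of variables for the latter carries over. *)
Lemma ge0_integral_density (f : T -> \bar R) : measurable_fun setT f ->
  (forall x, (0 <= f x)%E) ->
  (\int[nu]_x f x = \int[mu]_x (f x * (h x)%:E))%E.
Proof.
move=> mf f0.
have numu : nu `<< mu.
  apply/null_content_dominatesP => A mA A0; rewrite nuE//.
  by apply: null_set_integral => //; apply: measurable_funTS; exact: measurable_int hint.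
rewrite -(Radon_Nikodym_SigmaFinite.change_of_variables numu f0 measurableT mf).
have intRN := Radon_Nikodym_SigmaFinite.f_integrable numu.
have mRN := measurable_int _ intRN.
have mh := measurable_int _ hint.
apply: ae_eq_integral => //; [exact: emeasurable_funM|exact: emeasurable_funM|].
have RNE : ae_eq mu setT (Radon_Nikodym_SigmaFinite.f nu mu) (EFin \o h).
  apply: integral_ae_eq => // E _ mE.
  by rewrite -Radon_Nikodym_SigmaFinite.f_integral// nuE.
by apply: filterS RNE => x /[apply] ->.
Qed.

Lemma integrable_density (f : T -> R) : measurable_fun setT f ->
  mu.-integrable setT (EFin \o (fun x => f x * h x)) ->
  nu.-integrable setT (EFin \o f).
Proof.
move=> mf /integrableP[_ fh]; apply/integrableP; split; first exact/measurable_EFinP.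
rewrite ge0_integral_density//; last first.
  by apply: measurableT_comp => //; exact/measurable_EFinP.
apply: le_lt_trans fh; rewrite le_eqVlt; apply/orP; left; apply/eqP.
by apply: eq_integral => x _ /=; rewrite normrM (ger0_norm (h0 x)) EFinM.
Qed.

Lemma Rintegral_density (f : T -> R) : measurable_fun setT f ->
  \int[nu]_x f x = \int[mu]_x (f x * h x).
Proof.
move=> mf; rewrite /Rintegral; congr fine.
have mEf : measurable_fun setT (EFin \o f) by exact/measurable_EFinP.
rewrite integralE [RHS]integralE !ge0_integral_density//; first last.
- exact: measurable_funepos.
- exact: measurable_funeneg.
congr (_ - _)%E; apply: eq_integral => x _; rewrite ?funeposE ?funenegE /=.
  by rewrite -EFin_max -EFinM maxr_pMl ?h0// mul0r EFin_max.
by rewrite -EFin_max -EFinM maxr_pMl ?h0// mul0r mulNr EFin_max.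
Qed.

End density.

Section gaussian_moments.
Context (R : realType).
Implicit Types x y : R.
Local Notation mu := (@lebesgue_measure R).

(** This is [y / k <= exp (y / k)] raised to the power [k]. *)
Lemma exprn_le_expR (k : nat) y : 0 <= y -> y ^+ k <= k%:R ^+ k * expR y.
Proof.
move=> y0; case: k => [|k]; first by rewrite !expr0 mul1r -expR0 ler_expR.
have -> : expR y = expR (y / k.+1%:R) ^+ k.+1.
  by rewrite -expRM_natl mulrC divfK// pnatr_eq0.
rewrite -exprMn; apply: lerXn2r; rewrite ?nnegrE ?mulr_ge0 ?expR_ge0//.
have := expR_ge1Dx (y / k.+1%:R) => h.
rewrite -[leLHS](@divfK _ k.+1%:R) ?pnatr_eq0// mulrC ler_wpM2l//.
by apply: le_trans h; rewrite lerDr.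
Qed.

(** Half of the exponent absorbs the polynomial, by [exprn_le_expR] at [x ^+ 2 / 2]; the other half
    is left as a multiple of the standard normal density, which is integrable. *)
Lemma gauss_moment_bound (n : nat) : exists C : R, 0 <= C /\
  forall x, `|x ^+ n * gauss_fun x| <= C * expR (- (x ^+ 2 / 2)).
Proof.
exists (1 + 2 ^+ n * n%:R ^+ n); split.
  by rewrite addr_ge0// mulr_ge0// exprn_ge0.
move=> x; rewrite /gauss_fun.
have -> : expR (- x ^+ 2) = expR (- (x ^+ 2 / 2)) * expR (- (x ^+ 2 / 2)).
  by rewrite -expRD; congr expR; lra.
rewrite mulrA normrM [`|expR _|]gtr0_norm ?expR_gt0// ler_wpM2r ?expR_ge0//.
rewrite normrM [`|expR _|]gtr0_norm ?expR_gt0// expRN ler_pdivrMr ?expR_gt0//.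
have x2 : 0 <= x ^+ 2 / 2 by rewrite divr_ge0// sqr_ge0.
have h := exprn_le_expR n x2.
have e1 : 1 <= expR (x ^+ 2 / 2) by rewrite -[leLHS]expR0 ler_expR.
have xn : `|x ^+ n| <= 1 + (x ^+ 2) ^+ n.
  by rewrite -exprM mulnC exprM; rewrite -(real_normK (num_real (x ^+ n)));
    have := normr_ge0 (x ^+ n); nra.
apply: (le_trans xn); rewrite mulrDl mul1r lerD// -mulrA.
have -> : (x ^+ 2) ^+ n = 2 ^+ n * (x ^+ 2 / 2) ^+ n.
  by rewrite -exprMn; congr (_ ^+ _); lra.
by rewrite ler_wpM2l// exprn_ge0.
Qed.

Lemma integrable_gauss_moment (n : nat) :
  mu.-integrable setT (EFin \o (fun x => x ^+ n * gauss_fun x)).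
Proof.
have [C [C0 hC]] := gauss_moment_bound n.
have p0 : 0 < normal_peak (1 : R) by exact: normal_peak_gt0.
apply: (@le_integrable _ _ _ mu _ measurableT _
  (fun x => (C / normal_peak 1)%:E * (normal_pdf 0 1 x)%:E)%E).
- apply/measurable_EFinP; apply: measurable_funM => //.
  exact: measurable_gauss_fun.
- move=> x _; rewrite /= lee_fin; apply: (le_trans (hC x)).
  apply: le_trans (ler_norm _).
  by rewrite normal_pdfE ?oner_eq0// mulrA divfK ?gt_eqF// /normal_fun subr0 expr1n mulNr.
- by apply: integrableZl => //; exact: integrable_normal_pdf.
Qed.

(** The difference [f] of the two integrands has the primitive [F], which vanishes at infinity, so
    its integrals over growing intervals tend to 0. At [n = 0] the coefficient is 0 and the
    truncated exponent is harmless. *)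
Lemma integral_gauss_moment_rec (n : nat) :
  \int[mu]_x (x ^+ n.+1 * gauss_fun x) =
  n%:R / 2 * \int[mu]_x (x ^+ n.-1 * gauss_fun x).
Proof.
pose F x : R := - 2^-1 * (x ^+ n * gauss_fun x).
pose f x : R := x ^+ n.+1 * gauss_fun x - n%:R / 2 * (x ^+ n.-1 * gauss_fun x).
have dF x : is_derive x 1 F (f x).
  have dX m : is_derive x 1 (fun y => y ^+ m) (m%:R * x ^+ m.-1).
    by apply: DeriveDef; [exact: exprn_derivable|rewrite -derive1E exp_derive1].
  have dG : is_derive x 1 (@gauss_fun R) (gauss_fun x * - (2 * x)).
    have := @is_derive1_comp _ expR (fun y => - y ^+ 2) x _ _
      (is_derive_expR _) (is_deriveN (dX 2)).
    by rewrite expr1.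
  have := is_deriveM (is_derive_cst (- 2^-1 : R) x 1) (is_deriveM (dX n) dG).
  move/is_derive_eq; apply; rewrite scaler0 addr0 /f /cst /GRing.scale /= exprS.
  by field.
have cf : continuous f.
  move=> x; apply: cvgB; first by apply: cvgM; [exact: exprn_continuous|exact: continuous_gauss_fun].
  apply: cvgM; first exact: cvg_cst.
  by apply: cvgM; [exact: exprn_continuous|exact: continuous_gauss_fun].
have fint : mu.-integrable setT (EFin \o f).
  have := @integrableB _ _ _ mu _ measurableT _ _ (integrable_gauss_moment n.+1)
    (@integrableZl _ _ _ mu _ measurableT (n%:R / 2) _ (integrable_gauss_moment n.-1)).
  by apply: eq_integrable.
have f0 : \int[mu]_x f x = 0.
  (* The bound [k.+1] keeps every interval nondegenerate for the fundamental theorem of calculus. *)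
  pose g (k : nat) := (EFin \o f) \_ `[(- (k.+1%:R) : R), k.+1%:R].
  have [] := @dominated_convergence _ _ _ mu setT measurableT g (EFin \o f)
     (abse \o (EFin \o f)).
  - move=> k; apply/(measurable_restrictT _ _).1 => //.
    by apply: measurable_funTS; exact: measurable_int fint.
  - exact: measurable_int fint.
  - apply/aeW => x _; apply: cvg_near_cst; near=> k.
    rewrite /g patchE ifT// inE /= in_itv/= -ler_norml.
    apply: (@le_trans _ _ k%:R); last by rewrite ler_nat.
    by near: k; exact: nbhs_infty_ger.
  - exact: integrable_abse.
  - apply/aeW => x k _; rewrite /g patchE /=; case: ifP => // _.
    by rewrite abse0.
  move=> _ _ cvg1.
  have cvg2 : (\int[mu]_x g k x)%E @[k --> \oo] --> 0%E.
    have gE k : (\int[mu]_x g k x = (F k.+1%:R - F (- k.+1%:R))%:E)%E.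
      rewrite -integral_mkcond.
      rewrite (@continuous_FTC2 _ f F); last 1 first.
      - by move=> x _; rewrite derive1E; apply: derive_val.
      - by rewrite EFinB.
      - by have : 0 < k.+1%:R :> R by []; lra.
      - exact: continuous_subspaceT.
      - split.
        + by move=> x _; exact: ex_derive.
        + by apply: cvg_at_right_filter; apply: differentiable_continuous; exact/derivable1_diffP.
        + by apply: cvg_at_left_filter; apply: differentiable_continuous; exact/derivable1_diffP.
    under eq_fun do rewrite gE.
    apply: cvg_EFin; first exact: nearW.
    (* The bound for the next power controls [x * F x], so [F] decays at least like [1 / |x|]. *)
    have [C [C0 hC]] := gauss_moment_bound n.+1.
    apply/norm_cvg0P.
    apply: (@squeeze_cvgr _ _ _ _ (cst 0) (fun k => C * k.+1%:R^-1)).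
    + apply: nearW => k; rewrite normr_ge0 /=.
      have b x : x != 0 -> `|F x| <= 2^-1 * (C * `|x|^-1).
        move=> x0; rewrite /F normrM normrN [X in X * _ <= _]ger0_norm//.
        apply: ler_wpM2l => //.
        rewrite ler_pdivlMr ?normr_gt0// -normrM mulrC mulrA -exprS.
        apply: (le_trans (hC x)); rewrite ler_piMr// -expR0 ler_expR oppr_le0.
        by rewrite divr_ge0// sqr_ge0.
      apply: (le_trans (ler_normB _ _)).
      have kN : `|k.+1%:R : R| = k.+1%:R by exact: ger0_norm.
      have := b (- k.+1%:R); rewrite normrN kN oppr_eq0 pnatr_eq0 => /(_ isT).
      have := b k.+1%:R; rewrite kN pnatr_eq0 => /(_ isT).
      by move=> b1 b2; have := lerD b1 b2; congr (_ <= _); field; rewrite nat1r pnatr_eq0.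
    + exact: cvg_cst.
    + rewrite -[X in _ --> X](mulr0 C); apply: cvgM; first exact: cvg_cst.
      exact: cvg_harmonic.
  have := cvg_unique _ cvg1 cvg2 => h; rewrite /Rintegral.
  by have -> : (\int[mu]_x (f x)%:E = 0)%E by exact: h.
move: f0; rewrite RintegralB//; last 2 first.
- exact: integrable_gauss_moment.
- have := (@integrableZl _ _ _ mu _ measurableT (n%:R / 2) _ (integrable_gauss_moment n.-1)).
  by apply: eq_integrable.
rewrite RintegralZl//; last exact: integrable_gauss_moment.
by move/eqP; rewrite subr_eq0 => /eqP.
Unshelve. all: by end_near. Qed.

End gaussian_moments.

Section law.
Context (R : realType) (d : measure_display) (T : measurableType d).
Variable P : probability T R.

Lemma law_integral (X : T -> measurableTypeR R)
    (nu : probability (measurableTypeR R) R) (f : R -> R) :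
  measurable_fun setT X -> (forall B, measurable B -> P (X @^-1` B) = nu B) ->
  measurable_fun setT f -> nu.-integrable setT (EFin \o f) ->
  P.-integrable setT (EFin \o (f \o X)) /\ Ex P (f \o X) = \int[nu]_x f x.
Proof.
move=> mX lawX mf intf.
have mEf : measurable_fun setT (EFin \o f : measurableTypeR R -> _).
  exact/measurable_EFinP.
have pushE (h : R -> \bar R) : (\int[nu]_x h x = \int[pushforward P X]_x h x)%E.
  by apply: eq_measure_integral => A mA _; exact/esym/lawX.
have intP : P.-integrable setT (EFin \o (f \o X)).
  apply/integrableP; split; first by apply/measurable_EFinP; exact: measurableT_comp.
  have /integrableP[_] := intf; rewrite pushE ge0_integral_pushforward//.
  exact: measurableT_comp.
split => //; rewrite /Ex /Rintegral; congr fine.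
by rewrite pushE integral_pushforward.
Qed.

End law.

Section complex_gaussian.
Context (R : realType).
Local Notation sigma := (Num.sqrt 2^-1 : R).
Local Notation gauss := (normal_prob (0 : R) sigma).
Local Notation mu := (@lebesgue_measure R).

Definition gauss_moment (n : nat) : R := \int[gauss]_x (x ^+ n).

(** Variance 1/2 makes the density a multiple of [exp (- x ^+ 2)]; it is also the origin of the
    factor 1/2 in the moment recursion. *)
Let pdfE x : normal_pdf 0 sigma x = normal_peak sigma * gauss_fun x.
Proof.
rewrite normal_pdfE// /normal_fun subr0 sqr_sqrtr ?invr_ge0//.
by rewrite -[2^-1 *+ 2]mulr_natr mulVf ?pnatr_eq0// divr1.
Qed.

Lemma integrable_normal_moment n :
  gauss.-integrable setT (EFin \o (fun x : R => x ^+ n)).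
Proof.
apply: (@integrable_density R _ _ gauss mu (normal_pdf 0 sigma)) => //.
- exact: normal_pdf_ge0.
- exact: integrable_normal_pdf.
have := @integrableZl _ _ _ mu _ measurableT (normal_peak sigma) _ (integrable_gauss_moment R n).
by apply: eq_integrable => // x _ /=; rewrite pdfE -EFinM mulrCA.
Qed.

Lemma gauss_momentE n :
  gauss_moment n = normal_peak sigma * \int[mu]_x (x ^+ n * gauss_fun x).
Proof.
rewrite /gauss_moment.
rewrite (@Rintegral_density R _ _ gauss mu (normal_pdf 0 sigma))//; last 2 first.
- exact: normal_pdf_ge0.
- exact: integrable_normal_pdf.
rewrite -RintegralZl//; last exact: integrable_gauss_moment.
by apply: eq_Rintegral => x _; rewrite pdfE mulrCA.
Qed.

Lemma gauss_moment_rec n : gauss_moment n.+1 = n%:R / 2 * gauss_moment n.-1.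
Proof. by rewrite !gauss_momentE integral_gauss_moment_rec mulrCA. Qed.

Section entry.
Context (d : measure_display) (T : measurableType d) (P : probability T R).
Variable g : T -> R[i].
Hypothesis gG : std_complex_gaussian P g.

Let X t := complex.Re (g t).
Let Y t := complex.Im (g t).

Let mXY : measurable_fun setT X /\ measurable_fun setT Y.
Proof. by have [+ _] := gG => /measurable_fun_pairP. Qed.

Let XYE (A B : set R) : measurable A -> measurable B ->
  P ((X @^-1` A) `&` (Y @^-1` B)) = (gauss A * gauss B)%E.
Proof.
move=> mA mB; have := gG.2 (A `*` B) (measurableX mA mB).
by rewrite product_measure1E.
Qed.

Let XE (A : set R) : measurable A -> P (X @^-1` A) = gauss A.
Proof.
move=> mA; have := XYE mA (@measurableT _ (measurableTypeR R)).
by rewrite preimage_setT setIT probability_setT mule1.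
Qed.

Let YE (A : set R) : measurable A -> P (Y @^-1` A) = gauss A.
Proof.
move=> mA; have := XYE (@measurableT _ (measurableTypeR R)) mA.
by rewrite preimage_setT setTI probability_setT mul1e.
Qed.

Lemma all_cmoments_gaussian : all_cmoments P g.
Proof.
split; split.
- exact: mXY.1.
- by move=> n; apply: (law_integral mXY.1 XE _ (integrable_normal_moment n)).1.
- exact: mXY.2.
- by move=> n; apply: (law_integral mXY.2 YE _ (integrable_normal_moment n)).1.
Qed.

Lemma Ex_gaussian_monomial (p q : nat) :
  Ex P (fun t => complex.Re (g t) ^+ p * complex.Im (g t) ^+ q) =
  gauss_moment p * gauss_moment q.
Proof.
have [Xm Ym] := all_cmoments_gaussian.
have pX (B : set R) : measurable B -> measurable (X @^-1` B).
  by move=> mB; rewrite -[X in measurable X]setTI; exact: mXY.1.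
have pY (B : set R) : measurable B -> measurable (Y @^-1` B).
  by move=> mB; rewrite -[X in measurable X]setTI; exact: mXY.2.
have pow n (B : set R) : measurable B -> measurable ((fun x : R => x ^+ n) @^-1` B).
  by move=> mB; rewrite -[X in measurable X]setTI; exact: exprn_measurable.
rewrite (@ExM_indep _ _ _ P (fun t => X t ^+ p) (fun t => Y t ^+ q));
  [|exact: all_momentsX|exact: all_momentsX|].
  congr (_ * _).
    exact: (law_integral mXY.1 XE _ (integrable_normal_moment p)).2.
  exact: (law_integral mXY.2 YE _ (integrable_normal_moment q)).2.
(* A second use of the factorization, with the roles exchanged, reduces the real part to its events
   too; for two events the claim is the product law. *)
move=> B mB; under eq_fun do rewrite mulrC.
rewrite (@ExM_indep _ _ _ P _ (fun t => X t ^+ p));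
  [by rewrite mulrC| |exact: all_momentsX|].
  by apply: all_moments_indic; exact: (pY _ (pow q _ mB)).
move=> A mA.
have mA' := pX _ (pow p _ mA); have mB' := pY _ (pow q _ mB).
have -> : (fun t => \1_((fun t0 => Y t0 ^+ q) @^-1` B) t *
    \1_((fun t0 => X t0 ^+ p) @^-1` A) t) =
    \1_((X @^-1` ((fun x => x ^+ p) @^-1` A)) `&`
        (Y @^-1` ((fun x => x ^+ q) @^-1` B))) :> (T -> R).
  by apply/funext => t; rewrite indicI /= mulrC.
rewrite !Ex_indic//; last exact: measurableI.
rewrite XYE ?fineM ?fin_num_measure//; do ?exact: pow.
by rewrite mulrC; congr (fine _ * fine _); apply/esym; [apply: YE|apply: XE]; exact: pow.
Qed.

End entry.
End complex_gaussian.

Lemma big_prod_type (S : Type) (idx : S) (op : Monoid.com_law idx)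
    (A B : finType) (F : A * B -> S) :
  \big[op/idx]_q F q = \big[op/idx]_a \big[op/idx]_b F (a, b).
Proof. by rewrite pair_bigA; apply: eq_bigr => -[]. Qed.

Section derivation.
Variables (B : comNzRingType) (D : B -> B).
Hypothesis DM : forall a b, D (a * b) = D a * b + a * D b.

Lemma derivation1 : D 1 = 0.
Proof. by apply: (addrI (D 1)); rewrite addr0 -{3}[1]mulr1 DM mulr1 mul1r. Qed.

Lemma derivationX a n : D (a ^+ n) = n%:R * D a * a ^+ n.-1.
Proof.
elim: n => [|n IH]; first by rewrite expr0 derivation1 mul0r mul0r.
rewrite exprS DM IH; case: n {IH} => [|n]; first by rewrite /= !mul0r !mulr0 addr0 !mul1r.
by rewrite [n.+2%:R]mulrS mulrDl mul1r mulrDl /= exprS; ring.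
Qed.

Lemma derivation_prod_uniq (J : eqType) (r : seq J) (f : J -> B) : uniq r ->
  D (\prod_(i <- r) f i) = \sum_(i <- r) D (f i) * \prod_(j <- r | j != i) f j.
Proof.
elim: r => [|i r IH] /=; first by rewrite !big_nil derivation1.
move=> /andP[ir ur]; rewrite !big_cons eqxx DM IH//=; congr (_ * _ + _).
  rewrite [RHS]big_seq_cond [LHS]big_seq; apply: eq_bigl => j.
  by rewrite andbC; case: eqP => //= ->; rewrite (negPf ir).
rewrite mulr_sumr [RHS]big_seq [LHS]big_seq; apply: eq_bigr => j jr.
rewrite big_cons; case: eqP => [ij|_]; first by move: ir; rewrite ij jr.
exact: mulrCA.
Qed.

(** Where [m q] is 0, the truncated exponent does not matter: the coefficient vanishes. *)
Lemma derivation_monomial (J : finType) (x : J -> B) (m : J -> nat) :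
  D (\prod_q x q ^+ m q) = \sum_q (m q)%:R * D (x q) *
    \prod_q' x q' ^+ (m q' - (q' == q)).
Proof.
rewrite derivation_prod_uniq ?index_enum_uniq//; apply: eq_bigr => q _.
rewrite derivationX -mulrA; congr (_ * _).
rewrite [RHS](bigD1 q)//= eqxx subn1; congr (_ * _).
by apply: eq_bigr => q' /negPf ->; rewrite subn0.
Qed.

End derivation.

(** * Formal polynomials in the entries and their derivatives *)

Section formal_polynomials.
Import -(notations) mpoly.
Variables (K : comNzRingType) (J : finType).

(** Random entries cannot be differentiated in, formal variables can: a polynomial is differentiated
    here and then evaluated at the entries. Variables are named by a finite type, so that pairs of
    indices can be used directly. *)
Definition fpoly := mpoly #|J| K.
HB.instance Definition _ := GRing.ComNzRing.on fpoly.
HB.instance Definition _ := GRing.ComAlgebra.on fpoly.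
Definition fvar (q : J) : fpoly := mpolyX K (mnm1 (enum_rank q)).
Definition fconst (k : K) : fpoly := mpolyC #|J| k.
Definition fder (q : J) (p : fpoly) : fpoly := mderiv (enum_rank q) p.
Definition feval (v : J -> K) (p : fpoly) : K := meval (fun i => v (enum_val i)) p.

Lemma fder_linear q k (p p' : fpoly) : fder q (k *: p + p') = k *: fder q p + fder q p'.
Proof. exact: linearP. Qed.
HB.instance Definition _ q :=
  GRing.isLinear.Build K fpoly fpoly _ (fder q) (@fder_linear q).

Lemma fderM q (p p' : fpoly) : fder q (p * p') = fder q p * p' + p * fder q p'.
Proof. exact: mderivM. Qed.

Lemma fder_var q q' : fder q (fvar q') = fconst (q == q')%:R.
Proof.
rewrite /fder /fvar mderivX mnm1E (inj_eq enum_rank_inj) eq_sym.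
case: eqP => [->|_]; last by rewrite scale0r /fconst mpolyC0.
rewrite (_ : mnm_sub _ _ = mnm0); first by rewrite mpolyX0 scale1r /fconst mpolyC1.
by apply/mnmP => k; rewrite mnmBE mnmE subnn mnm0E.
Qed.

Lemma fder_const q k : fder q (fconst k) = 0.
Proof. exact: mderivC. Qed.

Lemma fconstE k : fconst k = k *: 1.
Proof. by rewrite /fconst -mul_mpolyC mulr1. Qed.

Lemma fconst0 : fconst 0 = 0. Proof. exact: mpolyC0. Qed.

Lemma fconst1 : fconst 1 = 1. Proof. exact: mpolyC1. Qed.

Lemma fconst_nat n : fconst n%:R = n%:R.
Proof. exact: mpolyC_nat. Qed.

Lemma feval_var v q : feval v (fvar q) = v q.
Proof. by rewrite /feval /fvar mevalXU enum_rankK. Qed.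

Lemma feval_const v k : feval v (fconst k) = k.
Proof. exact: mevalC. Qed.

Lemma fevalM v (p p' : fpoly) : feval v (p * p') = feval v p * feval v p'.
Proof. exact: mevalM. Qed.

Lemma fevalP v k (p p' : fpoly) : feval v (k *: p + p') = k * feval v p + feval v p'.
Proof. by rewrite /feval mevalD mevalZ. Qed.

Lemma feval0 v : feval v 0 = 0. Proof. exact: meval0. Qed.

Lemma feval1 v : feval v 1 = 1. Proof. exact: meval1. Qed.

Lemma fevalZ v k (p : fpoly) : feval v (k *: p) = k * feval v p.
Proof. by rewrite -[_ *: _]addr0 fevalP feval0 addr0. Qed.

Lemma fevalD v (p p' : fpoly) : feval v (p + p') = feval v p + feval v p'.
Proof. by rewrite -[p in LHS]scale1r fevalP mul1r. Qed.

Lemma feval_sum v (I : Type) (r : seq I) (F : I -> fpoly) :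
  feval v (\sum_(i <- r) F i) = \sum_(i <- r) feval v (F i).
Proof. exact: (big_morph _ (fevalD v) (feval0 v)). Qed.

Lemma fevalX v (p : fpoly) n : feval v (p ^+ n) = feval v p ^+ n.
Proof. by elim: n => [|n IH]; rewrite ?expr0 ?feval1// !exprS fevalM IH. Qed.

Lemma feval_prod v (I : Type) (r : seq I) (F : I -> fpoly) :
  feval v (\prod_(i <- r) F i) = \prod_(i <- r) feval v (F i).
Proof. exact: (big_morph _ (fevalM v) (feval1 v)). Qed.

Lemma fpoly_ind (Q : fpoly -> Prop) :
  Q 0 -> (forall k p p', Q p -> Q p' -> Q (k *: p + p')) ->
  (forall m : J -> nat, Q (\prod_q fvar q ^+ m q)) -> forall p, Q p.
Proof.
move=> Q0 QP Qm p; rewrite [p]mpolyE; elim: (msupp p) => [|m r IH].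
  by rewrite big_nil.
rewrite big_cons; apply: QP => //.
have -> : mpolyX K m = \prod_(q : J) fvar q ^+ m (enum_rank q).
  rewrite mpolyXE_id (reindex (@enum_rank J))//=.
  by exists enum_val => i _; rewrite ?enum_rankK ?enum_valK.
exact: Qm.
Qed.

Lemma fpoly_span (L L' : fpoly -> K) :
  (forall k p p', L (k *: p + p') = k * L p + L p') ->
  (forall k p p', L' (k *: p + p') = k * L' p + L' p') ->
  (forall m : J -> nat, L (\prod_q fvar q ^+ m q) = L' (\prod_q fvar q ^+ m q)) ->
  forall p, L p = L' p.
Proof.
move=> Ll L'l LL'; apply: fpoly_ind => // [|k p p' e e'].
  have L0 (H : fpoly -> K) :
      (forall k p p', H (k *: p + p') = k * H p + H p') -> H 0 = 0.
    by move=> Hl; have := Hl (-1) 0 0; rewrite scaler0 addr0 mulN1r addNr.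
  by rewrite !L0.
by rewrite Ll L'l e e'.
Qed.

Lemma fder_monomial j (m : J -> nat) : fder j (\prod_q fvar q ^+ m q) =
  (m j)%:R *: \prod_q fvar q ^+ (m q - (q == j)).
Proof.
rewrite (derivation_monomial (fderM j)) [LHS](bigD1 j)//= [X in _ + X]big1 ?addr0.
  by rewrite fder_var eqxx fconst1 mulr1 scaler_nat mulr_natl.
by move=> q qj; rewrite fder_var eq_sym (negPf qj) fconst0 mulr0 mul0r.
Qed.

End formal_polynomials.

Section gaussian_algebra.
Variables (K : fieldType) (ii : K) (M N : nat).
Hypotheses (ii2 : ii * ii = -1) (K2 : (2 : K) != 0).

(* The real variables of the model: the Boolean selects the imaginary part. *)
Local Notation J := ('I_M * 'I_N * bool)%type.
Local Notation poly := (fpoly K J).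
Variable E : poly -> K.
Hypothesis EP : forall k (p p' : poly), E (k *: p + p') = k * E p + E p'.
Hypothesis E_by_parts_real : forall (j : J) (p : poly),
  E (fvar _ j * p) = 2^-1 * E (fder j p).

Let E0 : E 0 = 0.
Proof. by have := EP (-1) 0 0; rewrite scaler0 addr0 mulN1r addNr. Qed.

Let ED (p p' : poly) : E (p + p') = E p + E p'.
Proof. by rewrite -[p in LHS]scale1r EP mul1r. Qed.

Let EZ k (p : poly) : E (k *: p) = k * E p.
Proof. by rewrite -[_ *: _]addr0 EP E0 addr0. Qed.

Let EB (p p' : poly) : E (p - p') = E p - E p'.
Proof. by rewrite -scaleN1r ED EZ mulN1r. Qed.

Let Esum (I : Type) (r : seq I) (F : I -> poly) :
  E (\sum_(i <- r) F i) = \sum_(i <- r) E (F i).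
Proof. exact: (big_morph _ ED E0). Qed.

(** The Wirtinger derivative in the entry [g k l]: it is 1 on that entry and 0 on every conjugate,
    and it makes integration by parts against [gb k l] a derivation formula. *)
Let D k l (p : poly) : poly :=
  2^-1 *: (fder (k, l, false) p - ii *: fder (k, l, true) p).
Definition gauss_var k l : poly := fvar _ (k, l, false) + ii *: fvar _ (k, l, true).
Definition gauss_conj k l : poly := fvar _ (k, l, false) - ii *: fvar _ (k, l, true).

Local Notation g := gauss_var.
Local Notation gb := gauss_conj.

Let E_by_parts k l p : E (gb k l * p) = E (D k l p).
Proof.
rewrite /gauss_conj /D mulrBl EB -scalerAl EZ !E_by_parts_real.
by rewrite EZ EB EZ; ring.
Qed.

Let DM k l p p' : D k l (p * p') = D k l p * p' + p * D k l p'.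
Proof.
rewrite /D !fderM -scalerAl -scalerAr -scalerDr; congr (_ *: _).
rewrite !scalerDr mulrBl mulrBr -scalerAl -scalerAr.
by rewrite [_ *: (_ * p')]scalerAl; ring.
Qed.

Let DP k l a p p' : D k l (a *: p + p') = a *: D k l p + D k l p'.
Proof.
rewrite /D !fder_linear scalerA [a * _]mulrC -scalerA -scalerDr; congr (_ *: _).
by rewrite scalerBr scalerDr opprD addrACA !scalerA [ii * a]mulrC.
Qed.

Let D0 k l : D k l 0 = 0.
Proof. by have := DP k l (-1) 0 0; rewrite scaler0 addr0 scaleN1r addNr. Qed.

Let DD k l p p' : D k l (p + p') = D k l p + D k l p'.
Proof. by rewrite -[p in LHS]scale1r DP scale1r. Qed.

Let DZ k l a p : D k l (a *: p) = a *: D k l p.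
Proof. by rewrite -[a *: p]addr0 DP D0 addr0. Qed.

Let derZ (j : J) a (p : poly) : fder j (a *: p) = a *: fder j p.
Proof. exact: linearZ. Qed.

Let derD (j : J) (p p' : poly) : fder j (p + p') = fder j p + fder j p'.
Proof. exact: linearD. Qed.

Let Dg k l k' l' : D k l (g k' l') = fconst _ ((k == k') && (l == l'))%:R.
Proof.
rewrite /D /gauss_var !derD !derZ !fder_var !xpair_eqE /= !andbT !andbF.
rewrite fconst0 !scaler0 !addr0 !add0r scalerA ii2 scaleN1r opprK -mulr2n.
by rewrite -scaler_nat scalerA mulVf ?K2// scale1r.
Qed.

Let Dgb k l k' l' : D k l (gb k' l') = 0.
Proof.
rewrite /D /gauss_conj -scaleNr !derD !derZ !fder_var !xpair_eqE /= !andbT !andbF.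
by rewrite fconst0 !scaler0 !addr0 !add0r scalerA mulrN ii2 opprK scale1r subrr scaler0.
Qed.

Definition wishart_var (q : 'I_N * 'I_N) : poly := N%:R^-1 *: \sum_k gb k q.1 * g k q.2.

Local Notation x := wishart_var.

Let D_x k l (q : 'I_N * 'I_N) :
  D k l (x q) = (N%:R^-1 * (q.2 == l)%:R) *: gb k q.1.
Proof.
rewrite /wishart_var DZ -scalerA; congr (_ *: _).
rewrite (big_morph _ (DD k l) (D0 k l)) (bigD1 k)//= big1 ?addr0; last first.
  by move=> k' /negPf kk'; rewrite DM Dgb Dg eq_sym kk' fconst0 mul0r mulr0 addr0.
by rewrite DM Dgb mul0r add0r Dg eqxx eq_sym fconstE -scalerAr mulr1.
Qed.

Let sum_gDx l l' q :
  \sum_k g k l' * D k l (x q) = (q.2 == l)%:R *: x (q.1, l').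
Proof.
under eq_bigr do rewrite D_x -scalerAr [g _ _ * _]mulrC.
by rewrite -scaler_sumr /wishart_var /= scalerA [_ * N%:R^-1]mulrC.
Qed.

(** Integration by parts is done in the conjugate entries of the first factor. Differentiating its
    other entry gives [M] times the Kronecker symbol. Differentiating [x (a, l)] leaves a conjugate
    entry in column [a], which the sum over [k] recombines with [g k l'] into [x (a, l')], so the
    formula closes on Wishart entries. *)
Lemma E_x_by_parts l l' (m : 'I_N * 'I_N -> nat) :
  E (x (l, l') * \prod_q x q ^+ m q) =
  M%:R / N%:R * (l == l')%:R * E (\prod_q x q ^+ m q) +
  N%:R^-1 * \sum_a (m (a, l))%:R *
    E (x (a, l') * \prod_q x q ^+ (m q - (q == (a, l)))).
Proof.
set p := \prod_q _ ^+ m q.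
rewrite {1}/wishart_var -scalerAl EZ mulr_suml Esum /=.
under eq_bigr do rewrite -mulrA E_by_parts DM ED Dg eqxx /=.
rewrite big_split /= mulrDr; congr (_ + _).
  rewrite sumr_const card_ord fconstE -scalerAl EZ mul1r.
  by rewrite -[_ *+ M]mulr_natl mulrCA !mulrA.
congr (_ * _); rewrite -Esum.
have -> : \sum_k g k l' * D k l p =
    \sum_a (m (a, l))%:R *: (x (a, l') * \prod_q x q ^+ (m q - (q == (a, l)))).
  under eq_bigr do rewrite (derivation_monomial (DM _ _)) mulr_sumr.
  rewrite exchange_big /=.
  rewrite big_prod_type /=.
  have pull a b : \sum_k g k l' * ((m (a, b))%:R * D k l (x (a, b)) *
      \prod_q x q ^+ (m q - (q == (a, b)))) =
      (b == l)%:R *: ((m (a, b))%:R *: (x (a, l') *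
        \prod_q x q ^+ (m q - (q == (a, b))))).
    rewrite scalerA mulrC -scalerA scalerAl -(sum_gDx l l' (a, b)) mulr_suml scaler_sumr.
    apply: eq_bigr => k _. rewrite scaler_nat.
    by rewrite -[RHS]mulr_natl !mulrA [g _ _ * _]mulrC.
  apply: eq_bigr => a _; rewrite (eq_bigr _ (fun b _ => pull a b)) (bigD1 l)//=.
  rewrite eqxx scale1r [X in _ + X]big1 ?addr0// => b /negPf ->; exact: scale0r.
by rewrite Esum; apply: eq_bigr => a _; rewrite EZ.
Qed.

End gaussian_algebra.

Section polynomial_expectation.
Context (R : realType) (d : measure_display) (T : measurableType d).
Variables (P : probability T R) (J : finType) (V : T -> J -> R[i]).
Hypothesis Vm : forall q, all_cmoments P (fun t => V t q).
Local Notation poly := (fpoly R[i] J).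

Definition Epoly (p : poly) : R[i] := Cexpectation P (fun t => feval (V t) p).

Lemma all_cmoments_eval (p : poly) :
  all_cmoments P (fun t => feval (V t) p).
Proof.
elim/fpoly_ind: p => [|k p p' pm p'm|m].
- by under eq_fun do rewrite feval0; exact: all_cmoments_cst.
- under eq_fun do rewrite fevalP.
  by apply: all_cmomentsD => //; exact: all_cmomentsZ.
- under eq_fun do rewrite feval_prod.
  apply: all_cmoments_prod => q; under eq_fun do rewrite fevalX feval_var.
  exact: all_cmomentsX.
Qed.

Lemma EpolyP k (p p' : poly) : Epoly (k *: p + p') = k * Epoly p + Epoly p'.
Proof.
rewrite /Epoly; under eq_fun do rewrite fevalP.
have pm := all_cmoments_eval p; have p'm := all_cmoments_eval p'.
by rewrite CexpectationD ?CexpectationZ//; exact: all_cmomentsZ.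
Qed.

Lemma Epoly0 : Epoly 0 = 0.
Proof. by have := EpolyP (-1) 0 0; rewrite scaler0 addr0 mulN1r addNr. Qed.

Lemma EpolyD (p p' : poly) : Epoly (p + p') = Epoly p + Epoly p'.
Proof. by rewrite -[p in LHS]scale1r EpolyP mul1r. Qed.

Lemma EpolyZ k (p : poly) : Epoly (k *: p) = k * Epoly p.
Proof. by rewrite -[_ *: _]addr0 EpolyP Epoly0 addr0. Qed.

Lemma EpolyB (p p' : poly) : Epoly (p - p') = Epoly p - Epoly p'.
Proof. by rewrite -scaleN1r EpolyD EpolyZ mulN1r. Qed.

Lemma Epoly_sum (I : Type) (r : seq I) (F : I -> poly) :
  Epoly (\sum_(i <- r) F i) = \sum_(i <- r) Epoly (F i).
Proof. exact: (big_morph _ EpolyD Epoly0). Qed.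

End polynomial_expectation.

Section wishart_by_parts.
Context (R : realType) (d : measure_display) (T : measurableType d).
Variables (P : probability T R) (M N : nat) (G : T -> 'M[R[i]]_(M, N)).
Hypothesis GG : forall k l, std_complex_gaussian P (fun t => G t k l).
Hypothesis Gindep : mutually_independent P
  (fun kl : 'I_M * 'I_N => events_of (fun t => G t kl.1 kl.2)).

Local Notation J := ('I_M * 'I_N * bool)%type.
Local Notation poly := (fpoly R[i] J).

Let V t (j : J) : R[i] :=
  (if j.2 then complex.Im (G t j.1.1 j.1.2) else complex.Re (G t j.1.1 j.1.2))%:C.

Let Vm q : all_cmoments P (fun t => V t q).
Proof.
by apply: all_cmoments_real; have [Xm Ym] := all_cmoments_gaussian (GG q.1.1 q.1.2);
  case: (q.2).
Qed.

Local Notation E := (Epoly P V).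
Let EP := EpolyP Vm.
Let ED := EpolyD Vm.
Let EZ := EpolyZ Vm.
Let EB := EpolyB Vm.
Let Esum := Epoly_sum Vm.

Let E_monomial (m : J -> nat) : E (\prod_q fvar _ q ^+ m q) =
  \prod_q (gauss_moment R (m q))%:C.
Proof.
rewrite /Epoly; under eq_fun do rewrite feval_prod.
pose f (kl : 'I_M * 'I_N) t : R[i] :=
  (complex.Re (G t kl.1 kl.2) ^+ m (kl, false) *
   complex.Im (G t kl.1 kl.2) ^+ m (kl, true))%:C.
have -> : (fun t => \prod_(q : J) feval (V t) (fvar _ q ^+ m q)) =
    (fun t => \prod_(kl : 'I_M * 'I_N) f kl t).
  apply/funext => t; under eq_bigr do rewrite fevalX feval_var.
  rewrite big_prod_type /=.
  by apply: eq_bigr => kl _; rewrite big_bool /f /V /= rmorphM !rmorphXn mulrC.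
rewrite (@Cexpectation_prod_indep _ _ _ P _ _ f Gindep).
- rewrite [RHS]big_prod_type /=.
  apply: eq_bigr => kl _; rewrite big_bool /= mulrC -rmorphM.
  by rewrite /f Cexpectation_real (Ex_gaussian_monomial (GG kl.1 kl.2)).
- by move=> kl A [B mB <-]; exact: (GG kl.1 kl.2).1.
- move=> kl; apply: all_cmoments_real; apply: all_momentsM; apply: all_momentsX;
  by have [] := all_cmoments_gaussian (GG kl.1 kl.2).
- move=> kl B mB.
  (* The factor attached to one entry is a Borel function of it, so its events are events of that
     entry. *)
  pose h (z : measurableTypeR R * measurableTypeR R) : measurableTypeR R * measurableTypeR R :=
    (z.1 ^+ m (kl, false) * z.2 ^+ m (kl, true), 0).
  exists (h @^-1` B); last by rewrite setTI.
  rewrite -[X in measurable X]setTI.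
  have mh : measurable_fun setT h.
    apply/measurable_fun_pairP; split; last exact: measurable_cst.
    by apply: measurable_funM; apply: measurable_funX;
      [exact: measurable_fst|exact: measurable_snd].
  exact: mh.
Qed.

(** By linearity monomials suffice; their expectation is a product of Gaussian moments, and only the
    factor of exponent [m j] changes, according to [gauss_moment_rec]. *)
Let E_by_parts_real (j : J) (p : poly) :
  E (fvar _ j * p) = 2^-1 * E (fder j p).
Proof.
move: p; apply: fpoly_span => [k p p'|k p p'|m].
- by rewrite mulrDr -scalerAr EP.
- by rewrite fder_linear EP mulrDr mulrCA.
rewrite fder_monomial.
have -> : fvar _ j * \prod_q fvar _ q ^+ m q =
    \prod_q fvar R[i] q ^+ (m q + (q == j)).
  rewrite (bigD1 j)//= [RHS](bigD1 j)//= eqxx addn1 exprS mulrA; congr (_ * _).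
  by apply: eq_bigr => q /negPf ->; rewrite addn0.
rewrite EZ !E_monomial.
rewrite (bigD1 j)//= [in RHS](bigD1 j)//= eqxx addn1 gauss_moment_rec subn1.
rewrite rmorphM mulrA mulrA; congr (_ * _ * _).
  by rewrite rmorphM/= rmorph_nat fmorphV rmorph_nat mulrC.
by apply: eq_bigr => q /negPf ->; rewrite addn0 subn0.
Qed.

Let ii2 : ((0 +i* 1 : R[i]) * (0 +i* 1 : R[i])) = -1.
Proof. by apply: complex_eqP; rewrite ?ReM ?ImM /=; ring. Qed.

Let wishart t : 'M[R[i]]_N :=
  N%:R^-1 *: ((map_mx (@conjc R) (G t))^T *m G t).

Let eval_wishart_var t (q : 'I_N * 'I_N) :
  feval (V t) (wishart_var (K := R[i]) (0 +i* 1) M q) = wishart t q.1 q.2.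
Proof.
rewrite /wishart_var fevalZ feval_sum !mxE; congr (_ * _).
apply: eq_bigr => k _; rewrite !mxE fevalM /gauss_conj /gauss_var.
rewrite -scaleNr ![_ + _ *: _]addrC !fevalP !feval_var /V /=.
by congr (_ * _); case: (G t k _) => a b; apply: complex_eqP;
  rewrite ?ReD ?ImD ?ReM ?ImM /=; ring.
Qed.

Lemma all_cmoments_wishart_gauss a b : all_cmoments P (fun t => wishart t a b).
Proof.
under eq_fun do rewrite -(eval_wishart_var _ (a, b)).
exact: all_cmoments_eval.
Qed.

Lemma wishart_gauss_by_parts l l' (m : 'I_N * 'I_N -> nat) :
  Cexpectation P (fun t => wishart t l l' * \prod_q wishart t q.1 q.2 ^+ m q) =
  M%:R / N%:R * (l == l')%:R *
    Cexpectation P (fun t => \prod_q wishart t q.1 q.2 ^+ m q) +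
  N%:R^-1 * \sum_a (m (a, l))%:R *
    Cexpectation P (fun t => wishart t a l' *
      \prod_q wishart t q.1 q.2 ^+ (m q - (q == (a, l)))).
Proof.
have := @E_x_by_parts R[i] (0 +i* 1) M N ii2 _ E EP E_by_parts_real l l' m.
have evE (f : 'I_N * 'I_N -> nat) t :
    feval (V t) (\prod_q wishart_var (K := R[i]) (0 +i* 1) M q ^+ f q) =
    \prod_q wishart t q.1 q.2 ^+ f q.
  by rewrite feval_prod; apply: eq_bigr => q _; rewrite fevalX eval_wishart_var.
move=> /(_ _)/wrap[]; first by rewrite pnatr_eq0.
rewrite /Epoly; under eq_fun do rewrite fevalM eval_wishart_var evE.
move=> ->; congr (_ * _ + _ * _).
  by congr (Cexpectation P _); apply/funext => t; rewrite evE.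
apply: eq_bigr => a _; congr (_ * Cexpectation P _); apply/funext => t.
by rewrite fevalM eval_wishart_var evE.
Qed.

End wishart_by_parts.

Section complex_wishart.
Context (R : realType) (d : measure_display) (T : measurableType d).
Variables (P : probability T R) (M N : nat) (X : T -> 'M[R[i]]_N).
Hypothesis wX : complex_wishart P M X.

Lemma all_cmoments_wishart a b : all_cmoments P (fun t => X t a b).
Proof.
have [G [GG Gindep XE]] := wX; under eq_fun do rewrite XE.
exact: all_cmoments_wishart_gauss.
Qed.

Lemma wishart_by_parts l l' (m : 'I_N * 'I_N -> nat) :
  Cexpectation P (fun t => X t l l' * \prod_q X t q.1 q.2 ^+ m q) =
  M%:R / N%:R * (l == l')%:R *
    Cexpectation P (fun t => \prod_q X t q.1 q.2 ^+ m q) +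
  N%:R^-1 * \sum_a (m (a, l))%:R *
    Cexpectation P (fun t => X t a l' *
      \prod_q X t q.1 q.2 ^+ (m q - (q == (a, l)))).
Proof.
have [G [GG Gindep XE]] := wX.
have -> : X = fun t => N%:R^-1 *: ((map_mx (@conjc R) (G t))^T *m G t) by apply/funext.
exact: wishart_gauss_by_parts.
Qed.

End complex_wishart.

(** * The loop equation *)

Section words.
Variable I : eqType.
Implicit Types (w : seq I) (i : I).

(** The factorizations [w = p.1 ++ i :: p.2], one for each occurrence of [i]: the free difference
    quotient of a word. *)
Fixpoint splits i w : seq (seq I * seq I) :=
  if w is j :: w' then
    (if j == i then [:: ([::], w')] else [::]) ++
      [seq (j :: p.1, p.2) | p <- splits i w']
  else [::].

Lemma splitsP i w (p : seq I * seq I) : p \in splits i w -> w = p.1 ++ i :: p.2.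
Proof.
elim: w p => [|j w IH] p //=; rewrite mem_cat => /orP[|/mapP[q /IH -> -> //]].
by case: eqP => [->|//]; rewrite inE => /eqP ->.
Qed.

Lemma size_splits i w (p : seq I * seq I) : p \in splits i w -> size w = (size p.1 + size p.2).+1.
Proof. by move=> /splitsP ->; rewrite size_cat /= addnS. Qed.

(** The Leibniz rule of the free difference quotient. *)
Lemma splits_cat i u v : splits i (u ++ v) =
  [seq (p.1, p.2 ++ v) | p <- splits i u] ++ [seq (u ++ p.1, p.2) | p <- splits i v].
Proof.
elim: u => [|j u IH] /=.
  by rewrite -[LHS]map_id; apply: eq_map => -[].
rewrite IH map_cat !map_cat -catA -!map_comp; congr (_ ++ _).
by case: eqP.
Qed.

Fixpoint picks (T : Type) (s : seq T) : seq (T * seq T) :=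
  if s is x :: s' then (x, s') :: [seq (p.1, x :: p.2) | p <- picks s'] else [::].

Lemma perm_picks (T : eqType) (s : seq T) (p : T * seq T) : p \in picks s -> perm_eq s (p.1 :: p.2).
Proof.
elim: s p => [|x s IH] p //=; rewrite inE => /orP[/eqP -> //|/mapP[q /IH sq ->] /=].
apply: (perm_trans (y := x :: q.1 :: q.2)); first by rewrite perm_cons.
by apply/permP => a /=; rewrite addnCA.
Qed.

End words.

Section loop_equation.
Variables (K : fieldType) (s N : nat) (r : K).
Hypothesis N0 : N%:R != 0 :> K.
Local Notation J := ('I_s * ('I_N * 'I_N))%type.
Local Notation A := (fpoly K J).
Variable E : A -> K.
Hypothesis EP : forall k (p p' : A), E (k *: p + p') = k * E p + E p'.
Hypothesis E_by_parts : forall i l l' (F : A),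
  E (fvar _ (i, (l, l')) * F) = r * (l == l')%:R * E F +
    N%:R^-1 * \sum_a E (fvar _ (i, (a, l')) * fder (i, (a, l)) F).
Implicit Types (w : seq 'I_s) (Ws : seq (seq 'I_s)).

Let E0 : E 0 = 0.
Proof. by have := EP (-1) 0 0; rewrite scaler0 addr0 mulN1r addNr. Qed.

Let ED (p p' : A) : E (p + p') = E p + E p'.
Proof. by rewrite -[p in LHS]scale1r EP mul1r. Qed.

Let EZ k (p : A) : E (k *: p) = k * E p.
Proof. by rewrite -[_ *: _]addr0 EP E0 addr0. Qed.

Let Esum (I : Type) (l : seq I) (F : I -> A) :
  E (\sum_(i <- l) F i) = \sum_(i <- l) E (F i).
Proof. exact: (big_morph _ ED E0). Qed.

Definition fmat (i : 'I_s) : 'M[A]_N := \matrix_(a, b) fvar K (i, (a, b)).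
Definition fword w : 'M[A]_N := foldr (fun i B => fmat i *m B) 1%:M w.
Definition ftrace w : A := N%:R^-1 *: \tr (fword w).
Definition ftraces Ws : A := \prod_(w <- Ws) ftrace w.

Lemma fword_cat u v : fword (u ++ v) = fword u *m fword v.
Proof. by elim: u => [|i u IH] /=; rewrite ?mul1mx// IH mulmxA. Qed.

Lemma ftraces_nil Ws : ftraces ([::] :: Ws) = ftraces Ws.
Proof.
rewrite /ftraces big_cons /ftrace /= mxtrace1 -scaler_nat.
by rewrite scalerA mulVf// scale1r mul1r.
Qed.

Lemma ftrace_rcons i u : ftrace (rcons u i) = ftrace (i :: u).
Proof.
by rewrite /ftrace -cats1 fword_cat /= mulmx1 mxtrace_mulC.
Qed.

Let derZ j (a : K) (p : A) : fder j (a *: p) = a *: fder j p.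
Proof. exact: linearZ. Qed.

Let der_sum j (I : Type) (l : seq I) (F : I -> A) :
  fder j (\sum_(i <- l) F i) = \sum_(i <- l) fder j (F i).
Proof. exact: linear_sum. Qed.

Lemma fder_fword i a l w u v : fder (i, (a, l)) (fword w u v) =
  \sum_(p <- splits i w) fword p.1 u a * fword p.2 l v.
Proof.
elim: w u v => [|j w IH] u v.
  by rewrite big_nil /= mxE -[(_ == _)%:R]fconst_nat fder_const.
rewrite /= mxE der_sum big_cat big_map /=.
under eq_bigr do rewrite fderM mxE fder_var IH.
rewrite big_split /=; congr (_ + _).
  rewrite (bigD1 l)//= big1 ?addr0; last first.
    move=> b /negPf bl; rewrite !xpair_eqE [l == b]eq_sym bl !andbF fconst0.
    exact: mul0r.
  rewrite !xpair_eqE eqxx andbT [i == j]eq_sym; case: eqP => _ /=.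
    by rewrite big_seq1 /= mxE fconst_nat [a == u]eq_sym.
  by rewrite big_nil fconst0 mul0r.
under eq_bigr do rewrite mulr_sumr.
rewrite exchange_big /=; apply: eq_bigr => p _.
rewrite mxE mulr_suml; apply: eq_bigr => b _.
by rewrite mxE mulrA.
Qed.

Lemma fder_ftrace i a l w : fder (i, (a, l)) (ftrace w) =
  N%:R^-1 *: \sum_(p <- splits i w) fword (p.2 ++ p.1) l a.
Proof.
rewrite /ftrace derZ /mxtrace der_sum; congr (_ *: _).
under eq_bigr do rewrite fder_fword.
rewrite exchange_big /=; apply: eq_bigr => p _.
by rewrite fword_cat mxE; apply: eq_bigr => u _; rewrite mulrC.
Qed.

Lemma fder_ftraces j Ws : fder j (ftraces Ws) =
  \sum_(p <- picks Ws) fder j (ftrace p.1) * ftraces p.2.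
Proof.
elim: Ws => [|w Ws IH].
  by rewrite big_nil /ftraces big_nil (derivation1 (fderM j)).
rewrite /= big_cons big_map /ftraces big_cons fderM; congr (_ + _).
rewrite IH mulr_sumr; apply: eq_bigr => p _ /=.
by rewrite big_cons mulrCA.
Qed.

Let exchange3 (I : Type) (t : seq I) (F : 'I_N -> 'I_N -> 'I_N -> I -> A) :
  \sum_l \sum_l' \sum_a \sum_(p <- t) F l l' a p =
  \sum_(p <- t) \sum_l \sum_l' \sum_a F l l' a p.
Proof.
under eq_bigr do under eq_bigr do rewrite exchange_big /=.
by under eq_bigr do rewrite exchange_big /=; rewrite exchange_big.
Qed.

(** Index pattern of a derivative that falls inside the trace being expanded: the trace splits into
    two. *)
Let sum_trM (X U V : 'M[A]_N) (Q : A) :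
  \sum_l \sum_l' \sum_a X a l' * (U l' a * V l l * Q) =
  \tr (X *m U) * \tr V * Q.
Proof.
rewrite [\tr (X *m U)]/mxtrace [\tr V]/mxtrace.
under [in RHS]eq_bigr do rewrite mxE.
rewrite mulrC mulr_sumr mulr_sumr; apply: eq_bigr => l _.
rewrite exchange_big /= mulrC -mulrA mulr_suml; apply: eq_bigr => a _.
rewrite mulr_suml; apply: eq_bigr => l' _.
by rewrite !mulrA.
Qed.

(** Index pattern of a derivative that falls on another trace: the two traces merge into one. *)
Let sum_tr3 (X W Z : 'M[A]_N) (Q : A) :
  \sum_l \sum_l' \sum_a X a l' * (W l' l * (Z l a * Q)) =
  \tr (X *m (W *m Z)) * Q.
Proof.
rewrite mxtrace_mulC exchange_big /= /mxtrace mulr_suml; apply: eq_bigr => l' _.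
rewrite mxE mulr_suml exchange_big /=; apply: eq_bigr => a _.
rewrite mxE mulr_suml mulr_suml; apply: eq_bigr => l _.
by rewrite mulrC -!mulrA; congr (_ * (_ * _)); rewrite mulrC.
Qed.

(** One factor [N^-1] comes from the expanded trace and one from integration by parts. When the
    trace splits, both are absorbed in normalizing the two new traces. When two traces merge, the
    second normalization brings a third factor and the single new trace absorbs only one: hence
    [N^-2]. *)
Lemma loop_equation i w Ws :
  E (ftraces ((i :: w) :: Ws)) = r * E (ftraces (w :: Ws)) +
    \sum_(p <- splits i w) E (ftraces (rcons p.1 i :: p.2 :: Ws)) +
    N%:R^-2 * \sum_(q <- picks Ws) \sum_(p <- splits i q.1)
      E (ftraces ((i :: w ++ p.2 ++ p.1) :: q.2)).
Proof.
have trcons u : ftraces (u :: Ws) = ftrace u * ftraces Ws by rewrite /ftraces big_cons.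
rewrite !trcons; set Q := ftraces Ws.
have -> : ftrace (i :: w) * Q = N%:R^-1 *: \sum_l \sum_l'
    (fvar _ (i, (l, l')) * (fword w l' l * Q)).
  rewrite /ftrace -scalerAl; congr (_ *: _); rewrite /mxtrace mulr_suml.
  apply: eq_bigr => l _; rewrite /= mxE mulr_suml; apply: eq_bigr => l' _.
  by rewrite mxE mulrA.
rewrite EZ Esum.
under eq_bigr do rewrite Esum.
under eq_bigr do under eq_bigr do rewrite E_by_parts -Esum.
under eq_bigr do rewrite big_split /=.
rewrite big_split /= mulrDr -addrA; congr (_ + _).
  rewrite /ftrace -scalerAl EZ mulrCA; congr (_ * _).
  rewrite /mxtrace mulr_suml Esum mulr_sumr; apply: eq_bigr => l _.
  rewrite (bigD1 l)//= big1 ?addr0 ?eqxx ?mulr1//.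
  by move=> l' /negPf ll'; rewrite eq_sym ll' mulr0 mul0r.
under eq_bigr do rewrite -mulr_sumr -Esum.
rewrite -mulr_sumr -Esum mulrA -invfM -expr2.
have -> : \sum_l \sum_l' \sum_a fvar K (i, (a, l')) * fder (i, (a, l)) (fword w l' l * Q) =
    \sum_(p <- splits i w) (\tr (fword (i :: p.1)) * \tr (fword p.2) * Q) +
    \sum_(q <- picks Ws) \sum_(p <- splits i q.1)
      N%:R^-1 *: (\tr (fword (i :: w ++ p.2 ++ p.1)) * ftraces q.2).
  under eq_bigr do under eq_bigr do under eq_bigr do rewrite fderM mulrDr.
  under eq_bigr do under eq_bigr do rewrite big_split /=.
  under eq_bigr do rewrite big_split /=.
  rewrite big_split /=; congr (_ + _).
    under eq_bigr do under eq_bigr do under eq_bigr do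
      rewrite fder_fword mulr_suml mulr_sumr.
    rewrite exchange3; apply: eq_bigr => p _.
    rewrite -sum_trM; do 3! apply: eq_bigr => ? _.
    by rewrite [fmat _ _ _]mxE.
  under eq_bigr do under eq_bigr do under eq_bigr do
    rewrite fder_ftraces 2!mulr_sumr.
  rewrite exchange3; apply: eq_bigr => q _ /=.
  under eq_bigr do under eq_bigr do under eq_bigr do
    rewrite fder_ftrace -scalerAl mulr_suml -scalerAr -scalerAr 2!mulr_sumr scaler_sumr.
  rewrite exchange3; apply: eq_bigr => p _.
  rewrite /= [fword (w ++ _)]fword_cat -sum_tr3 scaler_sumr; apply: eq_bigr => l _.
  rewrite scaler_sumr; apply: eq_bigr => l' _.
  rewrite scaler_sumr; apply: eq_bigr => a _.
  by rewrite [fmat _ _ _]mxE.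
rewrite ED mulrDr !Esum !mulr_sumr; congr (_ + _); apply: eq_bigr => p _.
  rewrite /ftraces !big_cons ftrace_rcons /ftrace -!scalerAl -!scalerAr.
  by rewrite scalerA EZ -expr2 exprVn mulrA.
rewrite !Esum !mulr_sumr; apply: eq_bigr => q _.
by rewrite /ftraces big_cons /ftrace -scalerAl.
Qed.

End loop_equation.

(** * The planar recursion on words *)

Section word_polynomial.
Variables (I : eqType) (K : comNzRingType) (x : K).
Implicit Types (w : seq I).

(** The recursion is on length and not structural, since [rcons p.1 i] is not a subterm; hence the
    fuel [n], for which the size of the word suffices. *)
Fixpoint wrec n w : K :=
  if n is n'.+1 then
    if w is i :: w' then
      x * wrec n' w' + \sum_(p <- splits i w') wrec n' (rcons p.1 i) * wrec n' p.2
    else 1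
  else 1.

Lemma wrec_fuel n m w : (size w <= n)%N -> (size w <= m)%N -> wrec n w = wrec m w.
Proof.
elim: n m w => [|n IH] [|m] [|i w]//= wn wm.
rewrite (IH m)//; congr (_ + _); apply: eq_big_seq => p /size_splits wE.
by congr (_ * _); apply: IH; rewrite ?size_rcons; lia.
Qed.

(* The limit of the expected normalized trace of the word [w] when the ratio
   [M / N] tends to [x]; the recursion is the planar part of the loop equation. *)
Definition wval w := wrec (size w) w.

Lemma wval_nil : wval [::] = 1. Proof. by []. Qed.

Lemma wval_cons i w : wval (i :: w) =
  x * wval w + \sum_(p <- splits i w) wval (rcons p.1 i) * wval p.2.
Proof.
rewrite /wval /=; congr (_ + _); apply: eq_big_seq => p /size_splits wE.
by congr (_ * _); apply: wrec_fuel; rewrite ?size_rcons; lia.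
Qed.

Lemma wval_ind (Q : seq I -> Prop) : Q [::] ->
  (forall i w, Q w ->
    (forall p : seq I * seq I, p \in splits i w -> Q (rcons p.1 i) /\ Q p.2) -> Q (i :: w)) ->
  forall w, Q w.
Proof.
move=> Q0 Qc w; have [n] := ubnP (size w); elim: n w => // n IH [|i w]//= wn.
apply: Qc => [|p /size_splits wE]; first exact: IH.
by split; apply: IH; rewrite ?size_rcons; lia.
Qed.

End word_polynomial.

Lemma wval_rmorph (I : eqType) (K L : comNzRingType) (f : {rmorphism K -> L})
  (x : K) (w : seq I) : f (wval x w) = wval (f x) w.
Proof.
elim/wval_ind: w => [|i w IH IHs]; first by rewrite !wval_nil rmorph1.
rewrite !wval_cons rmorphD rmorphM IH rmorph_sum; congr (_ + _).
by apply: eq_big_seq => p /IHs[e1 e2]; rewrite rmorphM e1 e2.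
Qed.

Lemma wval_map (I J : eqType) (K : comNzRingType) (x : K) (f : I -> J) (w : seq I) :
  injective f -> wval x (map f w) = wval x w.
Proof.
move=> fi; have spl i u : splits (f i) (map f u) = [seq (map f p.1, map f p.2) | p <- splits i u].
  elim: u => //= j u IH; rewrite IH (inj_eq fi) map_cat -!map_comp; congr (_ ++ _).
  by case: eqP.
elim/wval_ind: w => [|i w IH IHs] //=.
rewrite !wval_cons IH spl big_map; congr (_ + _).
by apply: eq_big_seq => p /IHs[e1 e2]; rewrite -map_rcons e1 e2.
Qed.

Definition wpoly (I : eqType) (K : comNzRingType) (w : seq I) : {poly K} := wval 'X w.

Lemma horner_wpoly (I : eqType) (K : comNzRingType) (x : K) (w : seq I) :
  (wpoly K w).[x] = wval x w.
Proof.
by rewrite -/(horner_eval x _) /wpoly wval_rmorph /= /horner_eval hornerX.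
Qed.

Section complex_measurable.
Context (R : realType) (d : measure_display) (T : measurableType d).
Implicit Types Z W : T -> R[i].

Definition cmeasurable Z := measurable_fun setT (@ReIm R \o Z).

Lemma cmeasurableP Z : cmeasurable Z <->
  measurable_fun setT (fun t => complex.Re (Z t)) /\
  measurable_fun setT (fun t => complex.Im (Z t)).
Proof. exact: measurable_fun_pairP. Qed.

Lemma cmeasurable_cst z : cmeasurable (cst z).
Proof. by apply/cmeasurableP; split; exact: measurable_cst. Qed.

Lemma cmeasurableM Z W : cmeasurable Z -> cmeasurable W ->
  cmeasurable (fun t => Z t * W t).
Proof.
move=> /cmeasurableP[Zr Zi] /cmeasurableP[Wr Wi]; apply/cmeasurableP; split.
  by under eq_fun do rewrite ReM; apply: measurable_funB; exact: measurable_funM.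
by under eq_fun do rewrite ImM; apply: measurable_funD; exact: measurable_funM.
Qed.

Lemma cmeasurableX Z n : cmeasurable Z -> cmeasurable (fun t => Z t ^+ n).
Proof.
move=> Zm; elim: n => [|n IH]; first exact: cmeasurable_cst.
by under eq_fun do rewrite exprS; exact: cmeasurableM.
Qed.

Lemma cmeasurable_prod (I : Type) (r : seq I) (F : I -> T -> R[i]) :
  (forall i, cmeasurable (F i)) -> cmeasurable (fun t => \prod_(i <- r) F i t).
Proof.
move=> Fm; elim: r => [|i r IH].
  by under eq_fun do rewrite big_nil; exact: cmeasurable_cst.
by under eq_fun do rewrite big_cons; exact: cmeasurableM.
Qed.

End complex_measurable.

(** * Integration by parts for an independent family *)

Section independent_wishart.
Context (R : realType) (d : measure_display) (T : measurableType d).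
Variables (P : probability T R) (s M N : nat) (X : 'I_s -> T -> 'M[R[i]]_N).
Hypothesis wX : forall i, complex_wishart P M (X i).
Hypothesis iX : mutually_independent P (fun i => events_of_mx (X i)).
Local Notation J := ('I_s * ('I_N * 'I_N))%type.

Definition entries t (q : J) : R[i] := X q.1 t q.2.1 q.2.2.

Lemma all_cmoments_entries q : all_cmoments P (fun t => entries t q).
Proof. exact: all_cmoments_wishart (wX q.1) _ _. Qed.

Let block i (m : J -> nat) t : R[i] := \prod_(q : 'I_N * 'I_N) X i t q.1 q.2 ^+ m (i, q).

Let entry_events i (q : 'I_N * 'I_N) B : measurable B ->
  events_of_mx (X i) ((@ReIm R \o (fun t => X i t q.1 q.2)) @^-1` B).
Proof.
move=> mB; apply: sub_gen_smallest; exists q => //.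
by exists B => //; rewrite setTI.
Qed.

Let events_of_mx_measurable i A : events_of_mx (X i) A -> measurable A.
Proof.
apply: smallest_sub; first exact: sigma_algebra_measurable.
move=> B [q _] [C mC <-].
have [+ _] := all_cmoments_wishart (wX i) q.1 q.2.
have [_ Im] := all_cmoments_wishart (wX i) q.1 q.2.
move=> Rm; have : cmeasurable (fun t => X i t q.1 q.2).
  by apply/cmeasurableP; split; [exact: Rm.1|exact: Im.1].
exact.
Qed.

(** The functions [y] leave room for one extra entry per block, which will be the factor to
    integrate by parts. *)
Let Cexpectation_blocks (y : 'I_s -> T -> R[i]) (m : J -> nat) :
  (forall i, y i = cst 1 \/ exists q : 'I_N * 'I_N, y i = fun t => X i t q.1 q.2) ->
  Cexpectation P (fun t => \prod_i (y i t * block i m t)) =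
  \prod_i Cexpectation P (fun t => y i t * block i m t).
Proof.
move=> yX.
apply: (@Cexpectation_prod_indep _ _ _ P _ _ _ iX).
- exact: events_of_mx_measurable.
- move=> i; apply: all_cmomentsM.
    by case: (yX i) => [->|[q ->]]; [exact: all_cmoments_cst|exact: all_cmoments_wishart].
  by apply: all_cmoments_prod => q; apply: all_cmomentsX; exact: all_cmoments_wishart.
- move=> i B mB.
  (* The same sample space with the sigma-algebra generated by the [i]-th matrix: measurability over
     it is membership of the events in [events_of_mx]. *)
  pose T' := g_sigma_algebraType (\bigcup_(kl in [set: 'I_N * 'I_N])
    events_of (fun t => X i t kl.1 kl.2)).
  have mq (q : 'I_N * 'I_N) : cmeasurable (fun t : T' => X i t q.1 q.2).
    by move=> _ C mC; rewrite setTI; exact: entry_events.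
  have : cmeasurable (fun t : T' => y i t * block i m t).
    apply: cmeasurableM.
      by case: (yX i) => [->|[q ->]]; [exact: cmeasurable_cst|exact: mq].
    by apply: cmeasurable_prod => q; exact: cmeasurableX.
  by move=> /(_ measurableT _ mB); rewrite setTI.
Qed.

Local Notation E := (Epoly P entries).

Let E_monomial (m : J -> nat) :
  E (\prod_q fvar _ q ^+ m q) = \prod_i Cexpectation P (block i m).
Proof.
have := @Cexpectation_blocks (fun=> cst 1) m (fun=> or_introl erefl).
have e i : (fun t : T => cst (1 : R[i]) t * block i m t) = block i m.
  by apply/funext => t; rewrite mul1r.
under [X in _ = X -> _]eq_bigr do rewrite e.
move=> <-; congr (Cexpectation P _); apply/funext => t.
rewrite feval_prod big_prod_type /=; apply: eq_bigr => i _.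
by rewrite mul1r; apply: eq_bigr => q _; rewrite fevalX feval_var.
Qed.

Let E_var_monomial i (q : 'I_N * 'I_N) (m : J -> nat) :
  E (fvar _ (i, q) * \prod_q fvar _ q ^+ m q) =
  Cexpectation P (fun t => X i t q.1 q.2 * block i m t) *
  \prod_(j | j != i) Cexpectation P (block j m).
Proof.
pose y j := if j == i then fun t => X i t q.1 q.2 else cst (1 : R[i]).
have yX j : y j = cst 1 \/ exists q : 'I_N * 'I_N, y j = fun t => X j t q.1 q.2.
  by rewrite /y; case: eqP => [->|_]; [right; exists q|left].
have := @Cexpectation_blocks y m yX.
rewrite [X in _ = X -> _](bigD1 i)//= {2}/y eqxx => e.
have e' j : j != i -> Cexpectation P (fun t => y j t * block j m t) =
    Cexpectation P (block j m).
  move=> /negPf ji; congr (Cexpectation P _); apply/funext => t.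
  by rewrite /y ji mul1r.
rewrite (eq_bigr _ e') in e; rewrite -e.
congr (Cexpectation P _); apply/funext => t.
rewrite fevalM feval_var feval_prod big_prod_type /=.
rewrite (bigD1 i)//= [RHS](bigD1 i)//= mulrA /entries /y eqxx; congr (_ * _ * _).
  by apply: eq_bigr => q' _; rewrite fevalX feval_var.
apply: eq_bigr => j /negPf ji; rewrite ji mul1r.
by apply: eq_bigr => q' _; rewrite fevalX feval_var.
Qed.

(** Independence factors the expectation of a monomial over the matrices, and a derivative in an
    entry of the [i]-th matrix touches its block only; the other factors are carried along. *)
Lemma entries_by_parts i l l' (F : fpoly R[i] J) :
  E (fvar _ (i, (l, l')) * F) = M%:R / N%:R * (l == l')%:R * E F +
    N%:R^-1 * \sum_a E (fvar _ (i, (a, l')) * fder (i, (a, l)) F).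
Proof.
have EP := EpolyP all_cmoments_entries.
have EZ := EpolyZ all_cmoments_entries.
move: F; apply: fpoly_span => [k p p'|k p p'|m].
- by rewrite mulrDr -scalerAr EP.
- rewrite EP mulrDr mulrCA [in RHS]mulrDr addrACA; congr (_ + _).
  rewrite mulrCA -mulrDr; congr (_ * _).
  rewrite mulr_sumr -big_split /=; apply: eq_bigr => a _.
  by rewrite fder_linear mulrDr -scalerAr EP.
rewrite E_var_monomial E_monomial.
rewrite (@wishart_by_parts _ _ _ P M N (X i) (wX i) l l' (fun q => m (i, q))).
rewrite [in RHS](bigD1 i)//= mulrDl; congr (_ + _); first by rewrite !mulrA.
rewrite -mulrA mulr_suml; congr (_ * _); apply: eq_bigr => a _.
rewrite fder_monomial -scalerAr EZ E_var_monomial -mulrA; congr (_ * (_ * _)).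
  congr (Cexpectation P _); apply/funext => t; congr (_ * _).
  by apply: eq_bigr => q _; rewrite xpair_eqE eqxx.
apply: eq_bigr => j /negPf ji; congr (Cexpectation P _); apply/funext => t.
by apply: eq_bigr => q _; rewrite xpair_eqE ji subn0.
Qed.

End independent_wishart.

(** * Asymptotics of the loop equation *)

Section asymptotics.
Context (R : realType) (s : nat) (d : nat -> measure_display).
Context (T : forall N, measurableType (d N)) (P : forall N, probability (T N) R).
Variables (M : nat -> nat) (X : forall N, 'I_s -> T N -> 'M[R[i]]_N) (c c' : R).
Hypothesis hW : forall N (i : 'I_s), complex_wishart (P N) (M N) (@X N i).
Hypothesis hX : forall N,
  mutually_independent (P N) (fun i : 'I_s => events_of_mx (@X N i)).
Hypothesis hM : (M N)%:R / N%:R @[N --> \oo] --> c.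
Hypothesis hM' : (M N)%:R - N%:R * c @[N --> \oo] --> c'.
Implicit Types (w : seq 'I_s) (Ws : seq (seq 'I_s)).

Let ratio N : R := (M N)%:R / N%:R.
Let E Ws N : R[i] := Epoly (P N) (entries (@X N)) (ftraces R[i] N Ws).
Let a Ws N : R := complex.Re (E Ws N).
Let Q Ws N : R := \prod_(w <- Ws) wval (ratio N) w.

Let cvD (u v : nat -> R) (l k : R) : u @ \oo --> l -> v @ \oo --> k ->
  u N + v N @[N --> \oo] --> l + k.
Proof. by move=> ul vk; exact: cvgD. Qed.

Let cvM (u v : nat -> R) (l k : R) : u @ \oo --> l -> v @ \oo --> k ->
  u N * v N @[N --> \oo] --> l * k.
Proof. by move=> ul vk; exact: cvgM. Qed.

Let cvg0_sum (I : eqType) (l : seq I) (F : I -> nat -> R) :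
  (forall p, p \in l -> F p N @[N --> \oo] --> (0 : R)) ->
  \sum_(p <- l) F p N @[N --> \oo] --> (0 : R).
Proof.
elim: l => [|p l IH] Fl.
  by under eq_fun do rewrite big_nil; exact: cvg_cst.
under eq_fun do rewrite big_cons.
have F0 : F p N @[N --> \oo] --> (0 : R) by apply: Fl; rewrite mem_head.
have S0 : \sum_(q <- l) F q N @[N --> \oo] --> (0 : R).
  by apply: IH => q ql; apply: Fl; rewrite inE ql orbT.
by have := cvD F0 S0; rewrite addr0.
Qed.

Let cvg_wval w : wval (ratio N) w @[N --> \oo] --> wval c w.
Proof.
under eq_fun do rewrite -horner_wpoly; rewrite -horner_wpoly.
by apply: continuous_cvg => //; exact: continuous_horner.
Qed.

Let cvg_Q Ws : Q Ws N @[N --> \oo] --> \prod_(w <- Ws) wval c w.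
Proof.
elim: Ws => [|w Ws IH].
  by rewrite big_nil /Q; under eq_fun do rewrite big_nil; exact: cvg_cst.
rewrite big_cons /Q; under eq_fun do rewrite big_cons.
by apply: cvgM.
Qed.

Let cvg_invn : (N%:R^-1 : R) @[N --> \oo] --> (0 : R).
Proof. by rewrite -(cvg_shiftS); exact: cvg_harmonic. Qed.

(** Termination measure. Splitting a trace removes one letter but adds a trace, so letters count
    twice; merging and deleting an empty word decrease the measure as well. *)
Let total Ws := ((sumn (map size Ws)).*2 + size Ws)%N.

(** The comparison is with the planar values at the ratio [M / N], which satisfy the same recursion
    with the same coefficient; at [c] the error would be of order [1/N]. That the expectation is
    real is carried along, so that limits are taken in [R]. *)
Let good Ws := (forall N, (0 < N)%N -> E Ws N = (a Ws N)%:C) /\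
  N%:R * (a Ws N - Q Ws N) @[N --> \oo] --> (0 : R).

Let good_cvg Ws : good Ws -> N%:R^-1 * a Ws N @[N --> \oo] --> (0 : R).
Proof.
move=> [_ h].
have h2 : a Ws N - Q Ws N @[N --> \oo] --> (0 : R).
  have := cvM cvg_invn h; rewrite mul0r; apply: cvg_trans.
  apply: near_eq_cvg; near=> N; rewrite mulrA mulVf ?mul1r// pnatr_eq0 -lt0n.
  by near: N; exact: nbhs_infty_gt.
have : a Ws N @[N --> \oo] --> 0 + \prod_(w <- Ws) wval c w.
  have := cvD h2 (@cvg_Q Ws); apply: cvg_trans; apply: near_eq_cvg.
  by apply: nearW => N /=; rewrite subrK.
by move=> /(cvM cvg_invn); rewrite mul0r.
Unshelve. all: by end_near. Qed.

(** The induction covers all products of traces at once. After multiplication by [N], the merging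
    terms keep a factor [N^-1] in front of convergent sequences and disappear; the other terms match
    the recursion of [Q]. *)
Let all_good Ws : good Ws.
Proof.
have [n] := ubnP (total Ws); elim: n Ws => // n IH [|[|i w] Ws] /= le_n.
- have E1 N : E [::] N = 1.
    rewrite /E /ftraces big_nil /Epoly; under eq_fun do rewrite feval1.
    exact: Cexpectation_cst.
  split=> [N _|]; first by rewrite /a E1.
  rewrite /a /Q; under eq_fun do rewrite E1 big_nil subrr mulr0.
  exact: cvg_cst.
- have EE N : (0 < N)%N -> E ([::] :: Ws) N = E Ws N.
    by move=> N0; rewrite /E ftraces_nil// pnatr_eq0 -lt0n.
  have [|e1 e2] := IH Ws; first by move: le_n; rewrite /total /=; lia.
  split=> [N N0|]; first by rewrite /a EE// e1.
  apply: cvg_trans e2; apply: near_eq_cvg; near=> N.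
  rewrite /a EE; last by near: N; exact: nbhs_infty_gt.
  by rewrite /Q big_cons wval_nil mul1r.
have g1 : good (w :: Ws) by apply: IH; move: le_n; rewrite /total /=; lia.
have g2 (p : seq 'I_s * seq 'I_s) : p \in splits i w -> good (rcons p.1 i :: p.2 :: Ws).
  move=> /size_splits wE; apply: IH; move: le_n.
  have {}wE : size w = (size p.1 + size p.2).+1 by exact: wE.
  by rewrite /total /= size_rcons; lia.
have g3 (q : seq 'I_s * seq (seq 'I_s)) (p : seq 'I_s * seq 'I_s) : q \in picks Ws -> p \in splits i q.1 ->
    good ((i :: w ++ p.2 ++ p.1) :: q.2).
  move=> /perm_picks Wq /size_splits qE; apply: IH; move: le_n.
  have {}qE : size q.1 = (size p.1 + size p.2).+1 by exact: qE.
  have e1 : size Ws = (size q.2).+1 := perm_size Wq.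
  have e2 : sumn (map size Ws) = (size q.1 + sumn (map size q.2))%N :=
    perm_sumn (perm_map size Wq).
  by rewrite /total /= !size_cat; lia.
pose b N : R := ratio N * a (w :: Ws) N +
    \sum_(p <- splits i w) a (rcons p.1 i :: p.2 :: Ws) N +
    N%:R^-2 * \sum_(q <- picks Ws) \sum_(p <- splits i q.1)
      a ((i :: w ++ p.2 ++ p.1) :: q.2) N.
have EE N : (0 < N)%N -> E ((i :: w) :: Ws) N = (b N)%:C.
  move=> N0; rewrite /E.
  have := @loop_equation R[i] s N ((M N)%:R / N%:R)
    (Epoly (P N) (entries (@X N)))
    (EpolyP (all_cmoments_entries (@hW N)))
    (entries_by_parts (@hW N) (@hX N)) i w Ws.
  have natC k : (k%:R : R)%:C = k%:R by exact: (rmorph_nat (real_complex R)).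
  have invC (y : R) : (y^-1)%:C = y%:C^-1 by exact: (fmorphV (real_complex R)).
  have e1 : (ratio N)%:C = (M N)%:R / N%:R :> R[i] by rewrite /ratio rmorphM /= invC !natC.
  have e2 : (N%:R ^- 2 : R)%:C = N%:R ^- 2 :> R[i] by rewrite invC rmorphXn /= natC.
  have bE : (b N)%:C = (ratio N)%:C * (a (w :: Ws) N)%:C +
      \sum_(p <- splits i w) (a (rcons p.1 i :: p.2 :: Ws) N)%:C +
      (N%:R ^- 2)%:C * \sum_(q <- picks Ws) \sum_(p <- splits i q.1)
        (a ((i :: w ++ p.2 ++ p.1) :: q.2) N)%:C.
    have mS (J : Type) (l : seq J) (F : J -> R) :
        (\sum_(j <- l) F j)%:C = \sum_(j <- l) (F j)%:C.
      exact: (rmorph_sum (real_complex R)).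
    have mD (y z : R) : (y + z)%:C = y%:C + z%:C by exact: (rmorphD (real_complex R)).
    have mM (y z : R) : (y * z)%:C = y%:C * z%:C by exact: (rmorphM (real_complex R)).
    rewrite /b !mD !mM !mS.
    by congr (_ + _ * _); apply: eq_bigr => q _; exact: mS.
  rewrite bE e1 e2 => ->.
  congr (_ * _ + _ + _ * _); first exact: g1.1.
    by apply: eq_big_seq => p pi; exact: (g2 p pi).1.
  apply: eq_big_seq => q qi; apply: eq_big_seq => p pi.
  exact: (g3 q p qi pi).1.
have aE N : (0 < N)%N -> a ((i :: w) :: Ws) N = b N by move=> N0; rewrite /a EE.
split=> [N N0|]; first by rewrite aE// EE.
(* [N] times the difference between the loop equation and the planar recursion at [M / N], term by
   term. *)
have cv : ratio N * (N%:R * (a (w :: Ws) N - Q (w :: Ws) N)) +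
   \sum_(p <- splits i w) (N%:R * (a (rcons p.1 i :: p.2 :: Ws) N -
       Q (rcons p.1 i :: p.2 :: Ws) N)) +
   \sum_(q <- picks Ws) \sum_(p <- splits i q.1)
      N%:R^-1 * a ((i :: w ++ p.2 ++ p.1) :: q.2) N @[N --> \oo] --> c * 0 + 0 + 0.
  apply: cvD; first apply: cvD.
  - by apply: cvM; [exact: hM|exact: g1.2].
  - by apply: cvg0_sum => p pi; exact: (g2 p pi).2.
  - by apply: cvg0_sum => q qi; apply: cvg0_sum => p pi; apply/good_cvg/g3.
rewrite mulr0 !addr0 in cv; apply: cvg_trans cv; apply: near_eq_cvg; near=> N.
have N0 : (0 < N)%N by near: N; exact: nbhs_infty_gt.
have NR : N%:R != 0 :> R by rewrite pnatr_eq0 -lt0n.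
rewrite aE// /b [Q ((i :: w) :: Ws) N]big_cons wval_cons.
rewrite -/(Q Ws N) -mulr_sumr.
under [X in _ + X = _]eq_bigr do rewrite -mulr_sumr.
rewrite -mulr_sumr sumrB.
have -> : \sum_(p <- splits i w) Q (rcons p.1 i :: p.2 :: Ws) N =
    (\sum_(p <- splits i w) wval (ratio N) (rcons p.1 i) * wval (ratio N) p.2) * Q Ws N.
  by rewrite mulr_suml; apply: eq_bigr => p _; rewrite /Q !big_cons mulrA.
rewrite {1}/Q big_cons -/(Q Ws N).
set S := \sum_(q <- _) _; set S1 := \sum_(p <- _) a _ _; set S2 := \sum_(p <- _) _ * _.
by field.
Unshelve. all: by end_near. Qed.

(** The error at [c] is the error at [M / N], which is [o(1/N)], plus the increment of the
    polynomial from [c] to [M / N]; [N] times the step [M / N - c] tends to [c']. *)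
Lemma trace_moment_cvg w :
  [/\ forall N, (0 < N)%N -> E [:: w] N = (a [:: w] N)%:C,
     a [:: w] N @[N --> \oo] --> (wpoly R w).[c] &
     N%:R * (a [:: w] N - (wpoly R w).[c]) @[N --> \oo] --> c' * (wpoly R w)^`().[c] ].
Proof.
have [gE gc] := all_good [:: w].
have QE N : Q [:: w] N = (wpoly R w).[ratio N].
  by rewrite /Q big_seq1 horner_wpoly.
(* The increment is written by exact division by [X - c], with quotient [r]; its value at [c] is the
   derivative. *)
have [r rE] : exists r, wpoly R w = r * ('X - c%:P) + (wpoly R w).[c]%:P.
  have /factor_theorem[r rE] : root (wpoly R w - (wpoly R w).[c]%:P) c.
    by rewrite rootE !hornerE subrr.
  by exists r; rewrite -rE subrK.
have r'c : r.[c] = (wpoly R w)^`().[c].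
  by rewrite rE derivD derivM derivXsubC derivC !hornerE subrr mulr0 add0r.
have second : N%:R * (a [:: w] N - (wpoly R w).[c]) @[N --> \oo] --> c' * (wpoly R w)^`().[c].
  have rcvg : r.[ratio N] @[N --> \oo] --> r.[c].
    by apply: continuous_cvg => //; exact: continuous_horner.
  have := cvD gc (cvM hM' rcvg); rewrite add0r r'c; apply: cvg_trans.
  apply: near_eq_cvg; near=> N.
  have N0 : (0 < N)%N by near: N; exact: nbhs_infty_gt.
  have NR : N%:R != 0 :> R by rewrite pnatr_eq0 -lt0n.
  have -> : (M N)%:R - N%:R * c = N%:R * (ratio N - c).
    by rewrite /ratio mulrBr mulrCA divff ?mulr1.
  rewrite QE {1}rE !hornerE; ring.
split => //.
have := cvM cvg_invn second; rewrite mul0r.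
move=> /(cvD (cvg_cst (wpoly R w).[c])); rewrite addr0.
apply: cvg_trans; apply: near_eq_cvg; near=> N.
have N0 : (0 < N)%N by near: N; exact: nbhs_infty_gt.
have NR : N%:R != 0 :> R by rewrite pnatr_eq0 -lt0n.
by rewrite /= mulrA mulVf// mul1r addrC subrK.
Unshelve. all: by end_near. Qed.

End asymptotics.

Lemma cvg_complexR (R : realType) (u : nat -> R) (l : R) : u N @[N --> \oo] --> l ->
  ((u N)%:C : R[i]^o) @[N --> \oo] --> (l%:C : R[i]^o).
Proof.
move=> /cvgrPdist_lt ul; apply/cvgrPdist_lt => e e0.
(* A positive complex number is real, so the radius is a real one. *)
have [e1 eE] : 0 < complex.Re e /\ e = (complex.Re e)%:C.
  by case: e e0 => a b; rewrite ltcE /= => /andP[/eqP -> a0]; split.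
near=> N.
have -> : l%:C - (u N)%:C = (l - u N)%:C :> R[i] by rewrite rmorphB.
by rewrite normc_def /= expr0n addr0 sqrtr_sqr eE ltcR; near: N; exact: ul.
Unshelve. all: by end_near. Qed.

Section word_moments.
Context (R : realType) (s : nat) (d : nat -> measure_display).
Context (T : forall N, measurableType (d N)) (P : forall N, probability (T N) R).
Variables (M : nat -> nat) (X : forall N, 'I_s -> T N -> 'M[R[i]]_N) (c c' : R).
Hypothesis hW : forall N (i : 'I_s), complex_wishart (P N) (M N) (@X N i).
Hypothesis hX : forall N,
  mutually_independent (P N) (fun i : 'I_s => events_of_mx (@X N i)).
Hypothesis hM : (M N)%:R / N%:R @[N --> \oo] --> c.
Hypothesis hM' : (M N)%:R - N%:R * c @[N --> \oo] --> c'.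

Lemma feval_fword N (t : T N) (l : seq 'I_s) a b :
  feval (entries (@X N) t) (fword R[i] N l a b) = (\prod_(i <- l) @X N i t) a b.
Proof.
elim: l a b => [|i l IH] a b.
  by rewrite big_nil /= !mxE -fconst_nat feval_const.
rewrite big_cons /= mxE feval_sum mxE; apply: eq_bigr => k _.
by rewrite mxE fevalM feval_var IH.
Qed.

Lemma Epoly_ftraces1 N (l : seq 'I_s) :
  Epoly (P N) (entries (@X N)) (ftraces R[i] N [:: l]) =
  Cexpectation (P N) (fun t => ntr (\prod_(i <- l) @X N i t)).
Proof.
rewrite /Epoly; congr (Cexpectation _ _); apply/funext => t.
rewrite /ftraces big_seq1 /ftrace fevalZ /ntr /mxtrace feval_sum.
by congr (_ * _); apply: eq_bigr => a _; exact: feval_fword.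
Qed.

Lemma word_moment_cvg n (w : 'I_n -> 'I_s) :
  let p := wpoly R [seq w k | k <- enum 'I_n] in
  ((word_moment P X w N : R[i]^o) @[N --> \oo] --> (p.[c]%:C : R[i]^o)) /\
  ((N%:R * (word_moment P X w N - p.[c]%:C) : R[i]^o) @[N --> \oo] -->
    ((c' * p^`().[c])%:C : R[i]^o)).
Proof.
move=> p; have [aE c1 c2] := trace_moment_cvg hW hX hM hM' [seq w k | k <- enum 'I_n].
pose a N : R := complex.Re (Epoly (P N) (entries (@X N))
  (ftraces R[i] N [:: [seq w k | k <- enum 'I_n]])).
have wE N : (0 < N)%N -> word_moment P X w N = (a N)%:C.
  move=> N0; rewrite -aE// Epoly_ftraces1; congr (Cexpectation _ _).
  by apply/funext => t; congr ntr; rewrite big_map enumT [index_enum _]unlock.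
split.
  apply: cvg_trans (cvg_complexR c1); apply: near_eq_cvg; near=> N.
  by rewrite /= wE//; near: N; exact: nbhs_infty_gt.
apply: cvg_trans (cvg_complexR c2); apply: near_eq_cvg; near=> N.
rewrite /= wE; last by near: N; exact: nbhs_infty_gt.
by rewrite rmorphM rmorphB /= rmorph_nat.
Unshelve. all: by end_near. Qed.

End word_moments.

(** * One-variable moments *)

Section one_variable.
Variables (K : comNzRingType) (x : K).

(** As a polynomial in [x] this is the Narayana polynomial, the [n]-th moment of the
    Marchenko-Pastur law of parameter [x]. *)
Definition mom n : K := wval x (nseq n tt).

Lemma wval_nseq (I : eqType) (i : I) n : wval x (nseq n i) = mom n.
Proof.
rewrite /mom -(@wval_map _ _ _ _ (fun _ : unit => i)) ?map_nseq//.
by case=> [] [].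
Qed.

Lemma splits_nseq n : splits tt (nseq n tt) =
  [seq (nseq e tt, nseq (n.-1 - e) tt) | e <- iota 0 n].
Proof.
elim: n => [|n IH] //=; rewrite IH subn0; congr (_ :: _).
rewrite (iotaDl 1 0) -!map_comp; apply/eq_in_map => e; rewrite mem_iota => /andP[_ en] /=.
by congr (_, nseq _ tt); rewrite add1n; move: en; rewrite add0n; case: n {IH} => //= n _; lia.
Qed.

Lemma mom0 : mom 0 = 1. Proof. by []. Qed.

Lemma momS n : mom n.+1 = x * mom n + \sum_(e < n) mom e.+1 * mom (n.-1 - e).
Proof.
rewrite /mom /= wval_cons splits_nseq big_map -(big_mkord xpredT (fun e => mom e.+1 * mom (n.-1 - e))).
rewrite /index_iota subn0; congr (_ + _); apply: eq_bigr => e _ /=.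
by rewrite -[rcons _ _]/(rcons (nseq e tt) tt) -cats1 -(nseqD e 1) addn1.
Qed.

End one_variable.

(** * Moments as coefficients of powers and as weighted Motzkin paths *)

Section motzkin.
Variables (K : idomainType) (c : K).
Hypothesis natK : forall n, n.+1%:R != 0 :> K.

(* With [c = s ^ 2] and [X = s e^(it)], this is [s e^(it)] times
   [1 + c + 2 s cos t], the parametrization of the Marchenko-Pastur interval. *)
Definition mpoly_mp : {poly K} := (1 + 'X) * ('X + c%:P).
Local Notation P := mpoly_mp.

Lemma coef_mp_mul (F : {poly K}) k :
  (P * F)`_k.+2 = c * F`_k.+2 + (1 + c) * F`_k.+1 + F`_k.
Proof.
have -> : P * F = c *: F + (1 + c) *: (F * 'X) + F * 'X * 'X.
  by rewrite /mpoly_mp -!mul_polyC polyCD; ring.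
by rewrite !coefD !coefZ !coefMX.
Qed.

(** The point is the identity [X P' - P = X^2 - c]: multiplication by [X^2 - c] becomes a
    differential operator that acts diagonally on coefficients. *)
Lemma deriv_mpX n : n.+1%:R * (P ^+ n * ('X ^+ 2 - c%:P)) =
  'X * (P ^+ n.+1)^`() - n.+1%:R * P ^+ n.+1.
Proof.
have -> : (P ^+ n.+1)^`() = n.+1%:R * (P^`() * P ^+ n).
  by rewrite deriv_exp [RHS]mulr_natl.
have -> : P^`() = 1 + c%:P + 2%:R * 'X.
  by rewrite /mpoly_mp derivM -[1]polyC1 !derivD !derivX !derivC polyC1; ring.
by rewrite [P ^+ n.+1]exprS; move: (P ^+ n) (n.+1%:R : {poly K}) => Q m; rewrite /mpoly_mp; ring.
Qed.

Lemma coef_deriv_mpX n k : n.+1%:R * (P ^+ n * ('X ^+ 2 - c%:P))`_(n + k) =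
  (n + k)%:R * (P ^+ n.+1)`_(n + k) - n.+1%:R * (P ^+ n.+1)`_(n + k).
Proof.
rewrite -[n.+1%:R * (_`__)]coefCM polyC_natr deriv_mpX coefB -polyC_natr coefCM.
congr (_ - _); case: (n + k)%N => [|m]; first by rewrite coefXM mul0r.
by rewrite coefXM /= coef_deriv [RHS]mulr_natl.
Qed.

(** The substitution of [c / X] for [X] preserves [P] up to a monomial factor, so the coefficient of
    [P ^+ n] at [n - 1] is [c] times the one at [n + 1]. In [coef_deriv_mpX] it is the case where
    the two integers cancel. *)
Lemma coef_mp_shift n : (P ^+ n * ('X ^+ 2 - c%:P))`_n.+1 = 0.
Proof.
have := coef_deriv_mpX n 1; rewrite addn1 subrr => /eqP.
by rewrite mulf_eq0 (negPf (natK n)) /= => /eqP.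
Qed.

(** Weighted count of Motzkin paths of length [n] from height 0 to height [j]: level steps weigh
    [1 + c], down steps [c], up steps 1. The factor [X^2 - c] is the reflection principle, and
    [coef_mp_shift] is the absorbing boundary at height -1. *)
Definition motz n j : K := (P ^+ n * ('X ^+ 2 - c%:P))`_(n + j).+2.

Lemma motz0 j : motz 0 j = (j == 0%N)%:R.
Proof.
rewrite /motz expr0 mul1r add0n coefB coefXn coefC subr0.
by case: j.
Qed.

Lemma motzS n j : motz n.+1 j = (1 + c) * motz n j + c * motz n j.+1 +
  (if j is j'.+1 then motz n j' else 0).
Proof.
rewrite /motz exprS -mulrA addSn coef_mp_mul addnS [c * _ + _]addrC; congr (_ + _).
by case: j => [|j]; rewrite ?addn0 ?coef_mp_shift ?addnS.
Qed.

(** A path ending at height [j + 1] is cut at its last step up from height [j], after [k] steps;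
    what follows never goes below [j + 1]. The proof is an induction on the last step of the
    path. *)
Lemma motz_first_passage n j :
  motz n j.+1 = \sum_(k < n) motz k j * motz (n.-1 - k) 0.
Proof.
elim: n j => [|n IH] j; first by rewrite big_ord0 motz0.
rewrite big_ord_recl subn0 /= motz0 motzS.
rewrite (eq_bigr (fun k : 'I_n => (1 + c) * (motz k j * motz (n.-1 - k) 0) +
    c * (motz k j.+1 * motz (n.-1 - k) 0) +
    (if j is j'.+1 then motz k j' else 0) * motz (n.-1 - k) 0)); last first.
  move=> k _; rewrite /bump /= add1n motzS (_ : (n - k.+1 = n.-1 - k)%N); last by lia.
  by rewrite !mulrDl !mulrA.
rewrite !big_split /= -!mulr_sumr -!IH.
case: j => [|j] /=; first by rewrite mul1r big1 ?addr0 => [|k _]; rewrite ?mul0r// [RHS]addrC.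
by rewrite mul0r add0r -IH.
Qed.

(** The summand [e = n] of [momS] contains [mom 0 = 1] and joins the linear term, giving the weight
    [1 + c] of level steps. The remaining convolution is a path count to height 1. *)
Lemma mom_motz n : mom c n.+1 = c * motz n 0.
Proof.
have [m] := ubnP n; elim: m n => // m IH [|n] nm.
  by rewrite momS big_ord0 motz0 mom0 addr0 !mulr1.
rewrite momS big_ord_recr /= subnn mom0 mulr1.
rewrite motzS addr0 motz_first_passage.
have -> : \sum_(e < n) mom c (bump 0 e) * mom c (n - e) =
    c * (c * \sum_(k < n) motz k 0 * motz (n.-1 - k) 0).
  rewrite !mulr_sumr; apply: eq_bigr => e _.
  have -> : (n - e = (n.-1 - e).+1)%N by have := ltn_ord e; lia.
  rewrite !IH; first by ring.
    by have := ltn_ord e; lia.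
  by have := ltn_ord e; lia.
by rewrite IH; [ring|lia].
Qed.

End motzkin.

Section mom_derivative.
Variable F : numFieldType.
Local Notation K := {poly F}.

(** Differentiation in [c], which is here the variable of the coefficient ring; the outer variable,
    that of the circle, is held fixed. *)
Let coefderiv (p : {poly K}) : {poly K} := map_poly deriv p.

Let coef_coefderiv (p : {poly K}) k : (coefderiv p)`_k = (p`_k)^`().
Proof. by rewrite coef_map_id0// deriv0. Qed.

Let coefderivM (p q : {poly K}) :
  coefderiv (p * q) = coefderiv p * q + p * coefderiv q.
Proof.
apply/polyP => k; rewrite coef_coefderiv coefD !coefM raddf_sum -big_split /=.
by apply: eq_bigr => i _; rewrite derivM !coef_coefderiv.
Qed.

Local Notation P := (mpoly_mp ('X : K)).

Let coefderivD (p q : {poly K}) : coefderiv (p + q) = coefderiv p + coefderiv q.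
Proof. by apply/polyP => k; rewrite coefD !coef_coefderiv coefD derivD. Qed.

Let coefderivC (a : K) : coefderiv a%:P = (a^`())%:P.
Proof.
by apply/polyP => k; rewrite coef_coefderiv !coefC; case: k => [|k] //; exact: linear0.
Qed.

Let coefderiv_X : coefderiv 'X = 0.
Proof.
by apply/polyP => k; rewrite coef_coefderiv coefX coef0 -polyC_natr derivC.
Qed.

Let coefderivP : coefderiv P = 1 + 'X.
Proof.
rewrite /mpoly_mp coefderivM !coefderivD -[1]polyC1 !coefderivC coefderiv_X derivX.
by rewrite -polyC1 derivC !polyC1 !add0r mul0r add0r mulr1.
Qed.

Let natK n : n.+1%:R != 0 :> K.
Proof. by rewrite -polyC_natr polyC_eq0 pnatr_eq0. Qed.

(** The [c]-derivative of [P] is [1 + X], and [deriv_mpX] turns the lower power of [P] it leaves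
    into a derivative of [P ^+ n]; all coefficients become integer multiples of those of
    [P ^+ n]. *)
Let coefderiv_mpX n : coefderiv (P ^+ n * ('X ^+ 2 - ('X : K)%:P)) =
  (1 + 'X) * ('X * (P ^+ n)^`() - n%:R * P ^+ n) - P ^+ n.
Proof.
have d2 : coefderiv ('X ^+ 2 - ('X : K)%:P) = -1.
  rewrite coefderivD expr2 coefderivM coefderiv_X mul0r mulr0 !add0r.
  by rewrite -polyCN coefderivC derivN derivX polyCN polyC1.
rewrite coefderivM d2 mulrN1; congr (_ - _).
rewrite (derivationX coefderivM) coefderivP.
case: n => [|n]; first by rewrite !mul0r expr0 -[1 in RHS]polyC1 derivC mulr0 subr0 mulr0.
by rewrite -(deriv_mpX ('X : K)) /=; ring.
Qed.

Lemma deriv_mom_poly n : (mom ('X : K) n.+1)^`() =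
  (P ^+ n)`_n + 'X * (P ^+ n)`_n.+1.
Proof.
have cXd k : ('X * (P ^+ n)^`() - n%:R * P ^+ n)`_k = (k%:R - n%:R) * (P ^+ n)`_k.
  rewrite coefB -polyC_natr coefCM mulrBl; congr (_ - _).
  by case: k => [|k]; rewrite coefXM ?mul0r//= coef_deriv mulr_natl.
rewrite (mom_motz _ natK) derivM derivX mul1r /motz addn0 -coef_coefderiv coefderiv_mpX.
rewrite mulrBr coefB coefMXn coefMC /= !subSS subn0.
rewrite coefB mulrDl mul1r coefD coefXM /= !cXd -[n.+2]addn2 -[n.+1]addn1 !natrD; ring.
Qed.

End mom_derivative.

Section wpoly_values.
Variables (F : numFieldType) (I : eqType) (i : I) (c : F).
Local Notation P := (mpoly_mp c).

Let natF n : n.+1%:R != 0 :> F.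
Proof. by rewrite pnatr_eq0. Qed.

Lemma horner_wpoly_nseq n : (wpoly F (nseq n i)).[c] = mom c n.
Proof. by rewrite horner_wpoly wval_nseq. Qed.

Lemma deriv_wpoly_nseq0 : (wpoly F (nseq 0 i))^`().[c] = 0.
Proof. by rewrite /wpoly wval_nil -polyC1 derivC horner0. Qed.

(** This form mirrors the numerator [x + 1 - c] of the density of the limit: the central
    coefficients of the powers of [P] are moments of the arcsine law on the interval, and
    multiplication by [x] raises the order by one. *)
Lemma deriv_wpoly_nseq n : (wpoly F (nseq n.+1 i))^`().[c] *+ 2 =
  (P ^+ n.+1)`_n.+1 + (1 - c) * (P ^+ n)`_n.
Proof.
rewrite /wpoly wval_nseq deriv_mom_poly.
have evP k m : ((mpoly_mp ('X : {poly F}) ^+ k)`_m).[c] = (P ^+ k)`_m.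
  rewrite -/(horner_eval c _) -coef_map /= rmorphXn /= /mpoly_mp.
  rewrite rmorphM !rmorphD rmorph1 /= map_polyX map_polyC /= /horner_eval hornerX.
  by [].
rewrite hornerD hornerM hornerX !evP exprS.
case: n => [|n].
  rewrite expr0 mulr1 !coef1 /=.
  have -> : P`_1 = 1 + c.
    have -> : P = c%:P + (1 + c%:P) * 'X + 'X * 'X by rewrite /mpoly_mp; ring.
    by rewrite -polyC1 -polyCD !coefD coefC coefCM coefX coefXM coefX /=; ring.
  by rewrite mulr0n; ring.
have := coef_mp_shift c natF n.+1; rewrite mulrBr coefB coefMXn coefMC /= !subSS subn0.
move=> /eqP; rewrite subr_eq0 => /eqP h.
rewrite coef_mp_mul h; ring.
Qed.

End wpoly_values.

(** * Noncrossing partitions *)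

Section noncrossing_relations.
Variables (n : nat) (K : comNzRingType) (x : K).
Local Notation I := 'I_n.
Implicit Types (A B : {set I}) (r : {set I * I}).

(** Noncrossing partitions of a subset [A], encoded as equivalence relations supported in [A].
    Restriction to an interval and gluing are then set operations inside one ordinal, with no
    renumbering. *)
Record nc_rel A r : Prop := NcRel {
  nc_dom : forall u v : I, (u, v) \in r -> u \in A /\ v \in A;
  nc_refl : forall u : I, u \in A -> (u, u) \in r;
  nc_sym : forall u v : I, (u, v) \in r -> (v, u) \in r;
  nc_trans : forall u v w : I, (u, v) \in r -> (v, w) \in r -> (u, w) \in r;
  nc_nc : forall i j k l : I, (i < j)%N -> (j < k)%N -> (k < l)%N ->
    (i, k) \in r -> (j, l) \in r -> (i, j) \in r }.

(* The classes of a relation are counted through their least elements. *)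
Definition minima r : {set I} :=
  [set u : I | ((u, u) \in r) && [forall v : I, ((u, v) \in r) ==> (u <= v)%N]]%SET.

Lemma minimaP r (u : I) : reflect ((u, u) \in r /\ forall v : I, (u, v) \in r -> (u <= v)%N)
  (u \in minima r).
Proof.
rewrite inE; apply: (iffP andP) => -[ruu h]; split => //.
  by move=> v ruv; move/forallP: h => /(_ v)/implyP; apply.
by apply/forallP => v; apply/implyP; exact: h.
Qed.

Definition nc_sum A : K := \sum_(r | `[< nc_rel A r >]) x ^+ #|minima r|.

Definition rel_restr A r : {set I * I} :=
  [set z in r | (z.1 \in A) && (z.2 \in A)]%SET.

Lemma rel_restrE A r (u v : I) : ((u, v) \in rel_restr A r) = [&& (u, v) \in r, u \in A & v \in A].
Proof. by rewrite inE. Qed.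

Lemma nc_rel_restr A B r : A \subset B -> nc_rel B r -> nc_rel A (rel_restr A r).
Proof.
move=> /fintype.subsetP AB [d rf sy tr nc]; split.
- by move=> u v; rewrite rel_restrE => /and3P[].
- by move=> u uA; rewrite rel_restrE uA rf ?AB.
- by move=> u v; rewrite !rel_restrE => /and3P[/sy -> -> ->].
- move=> u v w; rewrite !rel_restrE => /and3P[uv -> _] /and3P[vw _ ->].
  by rewrite (tr _ _ _ uv vw).
- move=> i j k l ij jk kl; rewrite !rel_restrE => /and3P[ik -> _] /and3P[jl -> _].
  by rewrite (nc _ _ _ _ ij jk kl ik jl).
Qed.

Lemma nc_sum0 : nc_sum finset.set0 = 1.
Proof.
rewrite /nc_sum (big_pred1 finset.set0) => [|r]; last first.
  apply/asboolP/eqP => [[d _ _ _ _]|->].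
    by apply/finset.setP => -[u v]; rewrite inE; apply/negP => /d[]; rewrite inE.
  by split=> [u v|u|u v|u v w|i j k l _ _ _]; rewrite !inE.
have -> : minima finset.set0 = finset.set0.
  by apply/finset.setP => u; rewrite !inE.
by rewrite cards0.
Qed.

Section step.
Variables (o : I) (b : nat).
Hypothesis ob : (o < b)%N.

Definition segment (p q : nat) : {set I} := [set u : I | (p <= u < q)%N]%SET.
Local Notation A := (segment o b).
Local Notation A' := (segment o.+1 b).

Lemma segmentE p q (u : I) : (u \in segment p q) = (p <= u < q)%N.
Proof. by rewrite inE. Qed.

Definition next_in_class r (k : I) := (o, k) \in r /\
  forall v : I, (o, v) \in r -> v = o \/ (k <= v)%N.
Definition alone r := forall v : I, (o, v) \in r -> v = o.

(** The second smallest element of the class of [o]; the value [o] itself means that there is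
    none. *)
Definition next r : I := if [pick k | (k != o) && `[< next_in_class r k >]] is Some k then k else o.

Lemma next_alone r : (next r == o) = `[< alone r >].
Proof.
rewrite /next; case: pickP => [k /andP[ko /asboolP[ok kmin]]|h].
  by rewrite (negPf ko); apply/esym/asboolPn => al; move: ko; rewrite (al _ ok) eqxx.
rewrite eqxx; apply/esym/asboolP => v ov; apply/eqP/negPn/negP => vo.
pose Q (k : I) := (k != o) && ((o, k) \in r).
have Qv : Q v by rewrite /Q vo.
case: (arg_minnP (P := Q) (fun k : I => k : nat) Qv) => k /andP[ko ok] kmin.
have := h k; rewrite ko /= => /asboolPn; apply; split => // w ow.
by case: (eqVneq w o) => [|wo]; [left|right; apply: kmin; rewrite /Q wo].
Qed.

Lemma next_eq r (k : I) : k != o -> (next r == k) = `[< next_in_class r k >].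
Proof.
move=> ko; rewrite /next; case: pickP => [l /andP[lo /asboolP[ol lmin]]|h].
  apply/eqP/asboolP => [<- //|[ok kmin]].
  apply/val_inj/eqP; rewrite eqn_leq; apply/andP; split.
    by case: (lmin _ ok) => // /eqP; rewrite (negPf ko).
  by case: (kmin _ ol) => // /eqP; rewrite (negPf lo).
by rewrite eq_sym (negPf ko); have := h k; rewrite ko.
Qed.

Definition add_alone r : {set I * I} := ((o, o) |: r)%SET.

(** Deleting the singleton class of [o] is a bijection onto the relations on the remaining segment
    and loses exactly one class, hence one factor [x]. *)
Lemma alone_sum : \sum_(r | `[< nc_rel A r >] && (next r == o)) x ^+ #|minima r| =
  x * nc_sum A'.
Proof.
rewrite (reindex_onto add_alone (rel_restr A')) /=; last first.
  move=> r /andP[/asboolP[d rf sy tr nc]]; rewrite next_alone => /asboolP al.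
  apply/finset.setP => -[u v]; rewrite finset.in_setU1 rel_restrE; apply/idP/idP.
    move=> /orP[/eqP[-> ->]|/and3P[] //]; apply: rf.
    by rewrite segmentE leqnn ob.
  move=> uv; rewrite uv /= xpair_eqE; have [uA vA] := d _ _ uv.
  rewrite !segmentE in uA vA *.
  have [uo|uo] := eqVneq u o; first by rewrite uo in uv; rewrite (al _ uv) eqxx.
  have [vo|vo] := eqVneq v o.
    by move: uv; rewrite vo => /sy /al /eqP; rewrite (negPf uo).
  by move: (uo) (vo); rewrite -!val_eqE /=; lia.
rewrite /nc_sum mulr_sumr; apply: eq_big => r.
  rewrite next_alone; apply/idP/idP.
    move=> /andP[/andP[/asboolP nr _] /eqP <-]; apply/asboolP.
    apply: nc_rel_restr nr; apply/fintype.subsetP => u; rewrite !segmentE; lia.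
  move=> /asboolP[d rf sy tr nc].
  have od (v : I) : (o, v) \in r = false by apply/negP => /d[]; rewrite segmentE ltnn.
  have do' (v : I) : (v, o) \in r = false by apply/negP => /sy; rewrite od.
  apply/andP; split; first (apply/andP; split; apply/asboolP).
  - split.
    + move=> u v; rewrite finset.in_setU1 => /orP[/eqP[-> ->]|/d[]]; rewrite !segmentE; lia.
    + move=> u; rewrite finset.in_setU1 segmentE xpair_eqE => uA.
      have [-> //|uo] := eqVneq u o; apply: rf; rewrite segmentE.
      by move: uo; rewrite -val_eqE /=; lia.
    + by move=> u v; rewrite !finset.in_setU1 => /orP[/eqP[-> ->]|/sy ->]; rewrite ?eqxx ?orbT.
    + move=> u v w; rewrite !finset.in_setU1 !xpair_eqE.
      move=> /orP[/andP[/eqP -> /eqP ->]|uv]; first by move=> /orP[|->]; rewrite ?orbT //= => ->.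
      move=> /orP[/andP[/eqP vo /eqP ->]|vw]; first by rewrite vo do' in uv.
      by rewrite (tr _ _ _ uv vw) orbT.
    + move=> i j k l ij jk kl; rewrite !finset.in_setU1 !xpair_eqE.
      move=> /orP[/andP[/eqP io /eqP ko]|ik]; first by move: ij jk; rewrite io ko; lia.
      move=> /orP[/andP[/eqP jo /eqP lo]|jl]; first by move: jk kl; rewrite jo lo; lia.
      by rewrite (nc _ _ _ _ ij jk kl ik jl) orbT.
  - by move=> v; rewrite finset.in_setU1 od orbF => /eqP[].
  apply/eqP/finset.setP => -[u v]; rewrite rel_restrE finset.in_setU1 xpair_eqE.
  apply/idP/idP => [/and3P[/orP[/andP[/eqP -> _]|//]]|uv].
    by rewrite segmentE ltnn.
  by rewrite uv orbT; have [-> ->] := d _ _ uv.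
move=> /andP[/andP[/asboolP nr _] /eqP rr]; rewrite -exprS; congr (_ ^+ _).
have od (v : I) : (o, v) \in r = false.
  by apply/negP; rewrite -rr rel_restrE segmentE ltnn andbF.
have do' (v : I) : (v, o) \in r = false.
  by apply/negP; rewrite -rr rel_restrE => /and3P[_ _]; rewrite segmentE ltnn.
have -> : minima (add_alone r) = (o |: minima r)%SET.
  apply/finset.setP => u; rewrite finset.in_setU1; apply/minimaP/orP.
    rewrite finset.in_setU1 xpair_eqE andbb => -[/orP[->|uu] um]; [by left|right].
    by apply/minimaP; split => // v uv; apply: um; rewrite finset.in_setU1 uv orbT.
  move=> [/eqP ->|/minimaP[uu um]].
    by split=> [|v]; rewrite finset.in_setU1 ?eqxx// od orbF => /eqP[->].
  split=> [|v]; rewrite finset.in_setU1 ?uu ?orbT//.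
  by move=> /orP[/eqP[uo _]|/um //]; move: uu; rewrite uo od.
by rewrite cardsU1 inE od.
Qed.

Section glue.
Variable k : I.
Hypotheses (ok : (o < k)%N) (kb : (k < b)%N).
Local Notation A1 := (segment o.+1 k).
Local Notation A2 := (segment k b).

Let shift (u : I) : I := if u == o then k else u.

(** If [k] follows [o] in its class, no class meets both the open interval from [o] to [k] and the
    rest. The relation is thus a pair: one relation on that interval and one on the segment from
    [k], where [k] also stands for [o] through [shift]. *)
Definition glue (z : {set I * I} * {set I * I}) : {set I * I} :=
  [set p | ((p.1, p.2) \in z.1) || ((shift p.1, shift p.2) \in z.2)]%SET.

Lemma glueE z (u v : I) : ((u, v) \in glue z) = ((u, v) \in z.1) || ((shift u, shift v) \in z.2).
Proof. by rewrite inE. Qed.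

Let shift_o : shift o = k. Proof. by rewrite /shift eqxx. Qed.
Let shift_id (u : I) : u != o -> shift u = u. Proof. by rewrite /shift => /negPf ->. Qed.
Let shiftA2 (u : I) : (shift u \in A2) = (u == o) || (u \in A2).
Proof. by rewrite /shift; case: eqVneq => // _; rewrite segmentE leqnn kb. Qed.
Let ko : k != o. Proof. by rewrite -val_eqE /=; lia. Qed.

Let gk r : nc_rel A r /\ next_in_class r k ->
  glue (rel_restr A1 r, rel_restr A2 r) = r.
Proof.
move=> [[d rf sy tr nc] [rok kmin]]; apply/finset.setP => -[u v].
rewrite glueE /= !rel_restrE !shiftA2.
(* The arc from [o] to [k] traps the class of [w]: leaving the interval would put [w] in the class
   of [o], which has no element before [k]. *)
have between (w : I) : (o < w)%N -> (w < k)%N -> forall v : I, (w, v) \in r -> (w \in A1) /\ v \in A1.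
  move=> ow wk v' wv.
  have wo : (o, w) \notin r.
    by apply/negP => /kmin[/(congr1 val)/=|]; lia.
  have [wA vA] := d _ _ wv; rewrite !segmentE in vA *; split; first by lia.
  have [vk|kv|vk] := ltngtP v' k.
  - suff : v' != o by rewrite -val_eqE /=; lia.
    by apply: contraNneq wo => vo; apply: sy; rewrite -vo.
  - by move: wo; rewrite (nc _ _ _ _ ow wk kv rok wv).
  - move: wo; rewrite (tr _ _ _ rok)//; apply: sy.
    by move/val_inj: vk => <-.
apply/idP/idP.
  move=> /orP[/and3P[] //|/and3P[+ _ _]].
  rewrite /shift; case: eqVneq => [->|_]; case: eqVneq => [->|_] // h.
  - by apply: rf; rewrite segmentE leqnn ob.
  - exact: tr rok h.
  - exact: tr h (sy _ _ rok).
move=> uv; have [uA vA] := d _ _ uv; rewrite uv /=.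
have [wlt|wge] := boolP ((o < u)%N && (u < k)%N).
  by have /andP[h1 h2] := wlt; have [-> ->] := between u h1 h2 v uv.
have [wlt'|wge'] := boolP ((o < v)%N && (v < k)%N).
  have /andP[h1 h2] := wlt'; have [] := between v h1 h2 u (sy _ _ uv).
  by rewrite !segmentE; move: wge; lia.
have -> : (u == o) || (u \in A2).
  by move: uA wge; rewrite -val_eqE /= !segmentE; lia.
have -> : (v == o) || (v \in A2).
  by move: vA wge'; rewrite -val_eqE /= !segmentE; lia.
rewrite !andbT; apply/orP; right; rewrite /shift.
case: eqVneq => [uo|_]; case: eqVneq => [vo|_].
- by apply: rf; rewrite segmentE; lia.
- by rewrite uo in uv; exact: tr (sy _ _ rok) uv.
- by rewrite vo in uv; exact: tr uv rok.
- by [].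
Qed.

Let gnc z : nc_rel A1 z.1 -> nc_rel A2 z.2 ->
  [/\ nc_rel A (glue z), next_in_class (glue z) k,
      rel_restr A1 (glue z) = z.1 & rel_restr A2 (glue z) = z.2].
Proof.
case: z => r1 r2 /= [d1 rf1 sy1 tr1 nc1] [d2 rf2 sy2 tr2 nc2].
have no12 (u v w : I) : (u, v) \in r1 -> (shift v, w) \in r2 -> False.
  move=> /d1[_ vA] /d2[]; rewrite shiftA2 => /orP[/eqP vo|]; move: vA.
    by rewrite vo segmentE ltnn.
  by rewrite !segmentE => + + _; lia.
have D1 (u v : I) : (u, v) \in r1 -> (o < u < k)%N /\ (o < v < k)%N.
  by move=> /d1[]; rewrite !segmentE; lia.
have D2 (u v : I) : (shift u, shift v) \in r2 ->
    ((u == o) || (k <= u < b)%N) /\ ((v == o) || (k <= v < b)%N).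
  by move=> /d2[]; rewrite !shiftA2 !segmentE.
split.
- split.
  + move=> u v; rewrite glueE /= => /orP[/D1|/D2]; rewrite !segmentE -?val_eqE /=; lia.
  + move=> u uA; rewrite glueE /=.
    have [wlt|wge] := boolP ((o < u)%N && (u < k)%N).
      by rewrite rf1// segmentE; lia.
    rewrite rf2 ?orbT// shiftA2; move: uA wge.
    by rewrite -val_eqE /= !segmentE; lia.
  + by move=> u v; rewrite !glueE /= => /orP[/sy1 ->|/sy2 ->]; rewrite ?orbT.
  + move=> u v w; rewrite !glueE /= => /orP[uv|uv] /orP[vw|vw].
    * by rewrite (tr1 _ _ _ uv vw).
    * by case: (no12 _ _ _ uv vw).
    * by case: (no12 _ _ _ (sy1 _ _ vw) (sy2 _ _ uv)).
    * by rewrite (tr2 _ _ _ uv vw) orbT.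
  + move=> i j l m ij jl lm; rewrite !glueE /= => /orP[il|il] /orP[jm|jm].
    * by rewrite (nc1 _ _ _ _ ij jl lm il jm).
    * by have := D1 _ _ il; have := D2 _ _ jm; rewrite -!val_eqE /=; lia.
    * by have := D2 _ _ il; have := D1 _ _ jm; rewrite -!val_eqE /=; lia.
    * have := D2 _ _ il; have := D2 _ _ jm; rewrite -!val_eqE /= => -[jD mD] [iD lD].
      have jo : j != o by rewrite -val_eqE /=; lia.
      have lo : l != o by rewrite -val_eqE /=; lia.
      have mo : m != o by rewrite -val_eqE /=; lia.
      rewrite (shift_id jo) (shift_id lo) (shift_id mo) in il jm *.
      apply/orP; right; move: il; rewrite /shift; case: eqVneq => [_|io] il.
        have [kj|jk|/val_inj <-] := ltngtP k j; [exact: (nc2 _ _ _ _ kj jl lm il jm)|lia|].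
        by apply: rf2; rewrite segmentE leqnn kb.
      exact: (nc2 _ _ _ _ ij jl lm il jm).
- split; first by rewrite glueE shift_o (shift_id ko) rf2 ?orbT// segmentE leqnn kb.
  move=> v; rewrite glueE /= shift_o => /orP[/D1[]|/d2[_]]; first by rewrite ltnn.
  by rewrite shiftA2 segmentE => /orP[/eqP|/andP[]]; [left|right].
- apply/finset.setP => -[u v]; rewrite rel_restrE glueE /=; apply/idP/idP.
    move=> /and3P[/orP[//|/D2]]; rewrite -!val_eqE !segmentE /=; lia.
  by move=> uv; rewrite uv /= !segmentE; have := D1 _ _ uv; lia.
- apply/finset.setP => -[u v]; rewrite rel_restrE glueE /=; apply/idP/idP.
    move=> /and3P[/orP[/D1|h]]; rewrite !segmentE; first by lia.
    move=> uA vA; rewrite !shift_id in h => //; rewrite -val_eqE /=; lia.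
  move=> uv; have [uA vA] := d2 _ _ uv; rewrite uA vA !andbT.
  rewrite !shift_id ?uv ?orbT//; rewrite -val_eqE /=.
    by move: vA; rewrite segmentE; lia.
  by move: uA; rewrite segmentE; lia.
Qed.

Let gmin z : nc_rel A1 z.1 -> nc_rel A2 z.2 ->
  #|minima (glue z)| = (#|minima z.1| + #|minima z.2|)%N.
Proof.
case: z => r1 r2 /= n1 n2; have [d1 rf1 sy1 tr1 nc1] := n1.
have [d2 rf2 sy2 tr2 nc2] := n2.
have kmin : k \in minima r2.
  apply/minimaP; split; first by apply: rf2; rewrite segmentE leqnn kb.
  by move=> v /d2[_]; rewrite segmentE => /andP[].
(* Only the class of [k] changes its minimum, from [k] to [o]; the number of classes adds up. *)
have -> : minima (glue (r1, r2)) = (minima r1 :|: (o |: (minima r2 :\ k)))%SET.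
  apply/finset.setP => u; rewrite !finset.in_setU finset.in_set1 finset.in_setD1; apply/minimaP/idP.
    rewrite glueE /= => -[/orP[uu|uu] um].
      apply/orP; left; apply/minimaP; split => // v uv.
      by apply: um; rewrite glueE uv.
    apply/orP; right; have [//|uo] := eqVneq u o; rewrite (shift_id uo) in uu.
    rewrite /=; apply/andP; split.
      apply: contraTneq ok => uk; rewrite -leqNgt -uk; apply: um.
      by rewrite glueE /= shift_o (shift_id uo) -uk uu orbT.
    apply/minimaP; split => // v uv; apply: um; rewrite glueE /= (shift_id uo).
    rewrite shift_id ?uv ?orbT//; have [_] := d2 _ _ uv.
    by rewrite segmentE -val_eqE /=; lia.
  move=> /orP[/minimaP[uu um]|/orP[/eqP ->|/andP[uk /minimaP[uu um]]]].
  - split=> [|v]; rewrite glueE /= ?uu// => /orP[/um //|/d2[]].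
    have [uA _] := d1 _ _ uu; move: uA; rewrite shiftA2 !segmentE -val_eqE /=; lia.
  - split=> [|v]; rewrite glueE /= shift_o; first by rewrite rf2 ?orbT// segmentE leqnn kb.
    move=> /orP[/d1[]|/d2[_]]; first by rewrite segmentE ltnn.
    by rewrite shiftA2 segmentE -val_eqE /=; lia.
  - have [uA _] := d2 _ _ uu.
    have uo : u != o by move: uA; rewrite segmentE -val_eqE /=; lia.
    split=> [|v]; rewrite glueE /= (shift_id uo) ?uu ?orbT//.
    move=> /orP[/d1[]|uv]; first by move: uA; rewrite !segmentE; lia.
    move: uv; rewrite /shift; case: eqVneq => [_ uk'|_ /um //].
    by have := um _ uk'; move: uA uk; rewrite segmentE -val_eqE /=; lia.
rewrite cardsU cardsU1 (cardsD1 k (minima r2)) kmin !inE.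
have -> : ((o, o) \in r2) = false.
  by apply/negP => /d2[]; rewrite segmentE; lia.
rewrite /= andbF /= (_ : _ :&: _ = finset.set0)%SET ?cards0 ?subn0//.
apply/finset.setP => u; rewrite !finset.in_setI finset.in_setU finset.in_set1 finset.in_setD1 finset.in_set0; apply/negP.
move=> /andP[/minimaP[/d1[uA _] _] /orP[/eqP uo|/andP[_ /minimaP[/d2[uA' _] _]]]].
  by move: uA; rewrite uo segmentE ltnn.
by move: uA uA'; rewrite !segmentE; lia.
Qed.

Lemma glue_sum :
  \sum_(r | `[< nc_rel A r >] && (next r == k)) x ^+ #|minima r| =
  nc_sum A1 * nc_sum A2.
Proof.
rewrite (reindex_onto glue (fun r => (rel_restr A1 r, rel_restr A2 r))) /=; last first.
  by move=> r /andP[/asboolP nr]; rewrite (next_eq _ ko) => /asboolP nk; exact: gk.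
rewrite /nc_sum mulr_suml.
under [RHS]eq_bigr do rewrite mulr_sumr.
rewrite pair_big /=; apply: eq_big => z.
  apply/idP/idP.
    move=> /andP[/andP[/asboolP nr _] /eqP zE]; apply/andP.
    rewrite -zE /=; split; apply/asboolP; apply: nc_rel_restr nr;
      by apply/fintype.subsetP => u; rewrite !segmentE; lia.
  move=> /andP[/asboolP n1 /asboolP n2]; have [h1 h2 h3 h4] := gnc n1 n2.
  apply/andP; split; first (apply/andP; split; first exact/asboolP).
    by rewrite (next_eq _ ko); apply/asboolP.
  by rewrite h3 h4 -surjective_pairing.
move=> /andP[/andP[/asboolP nr _] /eqP zE].
have n1 : nc_rel A1 z.1.
  rewrite -zE; apply: nc_rel_restr nr; apply/fintype.subsetP => u; rewrite !segmentE; lia.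
have n2 : nc_rel A2 z.2.
  rewrite -zE; apply: nc_rel_restr nr; apply/fintype.subsetP => u; rewrite !segmentE; lia.
by rewrite gmin// exprD.
Qed.

End glue.

(** Relations are sorted by the element following the minimum [o] in its class. *)
Lemma nc_sum_step : nc_sum A = x * nc_sum A' +
  \sum_(k : I | (o < k < b)%N) nc_sum (segment o.+1 k) * nc_sum (segment k b).
Proof.
rewrite {1}/nc_sum (partition_big next xpredT)//= (bigD1 o)//= alone_sum; congr (_ + _).
rewrite (bigID (fun k : I => (o < k < b)%N)) /= [X in _ + X]big1 ?addr0; last first.
  move=> k /andP[ko kA]; rewrite big_pred0// => r; apply/negP => /andP[/asboolP nr].
  rewrite (next_eq _ ko) => /asboolP[/(nc_dom nr)[_]]; rewrite segmentE.
  by move: ko kA; rewrite -val_eqE /=; lia.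
apply: eq_big => k; first by rewrite -val_eqE /=; lia.
by move=> /andP[_ /andP[h1 h2]]; exact: glue_sum.
Qed.

End step.
End noncrossing_relations.

Section noncrossing_partitions.
Variables (n : nat) (K : comNzRingType) (x : K).
Local Notation I := 'I_n.
Implicit Types (p : {set {set I}}) (r : {set I * I}).

Lemma nc_sum_segment a b : (a <= b)%N -> (b <= n)%N ->
  nc_sum x (segment n a b) = mom x (b - a).
Proof.
have [m] := ubnP (b - a); elim: m a b => // m IH a b abm ab bn.
move: ab; rewrite leq_eqVlt => /orP[/eqP ->|ab].
  rewrite subnn mom0 (_ : segment n b b = finset.set0) ?nc_sum0//.
  by apply/finset.setP => u; rewrite segmentE finset.in_set0; lia.
have an : (a < n)%N by lia.
have := @nc_sum_step n K x (Ordinal an) b ab => /= ->.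
rewrite IH; [|lia|lia|lia].
have -> : (b - a = (b - a.+1).+1)%N by lia.
rewrite momS; congr (_ + _).
pose G (k : nat) := mom x (k - a.+1) * mom x (b - k).
rewrite (eq_bigr (fun k : I => G k)); last first.
  by move=> k /andP[h1 h2]; have kn := ltn_ord k; rewrite !IH//; lia.
rewrite -(big_mkord (fun k => (a < k < b)%N) G).
transitivity (\sum_(a.+1 <= k < b) G k).
  rewrite [RHS](big_nat_widen _ _ n)// [RHS](big_nat_widenl _ 0%N)//.
  by apply: eq_bigl => k /=; rewrite andbC.
(* Reversing the index puts the factor of order [b - k] into the role of the order [e + 1] in
   [momS]. *)
rewrite -{1}[a.+1]add0n big_addn big_mkord (reindex_inj rev_ord_inj) /=.
apply: eq_bigr => j _; rewrite /G mulrC; have jn := ltn_ord j.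
by congr (mom x _ * mom x _); lia.
Qed.

Definition rel_of p : {set I * I} := [set z : I * I | z.2 \in finset.pblock p z.1]%SET.
Definition part_of r : {set {set I}} :=
  finset.equivalence_partition (fun u v => (u, v) \in r) [set: I]%SET.

Lemma rel_ofE p (u v : I) : ((u, v) \in rel_of p) = (v \in finset.pblock p u).
Proof. by rewrite inE. Qed.

Lemma part_ofK p : finset.partition p [set: I]%SET -> part_of (rel_of p) = p.
Proof.
move=> pp; rewrite -[RHS](finset.equivalence_partition_pblock pp) /part_of.
by congr (finset.equivalence_partition _ _); apply/funext => u; apply/funext => v; rewrite rel_ofE.
Qed.

Lemma nc_rel_of p : p \in NC n -> nc_rel [set: I]%SET (rel_of p).
Proof.
rewrite inE => /andP[pp /forall_inP ncp].
have /and3P[/eqP cov triv _] := pp.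
have mem u : u \in finset.pblock p u by rewrite finset.mem_pblock cov finset.in_setT.
have pin u : finset.pblock p u \in p by apply: finset.pblock_mem; rewrite cov finset.in_setT.
have eqp u v : (v \in finset.pblock p u) = (finset.pblock p u == finset.pblock p v).
  by rewrite finset.eq_pblock// cov finset.in_setT.
split.
- by move=> u v _; rewrite !finset.in_setT.
- by move=> u _; rewrite rel_ofE.
- by move=> u v; rewrite !rel_ofE !eqp eq_sym.
- by move=> u v w; rewrite !rel_ofE !eqp => /eqP -> /eqP ->.
- move=> i j k l ij jk kl; rewrite !rel_ofE => ik jl.
  have /forall_inP/(_ _ (pin j)) := ncp _ (pin i).
  move=> /forall_inP/(_ _ (mem i))/forall_inP/(_ _ (mem j)).
  move=> /forall_inP/(_ _ ik)/forall_inP/(_ _ jl).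
  by rewrite ij jk kl eqp.
Qed.

Section part_of.
Variable r : {set I * I}.
Hypothesis ncr : nc_rel [set: I]%SET r.

Let eqr : {in [set: I]%SET & &, equivalence_rel (fun u v => (u, v) \in r)}.
Proof.
have [_ rf sy tr _] := ncr.
move=> u v w _ _ _; split; first by apply: rf; rewrite finset.in_setT.
move=> uv; apply/idP/idP => h; first exact: tr (sy _ _ uv) h.
exact: tr uv h.
Qed.

Let pp : finset.partition (part_of r) [set: I]%SET.
Proof. exact: finset.equivalence_partitionP. Qed.

Let pblockE (u v : I) : (v \in finset.pblock (part_of r) u) = ((u, v) \in r).
Proof.
by rewrite (finset.pblock_equivalence_partition eqr) ?finset.in_setT.
Qed.

Lemma rel_ofK : rel_of (part_of r) = r.
Proof. by apply/finset.setP => -[u v]; rewrite rel_ofE pblockE. Qed.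

Let triv : finset.trivIset (part_of r).
Proof. by case/and3P: pp. Qed.

Lemma part_of_NC : part_of r \in NC n.
Proof.
rewrite inE pp /=; have [_ rf sy tr nc] := ncr.
apply/forall_inP => V Vp; apply/forall_inP => W Wp.
apply/forall_inP => i iV; apply/forall_inP => j jW.
apply/forall_inP => k kV; apply/forall_inP => l lW.
apply/implyP => /and3P[ij jk kl].
have iVE := finset.def_pblock triv Vp iV; have jWE := finset.def_pblock triv Wp jW.
have ik : (i, k) \in r by rewrite -pblockE iVE.
have jl : (j, l) \in r by rewrite -pblockE jWE.
have := nc _ _ _ _ ij jk kl ik jl; rewrite -pblockE iVE => jV.
by rewrite -jWE (finset.def_pblock triv Vp jV).
Qed.

Lemma card_part_of : #|part_of r| = #|minima r|.
Proof.
have [_ rf sy tr nc] := ncr.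
have -> : part_of r = [set finset.pblock (part_of r) u | u in minima r]%SET.
  apply/finset.setP => V; apply/idP/finset.imsetP.
    move=> Vp; have /finset.set0Pn[u uV] : V != finset.set0.
      by apply: contraTneq Vp => ->; case/and3P: pp.
    have VE := finset.def_pblock triv Vp uV.
    case: (arg_minnP (P := fun v => v \in V) (fun k : I => k : nat) uV) => v vV vmin.
    exists v; last by rewrite (finset.def_pblock triv Vp vV).
    apply/minimaP; split; first by apply: rf; rewrite finset.in_setT.
    by move=> w; rewrite -pblockE (finset.def_pblock triv Vp vV); exact: vmin.
  move=> [u _ ->]; apply: finset.pblock_mem.
  by case/and3P: pp => /eqP -> _ _; rewrite finset.in_setT.
rewrite finset.card_in_imset// => u v /minimaP[_ um] /minimaP[_ vm] uv.
have ruv : (u, v) \in r.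
  by rewrite -pblockE uv pblockE rf// finset.in_setT.
by apply/val_inj/eqP; rewrite eqn_leq um// vm//; exact: sy.
Qed.

End part_of.

Lemma sum_NC : \sum_(p in NC n) x ^+ #|p| = mom x n.
Proof.
have -> : mom x n = nc_sum x [set: I]%SET.
  rewrite -{1}[n]subn0 -nc_sum_segment//; congr nc_sum.
  by apply/finset.setP => u; rewrite segmentE finset.in_setT ltn_ord.
rewrite (reindex_onto part_of rel_of) /=; last first.
  by move=> p; rewrite inE => /andP[pp _]; exact: part_ofK.
apply: eq_big => r.
  apply/andP/asboolP => [[rN /eqP <-]|nr]; first exact: nc_rel_of.
  by rewrite part_of_NC// rel_ofK.
move=> /andP[rN /eqP rE]; rewrite card_part_of// -rE; exact: nc_rel_of.
Qed.

End noncrossing_partitions.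

(** * Constant cumulants *)

Section cumulants.
Variables (F : numFieldType) (c c' : F).

Lemma sum_NC_cst n : \sum_(p in NC n) \prod_(V in p) c = (wpoly F (nseq n tt)).[c].
Proof.
rewrite horner_wpoly_nseq -sum_NC.
by apply: eq_bigr => p _; rewrite big_const iter_mulr_1.
Qed.

(** With constant cumulants, marking one block of [p] gives [#|p|] equal terms, that is [c'] times
    the derivative at [c] of the monomial of degree [#|p|]. *)
Lemma sum_NC_deriv n : \sum_(p in NC n) \sum_(V in p) c' * \prod_(W in p | W != V) c =
  c' * (wpoly F (nseq n tt))^`().[c].
Proof.
rewrite /wpoly wval_nseq -sum_NC raddf_sum /= horner_sum mulr_sumr.
apply: eq_bigr => p _; rewrite derivXn hornerMn hornerXn.
rewrite (eq_bigr (fun=> c' * c ^+ #|p|.-1)); last first.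
  move=> V Vp; rewrite (eq_bigl (fun W => W \in p :\ V)%SET); last first.
    by move=> W; rewrite !inE andbC.
  by rewrite big_const iter_mulr_1 (cardsD1 V p) Vp.
by rewrite sumr_const mulrnAr.
Qed.

End cumulants.

(** * Freeness and infinitesimal freeness *)

Section freeness.
Variables (K : comNzRingType) (A : algType K) (I : eqType) (x : I -> A) (c : K).
(** [T i a w b] stands for the sum of [Phi (a * u * x i) * Phi (v * b)] over the factorizations
    [w = u * x i * v]: the word is cut after each letter [x i]. The outer arguments [a] and [b] are
    there to make the Leibniz rule [TM] expressible. *)
Variables (Phi : A -> K) (T : I -> A -> A -> A -> K).
Hypothesis PhiP : forall k a b, Phi (k *: a + b) = k * Phi a + Phi b.
Hypothesis Phi1 : Phi 1 = 1.
Hypothesis TP : forall i a k w w' b, T i a (k *: w + w') b = k * T i a w b + T i a w' b.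
Hypothesis TM : forall i a w w' b,
  T i a (w * w') b = T i a w (w' * b) + T i (a * w) w' b.
Hypothesis Tx : forall i j a b, T i a (x j) b = (i == j)%:R * (Phi (a * x i) * Phi b).
(* The Schwinger-Dyson equation of the planar limit. *)
Hypothesis PhiS : forall i w, Phi (x i * w) = c * Phi w + T i 1 w 1.

Let Phi0 : Phi 0 = 0.
Proof. by have := PhiP (-1) 0 0; rewrite scaler0 addr0 mulN1r addNr. Qed.

Let PhiZ k a : Phi (k *: a) = k * Phi a.
Proof. by rewrite -[k *: a]addr0 PhiP Phi0 addr0. Qed.

Let PhiD a b : Phi (a + b) = Phi a + Phi b.
Proof. by rewrite -[a in LHS]scale1r PhiP mul1r. Qed.

Let Phi_sum (J : Type) (r : seq J) (F : J -> A) :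
  Phi (\sum_(j <- r) F j) = \sum_(j <- r) Phi (F j).
Proof. exact: (big_morph _ PhiD Phi0). Qed.

Let T0 i a b : T i a 0 b = 0.
Proof. by have := TP i a (-1) 0 0 b; rewrite scaler0 addr0 mulN1r addNr. Qed.

Let TZ i a k w b : T i a (k *: w) b = k * T i a w b.
Proof. by rewrite -[k *: w]addr0 TP T0 addr0. Qed.

Let TD i a w w' b : T i a (w + w') b = T i a w b + T i a w' b.
Proof. by rewrite -[w in LHS]scale1r TP mul1r. Qed.

Let T_sum i a b (J : Type) (r : seq J) (F : J -> A) :
  T i a (\sum_(j <- r) F j) b = \sum_(j <- r) T i a (F j) b.
Proof. exact: (big_morph (fun w => T i a w b) (fun w w' => TD i a w w' b) (T0 i a b)). Qed.

Let T1 i a b : T i a 1 b = 0.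
Proof.
by apply: (addrI (T i a 1 b)); rewrite addr0 -{3}[1]mulr1 TM mulr1 mul1r.
Qed.

Definition alg_poly (i : I) (f : {poly K}) : A := horner_alg (x i) f.

Let alg_polyE i f : alg_poly i f = \sum_(r < size f) f`_r *: x i ^+ r.
Proof.
rewrite /alg_poly -{1}[f]coefK poly_def linear_sum; apply: eq_bigr => r _.
by rewrite linearZ /= rmorphXn /= horner_algX mulr_algl.
Qed.

Let T_pow i a r b : T i a (x i ^+ r) b =
  \sum_(e < r) Phi (a * x i ^+ e.+1) * Phi (x i ^+ (r.-1 - e) * b).
Proof.
elim: r a => [|r IH] a; first by rewrite expr0 T1 big_ord0.
rewrite exprS TM Tx eqxx mul1r IH big_ord_recl /= subn0 expr1; congr (_ + _).
apply: eq_bigr => e _; rewrite -mulrA -exprS /bump /= add1n.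
by congr (_ * Phi (_ ^+ _ * _)); have := ltn_ord e; lia.
Qed.

(** Cuts at [x i] inside a polynomial in [x j] exist only for [i = j]; each term is then a product
    in which one of the two families of hypotheses supplies a zero. *)
Let T_alg_poly i j f a b :
  (i == j -> (forall e, Phi (x i ^+ e * b) = 0) \/ (forall e, Phi (a * x i ^+ e) = 0)) ->
  T i a (alg_poly j f) b = 0.
Proof.
move=> h; rewrite alg_polyE T_sum big1// => r _; rewrite TZ.
have [ij|ij] := eqVneq i j; last first.
  suff -> : T i a (x j ^+ r) b = 0 by rewrite mulr0.
  elim: (nat_of_ord r) a {h} => [|m IH] a; first by rewrite expr0 T1.
  by rewrite exprS TM Tx (negPf ij) mul0r add0r.
rewrite -ij T_pow big1 ?mulr0// => e _.
by case: (h _) => [|->|->]; rewrite ?mulr0 ?mul0r// ij eqxx.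
Qed.

Implicit Types (l : seq (I * {poly K})).

Definition prod_alg l : A := \prod_(p <- l) alg_poly p.1 p.2.
Definition alternating (U : Type) (i : I) (l : seq (I * U)) :=
  path (fun j k => j != k) i (map fst l).
Definition centered l := all (fun p => Phi (alg_poly p.1 p.2) == 0) l.

Let alternating_cat (U : Type) i (l1 l2 : seq (I * U)) : alternating i (l1 ++ l2) =
  alternating i l1 && alternating (last i (map fst l1)) l2.
Proof. by rewrite /alternating map_cat cat_path. Qed.

Let prod_alg_cons p l : prod_alg (p :: l) = alg_poly p.1 p.2 * prod_alg l.
Proof. exact: big_cons. Qed.

Let prod_alg_cat l1 l2 : prod_alg (l1 ++ l2) = prod_alg l1 * prod_alg l2.
Proof. exact: big_cat. Qed.

(** Induction on the length of [l], then on [d]. For [d = 0] the first factor is expanded in powers,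
    leaving a shorter list. Otherwise [PhiS] removes one [x i]: the terms with all of [l] intact
    have a lower power, and a cut inside [l] counts only in a factor of index [i]. *)
Let free_pow i l d : l != [::] -> alternating i l -> centered l ->
  Phi (x i ^+ d * prod_alg l) = 0.
Proof.
have [n] := ubnP (size l); elim: n i l d => // n IH i l d.
have [m] := ubnP d; elim: m d l => // m IHd [|d] l dm ln l0 al ce.
  case: l ln l0 al ce => // -[j f] l /= ln _ /andP[ij al] /andP[/eqP fj ce].
  rewrite expr0 mul1r prod_alg_cons /=.
  have [->|l0] := eqVneq l [::]; first by rewrite /prod_alg big_nil mulr1.
  rewrite alg_polyE mulr_suml Phi_sum big1// => r _.
  by rewrite -scalerAl PhiZ IH ?mulr0.
rewrite exprS -mulrA PhiS IHd// mulr0 add0r TM mul1r mulr1.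
rewrite T_pow big1 ?add0r; last first.
  by move=> e _; rewrite IHd ?mulr0//; have := ltn_ord e; lia.
(* The Leibniz rule passes the factors of [l] to the left argument one by one; [l1] collects those
   already passed. *)
suff h l1 l2 : l1 ++ l2 = l -> T i (x i ^+ d * prod_alg l1) (prod_alg l2) 1 = 0.
  by have := h [::] l erefl; rewrite /prod_alg big_nil mulr1.
elim: l2 l1 => [|[j f] l2 IHl] l1 lE; first by rewrite /prod_alg big_nil T1.
rewrite prod_alg_cons TM /= mulr1.
have -> : x i ^+ d * prod_alg l1 * alg_poly j f = x i ^+ d * prod_alg (rcons l1 (j, f)).
  by rewrite -cats1 prod_alg_cat prod_alg_cons /prod_alg big_nil mulr1 mulrA.
rewrite IHl ?addr0; last by rewrite cat_rcons.
apply: T_alg_poly => /eqP ij; subst j.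
move: al ce ln; rewrite -lE alternating_cat /centered all_cat /= size_cat /=.
move=> /andP[al1 /andP[nil1 al2]] /andP[ce1 /andP[_ ce2]] ln.
(* If factors follow the cut, the right half vanishes by induction on length; after the last factor
   the left half has to vanish instead. *)
have [l20|l20] := eqVneq l2 [::]; last by left => e; apply: IH => //; lia.
right => e; subst l2.
have l10 : l1 != [::] by apply: contraNneq nil1 => ->.
(* Centring the power of [x i] makes [l1] with this factor appended a list as long as [l], covered
   by the induction on [d]; the constant subtracted leaves the shorter list [l1], nonempty because
   [l] starts with an index other than [i]. *)
pose f0 : {poly K} := 'X^e - (Phi (x i ^+ e))%:P.
have f0E : alg_poly i f0 = x i ^+ e - Phi (x i ^+ e) *: 1.
  rewrite /alg_poly /f0 rmorphB /= horner_algC rmorphXn /= horner_algX.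
  by [].
have := IHd d (rcons l1 (i, f0)).
rewrite -cats1 prod_alg_cat prod_alg_cons /= {2}/prod_alg big_nil mulr1 f0E.
rewrite mulrBr mulrBr -scalerAr -scalerAr mulr1 -scaleN1r addrC PhiP PhiZ.
rewrite (IH _ l1)//; last by lia.
rewrite !mulr0 add0r mulrA => -> //.
- by rewrite size_cat /=; lia.
- by case: (l1).
- by rewrite alternating_cat al1 /alternating /= nil1.
- rewrite /centered all_cat /= ce1 f0E -scaleN1r addrC PhiP PhiZ Phi1.
  by rewrite mulr1 mulN1r addNr eqxx.
Qed.

(** Expanding the first factor in powers leads to [free_pow]; a single factor is centred by
    hypothesis. *)
Lemma freeness i f l : alternating i l -> centered ((i, f) :: l) ->
  Phi (prod_alg ((i, f) :: l)) = 0.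
Proof.
move=> al /= /andP[/eqP f0 ce]; rewrite prod_alg_cons /=.
have [->|l0] := eqVneq l [::]; first by rewrite /prod_alg big_nil mulr1.
rewrite alg_polyE mulr_suml Phi_sum big1// => r _.
by rewrite -scalerAl PhiZ free_pow ?mulr0.
Qed.

End freeness.

Section infinitesimal.
Variables (K C : comNzRingType) (A : algType K) (I : eqType).
Variables (Phi : A -> K) (B : I -> A -> Prop) (v : {rmorphism K -> C}) (dv : K -> C).
Hypothesis PhiP : forall k a b, Phi (k *: a + b) = k * Phi a + Phi b.
Hypothesis Phi1 : Phi 1 = 1.
Hypothesis BM : forall i a b, B i a -> B i b -> B i (a * b).
Hypothesis BC : forall i a k, B i a -> B i (a - k *: 1).
Hypothesis dvD : forall p q, dv (p + q) = dv p + dv q.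
Hypothesis dvM : forall p q, dv (p * q) = dv p * v q + v p * dv q.
Implicit Types (l L : seq (I * A)).

Definition prod_seq l : A := \prod_(p <- l) p.2.
Definition alternates l := sorted (fun j k : I => j != k) (map fst l).

Hypothesis free : forall l, l != [::] -> alternates l ->
  (forall p, p \in l -> B p.1 p.2 /\ Phi p.2 = 0) -> Phi (prod_seq l) = 0.

Definition phi a : C := v (Phi a).
Definition dphi a : C := dv (Phi a).
Definition admissible l := forall p, p \in l -> B p.1 p.2 /\ phi p.2 = 0.

Let Phi0 : Phi 0 = 0.
Proof. by have := PhiP (-1) 0 0; rewrite scaler0 addr0 mulN1r addNr. Qed.

Let PhiB a k b : Phi (a - k *: b) = Phi a - k * Phi b.
Proof. by rewrite addrC -scaleNr PhiP mulNr addrC. Qed.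

Let dv0 : dv 0 = 0.
Proof. by apply: (addrI (dv 0)); rewrite -dvD !addr0. Qed.

Let dvN p : dv (- p) = - dv p.
Proof. by apply/eqP; rewrite -addr_eq0 -dvD addNr dv0. Qed.

(** [phi p.2 = 0] only says that [Phi p.2] vanishes under [v]. Freeness over [K] needs [Phi] itself
    to vanish, so this scalar of [K] is subtracted. *)
Let recenter (p : I * A) : I * A := (p.1, p.2 - Phi p.2 *: 1).

Let prod_seq_cons p l : prod_seq (p :: l) = p.2 * prod_seq l.
Proof. exact: big_cons. Qed.

Let prod_seq_cat l L : prod_seq (l ++ L) = prod_seq l * prod_seq L.
Proof. exact: big_cat. Qed.

Let prod_seq0 : prod_seq [::] = 1. Proof. exact: big_nil. Qed.

Let admissible_cons p l : admissible (p :: l) -> admissible l.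
Proof. by move=> h q ql; apply: h; rewrite inE ql orbT. Qed.

Let Phi_recenter a k b d : Phi (a * (b - k *: 1) * d) = Phi (a * b * d) - k * Phi (a * d).
Proof. by rewrite mulrBr mulrBl -scalerAr mulr1 -scalerAl PhiB. Qed.

Let phi_recenter l a b : admissible l ->
  phi (a * prod_seq (map recenter l) * b) = phi (a * prod_seq l * b).
Proof.
elim: l a => [|p l IH] a adm //=.
rewrite !prod_seq_cons !mulrA IH; last exact: admissible_cons adm.
rewrite /phi -!(mulrA (a * _)) Phi_recenter rmorphB rmorphM.
by have [_ p0] := adm p (mem_head _ _); rewrite -/(phi p.2) p0 mul0r subr0.
Qed.

Let alternates_recenter l : alternates (map recenter l) = alternates l.
Proof. by rewrite /alternates -map_comp. Qed.

Let free_recenter l : l != [::] -> alternates l -> admissible l ->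
  Phi (prod_seq (map recenter l)) = 0.
Proof.
move=> l0 al adm; apply: free.
- by case: l l0 {al adm}.
- by rewrite alternates_recenter.
- move=> p /mapP[q ql ->] /=; have [Bq _] := adm q ql; split; first exact: BC.
  by rewrite PhiB Phi1 mulr1 subrr.
Qed.

Lemma phi_free l : l != [::] -> alternates l -> admissible l -> phi (prod_seq l) = 0.
Proof.
move=> l0 al adm; have := phi_recenter 1 1 adm; rewrite !mul1r !mulr1 => <-.
by rewrite /phi free_recenter// rmorph0.
Qed.

(** Recentring a factor subtracts [Phi p.2] times the product without it. Under [dv] only the
    derivative of [Phi p.2] survives, since [v] kills [Phi p.2]; in the other factors the change is
    then invisible. *)
Let dphi_expand i0 l a : admissible l -> dphi (a * prod_seq l) =
  dphi (a * prod_seq (map recenter l)) +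
  \sum_(k < size l) dphi (nth (i0, 0) l k).2 *
    phi (a * prod_seq (take k l) * prod_seq (drop k.+1 l)).
Proof.
elim: l a => [|p l IH] a adm; first by rewrite big_ord0 addr0.
have [_ p0] := adm p (mem_head _ _).
rewrite big_ord_recl /= drop0 prod_seq0 mulr1.
have -> : dphi (a * prod_seq (p :: l)) =
    dphi (a * (recenter p).2 * prod_seq l) + dphi p.2 * phi (a * prod_seq l).
  rewrite /dphi Phi_recenter dvD dvN dvM -/(phi p.2) p0 mul0r addr0 subrK.
  by rewrite prod_seq_cons mulrA.
rewrite IH; last exact: admissible_cons adm.
rewrite -mulrA -(prod_seq_cons (recenter p)) -addrA; congr (_ + _).
rewrite addrC; congr (_ + _); apply: eq_bigr => k _.
rewrite /bump /= add1n prod_seq_cons; congr (_ * _).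
rewrite /phi -(mulrA (a * _)) Phi_recenter rmorphB rmorphM -/(phi p.2) p0.
by rewrite mul0r subr0 !mulrA.
Qed.

(** The fully recentred product has [Phi] equal to 0 in [K], hence no derivative; only the words
    with one factor removed remain. *)
Lemma dphi_prod i0 l : l != [::] -> alternates l -> admissible l ->
  dphi (prod_seq l) = \sum_(k < size l) dphi (nth (i0, 0) l k).2 *
    phi (prod_seq (take k l) * prod_seq (drop k.+1 l)).
Proof.
move=> l0 al adm; have := dphi_expand i0 1 adm; rewrite !mul1r => ->.
rewrite /dphi free_recenter// dv0 add0r.
by apply: eq_bigr => k _; rewrite mul1r.
Qed.

Let alternates_cat_cons l p L : alternates (l ++ p :: L) =
  alternates (rcons l p) && alternates (p :: L).
Proof.
rewrite /alternates map_cat map_rcons; case: (map fst l) => [|i s] //=.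
by rewrite cat_path rcons_path /= andbA.
Qed.

Let alternates_rev l : alternates (rev l) = alternates l.
Proof.
rewrite /alternates map_rev rev_sorted; apply: eq_sorted => i j.
by rewrite eq_sym.
Qed.

(** The word is collapsed from its middle. Two adjacent factors in different algebras leave an
    alternating word, of value 0. In the same algebra their product is its centred part, which again
    alternates, plus the scalar [phi] of the product. *)
Lemma phi_collapse l L : alternates l -> alternates L -> admissible l -> admissible L ->
  phi (prod_seq (rev l) * prod_seq L) =
  if size l == size L then \prod_(q <- zip l L) phi (q.1.2 * q.2.2) else 0.
Proof.
elim: l L => [|p l IH] [|q L] al aL adml admL.
- by rewrite /= !prod_seq0 mulr1 big_nil /phi Phi1 rmorph1.
- by rewrite /rev /= prod_seq0 mul1r phi_free.
- rewrite /= prod_seq0 mulr1 phi_free ?alternates_rev//.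
    by rewrite -size_eq0 size_rev.
  by move=> r; rewrite mem_rev; exact: adml.
have [Bp p0] := adml p (mem_head _ _); have [Bq q0] := admL q (mem_head _ _).
have admrev : admissible (rev l).
  by move=> r; rewrite mem_rev => rl; apply: adml; rewrite inE rl orbT.
have al' : alternates l by move: al; rewrite /alternates /=; exact: path_sorted.
have aL' : alternates L by move: aL; rewrite /alternates /=; exact: path_sorted.
have arev : alternates (rcons (rev l) p) by rewrite -rev_cons alternates_rev.
have assoc : prod_seq (rev (p :: l)) * prod_seq (q :: L) =
    prod_seq (rev l) * (p.2 * q.2) * prod_seq L.
  by rewrite rev_cons -cats1 prod_seq_cat !prod_seq_cons prod_seq0 mulr1 !mulrA.
rewrite /= eqSS big_cons assoc.
have [pq|pq] := eqVneq p.1 q.1; last first.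
  have -> : phi (p.2 * q.2) = 0.
    rewrite (_ : p.2 * q.2 = prod_seq [:: p; q]).
      apply: phi_free => //; first by rewrite /alternates /= pq.
      by move=> r; rewrite !inE => /orP[] /eqP ->.
    by rewrite !prod_seq_cons prod_seq0 mulr1.
  rewrite mul0r if_same -assoc -prod_seq_cat rev_cons -cats1 -catA.
  apply: phi_free; first by case: (rev l).
    by rewrite alternates_cat_cons arev /alternates /= pq.
  move=> r; rewrite mem_cat inE => /orP[/admrev //|/orP[/eqP -> //|]].
  exact: admL.
pose m := p.2 * q.2.
have mE : phi (prod_seq (rev l) * m * prod_seq L) =
    phi (prod_seq (rev l) * (m - Phi m *: 1) * prod_seq L) +
    phi m * phi (prod_seq (rev l) * prod_seq L).
  by rewrite /phi Phi_recenter rmorphB rmorphM subrK.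
rewrite mE (_ : phi (_ * (_ - _) * _) = 0) ?add0r; last first.
  have -> : prod_seq (rev l) * (m - Phi m *: 1) * prod_seq L =
      prod_seq (rev l ++ (p.1, m - Phi m *: 1) :: L).
    by rewrite prod_seq_cat prod_seq_cons mulrA.
  apply: phi_free; first by case: (rev l).
    rewrite alternates_cat_cons; apply/andP; split.
      by move: arev; rewrite /alternates !map_rcons.
    by move: aL; rewrite /alternates /= pq.
  move=> r; rewrite mem_cat inE => /orP[/admrev //|/orP[/eqP ->|rL]].
    split=> /=; first by apply: BC; apply: BM => //; rewrite pq.
    by rewrite /phi PhiB Phi1 mulr1 subrr rmorph0.
  by apply: admL; rewrite inE rL orbT.
rewrite IH//; first by case: ifP => _ //; rewrite mulr0.
- exact: admissible_cons adml.
- exact: admissible_cons admL.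
Qed.

Lemma alternates_nat n (j : nat -> I) (a : nat -> A) :
  (forall k, (k.+1 < n)%N -> j k <> j k.+1) ->
  alternates [seq (j k, a k) | k <- iota 0 n].
Proof.
move=> jj; rewrite /alternates -map_comp.
rewrite (_ : [seq _ | _ <- _] = mkseq j n)//; apply/(sortedP (j 0%N)) => k.
rewrite size_mkseq => kn; rewrite !nth_mkseq//; last by lia.
by apply/eqP/jj.
Qed.

(** Removing the factor of index [k] leaves a prefix and a suffix that collapse to a nonzero value
    only if they have equal length. So [n] must be odd and [k] the middle index. *)
Lemma infinitesimal_freeness n (j : nat -> I) (a : nat -> A) : (0 < n)%N ->
  (forall k, (k < n)%N -> B (j k) (a k)) ->
  (forall k, (k.+1 < n)%N -> j k <> j k.+1) ->
  (forall k, (k < n)%N -> phi (a k) = 0) ->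
  [/\ phi (\prod_(k < n) a k) = 0,
      ~~ odd n -> dphi (\prod_(k < n) a k) = 0 &
      forall m, n = m.*2.+1 ->
        dphi (\prod_(k < n) a k) =
        (\prod_(k < m) phi (a k * a (m.*2 - k)%N)) * dphi (a m)].
Proof.
move=> n0 Ba jj a0; pose l := [seq (j k, a k) | k <- iota 0 n].
have szl : size l = n by rewrite size_map size_iota.
have nthl i0 k : (k < n)%N -> nth (i0, 0) l k = (j k, a k).
  by move=> kn; rewrite (nth_map 0%N) ?size_iota// nth_iota.
have lE : \prod_(k < n) a k = prod_seq l.
  by rewrite /prod_seq big_map -(big_mkord xpredT a) /index_iota subn0.
have l0 : l != [::] by rewrite -size_eq0 szl; lia.
have al : alternates l by exact: alternates_nat.
have adm : admissible l.
  move=> p /mapP[k]; rewrite mem_iota add0n => /andP[_ kn] -> /=.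
  by split; [exact: Ba|exact: a0].
have dE := dphi_prod (j 0%N) l0 al adm.
have term k : (k < n)%N -> phi (prod_seq (take k l) * prod_seq (drop k.+1 l)) =
    if k == (n - k.+1)%N then \prod_(q <- zip (rev (take k l)) (drop k.+1 l))
      phi (q.1.2 * q.2.2) else 0.
  move=> kn; rewrite -{1}[take k l]revK phi_collapse.
  - by rewrite size_rev size_take size_drop szl kn.
  - rewrite alternates_rev /alternates map_take; apply: take_sorted.
    exact: al.
  - by rewrite /alternates map_drop; apply: drop_sorted; exact: al.
  - by move=> p; rewrite mem_rev => /mem_take; exact: adm.
  - by move=> p /mem_drop; exact: adm.
rewrite !lE; split; first exact: phi_free.
  move=> nodd; rewrite dE big1// => k _; rewrite term; last by rewrite -szl.
  case: eqP => [e|_]; last by rewrite mulr0.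
  have kn : (k < n)%N by rewrite -szl.
  by move: nodd; rewrite (_ : n = k.*2.+1) /= ?odd_double//; lia.
move=> m nE; rewrite dE szl.
have mn : (m < n)%N by lia.
rewrite (bigD1 (Ordinal mn))//= big1 ?addr0 => [|k km]; last first.
  rewrite term//; case: eqP => [e|_]; last by rewrite mulr0.
  by move: km; rewrite -val_eqE /=; have := ltn_ord k; lia.
rewrite term// ifT; last by apply/eqP; lia.
rewrite nthl//= mulrC; congr (_ * _).
have sz1 : size (rev (take m l)) = m by rewrite size_rev size_take szl mn.
have sz2 : size (drop m.+1 l) = m by rewrite size_drop szl; lia.
rewrite (big_nth ((j 0%N, 0), (j 0%N, 0))) big_mkord size_zip sz1 sz2 minnn.
(* The collapse lists the pairs from the middle outwards, the statement from the ends inwards. *)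
rewrite (reindex_inj rev_ord_inj) /=; apply: eq_bigr => k _.
have km := ltn_ord k.
rewrite nth_zip ?sz1 ?sz2//= nth_rev size_take szl mn; last by lia.
rewrite nth_take; last by lia.
rewrite nth_drop !nthl/=; [|lia|lia].
by congr (phi (a _ * a _)); lia.
Qed.

End infinitesimal.

(** * The free algebra and the limit space *)

Section scalerAr.
Variables (K : comNzRingType) (A : lalgType K).
Implicit Types (h k : K) (a b : A).

(** With the next lemma, extends the commutation of scalars with products from words to their linear
    combinations. *)
Lemma scalerAr_right h a b b' : (forall k, k *: (a * b) = a * (k *: b)) ->
  (forall k, k *: (a * b') = a * (k *: b')) ->
  forall k, k *: (a * (h *: b + b')) = a * (k *: (h *: b + b')).
Proof.
move=> e e' k; rewrite scalerDr !mulrDr scalerDr e'.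
by rewrite -e !scalerA e.
Qed.

Lemma scalerAr_left h k a a' b : k *: (a * b) = a * (k *: b) ->
  k *: (a' * b) = a' * (k *: b) -> k *: ((h *: a + a') * b) = (h *: a + a') * (k *: b).
Proof.
by move=> e e'; rewrite !mulrDl scalerDr e' -!scalerAl -e !scalerA mulrC.
Qed.

End scalerAr.

Section free_algebra.
Import -(notations) monalg.
Variables (I : choiceType) (K : comNzRingType).
Implicit Types (u w : seq I).

Definition ncpoly : Type := malg (fmonom I) K.
HB.instance Definition _ := GRing.Lalgebra.on ncpoly.

Definition word w : ncpoly := mkmalgU (FMonom w) (1 : K).

Let monE (w : fmonom I) k : mkmalgU w k = k *: (word (fmonom_val w) : malg (fmonom I) K).
Proof.
apply/malgP => m; rewrite mcoeffZ /word fmK !mcoeffU.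
by rewrite mulr_natr.
Qed.

Lemma ncpoly_ind (Q : ncpoly -> Prop) : Q 0 ->
  (forall k a b, Q a -> Q b -> Q (k *: a + b)) -> (forall w, Q (word w)) -> forall a, Q a.
Proof.
move=> Q0 QP Qw a; rewrite [a](@monalgE (fmonom I) K).
apply: (big_ind Q) => // [b b' Qb Qb'|w _].
  by have := QP 1 b b' Qb Qb'; rewrite scale1r.
by rewrite monE; have := QP (mcoeff w a) _ _ (Qw w) Q0; rewrite addr0.
Qed.

Lemma wordM u w : word u * word w = word (u ++ w).
Proof.
have := @fgmulUU (fmonom I) K 1 1 (FMonom u) (FMonom w).
rewrite -malgM_def mulr1 /word => ->; congr (mkmalgU _ _).
by apply/eqP; rewrite fmP fmM.
Qed.

Lemma word_nil : word [::] = 1.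
Proof.
by congr (mkmalgU _ _); apply/eqP; rewrite fmP fm1.
Qed.

Let scaler_word k u (b : ncpoly) : k *: (word u * b) = word u * (k *: b).
Proof.
elim/ncpoly_ind: b k => [|h b b' IH IH'|w] k; first by rewrite scaler0 mulr0 scaler0.
  exact: scalerAr_right IH IH' k.
have sc k' w' : k' *: word w' = mkmalgU (FMonom w') k' := esym (monE (FMonom w') k').
have := @fgmulUU (fmonom I) K 1 k (FMonom u) (FMonom w).
rewrite -malgM_def mul1r wordM !sc => /esym; congr (_ = _); congr (mkmalgU _ _).
by apply/eqP; rewrite fmP fmM.
Qed.

Let ncpoly_scalerAr k (a b : ncpoly) : k *: (a * b) = a * (k *: b).
Proof.
elim/ncpoly_ind: a => [|h a a' IH IH'|u]; first by rewrite !mul0r scaler0.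
  exact: scalerAr_left IH IH'.
exact: scaler_word.
Qed.

HB.instance Definition _ := GRing.Lalgebra_isAlgebra.Build K ncpoly ncpoly_scalerAr.

Definition ncpoly_lin (h : seq I -> K) (a : ncpoly) : K :=
  mmap idfun (fun m : fmonom I => h (fmonom_val m)) a.

Lemma ncpoly_linP h k a b : ncpoly_lin h (k *: a + b) = k * ncpoly_lin h a + ncpoly_lin h b.
Proof.
rewrite /ncpoly_lin mmapD; congr (_ + _).
rewrite (@mmapEw _ _ _ _ _ (msupp (a : malg (fmonom I) K))) ?msuppZ_le//.
by rewrite mmapE mulr_sumr; apply: eq_bigr => m _; rewrite mcoeffZ mulrA.
Qed.

Lemma ncpoly_lin_word h w : ncpoly_lin h (word w) = h w.
Proof. by rewrite /ncpoly_lin mmapU mul1r. Qed.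

End free_algebra.

Definition poly_in (I : eqType) (K : comNzRingType) (A : algType K) (x : I -> A) i a :=
  exists f : {poly K}, a = alg_poly x i f.

Section poly_in.
Variables (I : eqType) (K : comNzRingType) (A : algType K) (x : I -> A).

Lemma poly_inM i a b : poly_in x i a -> poly_in x i b -> poly_in x i (a * b).
Proof. by move=> [f ->] [g ->]; exists (f * g); rewrite /alg_poly rmorphM. Qed.

Lemma poly_inP i k a b : poly_in x i a -> poly_in x i b -> poly_in x i (k *: a + b).
Proof. by move=> [f ->] [g ->]; exists (k *: f + g); rewrite /alg_poly linearP /= mulr_algl. Qed.

Lemma poly_in1 i : poly_in x i 1.
Proof. by exists 1; rewrite /alg_poly rmorph1. Qed.

Lemma poly_in_var i : poly_in x i (x i).
Proof. by exists 'X; rewrite /alg_poly /= horner_algX. Qed.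

End poly_in.

Section planar_functional.
Variables (I : choiceType) (K : comNzRingType) (A : algType K) (c : K).
Variable word : seq I -> A.
Hypothesis wordM : forall u w, word u * word w = word (u ++ w).
Hypothesis word_nil : word [::] = 1.
Hypothesis A_ind : forall Q : A -> Prop, Q 0 ->
  (forall k a b, Q a -> Q b -> Q (k *: a + b)) -> (forall w, Q (word w)) -> forall a, Q a.
Implicit Types (a b w : A).

Variables (planar : A -> K) (cut : I -> A -> A -> A -> K).
Hypothesis planarP : forall k a b, planar (k *: a + b) = k * planar a + planar b.
Hypothesis planar_word : forall w : seq I, planar (word w) = wval c w.
Hypothesis cutP : forall i k a w w' b, cut i a (k *: w + w') b = k * cut i a w b + cut i a w' b.
Hypothesis cut_word : forall i a b (m : seq I), cut i a (word m) b =
  \sum_(p <- splits i m) planar (a * word (rcons p.1 i)) * planar (word p.2 * b).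

Let nvar (i : I) : A := word [:: i].

Let planar0 : planar 0 = 0.
Proof. by have := planarP (-1) 0 0; rewrite scaler0 addr0 mulN1r addNr. Qed.

Let cut0 i a b : cut i a 0 b = 0.
Proof. by have := cutP i (-1) a 0 0 b; rewrite scaler0 addr0 mulN1r addNr. Qed.

Let comb (h k p q r t : K) : h * (k * p + q) + (k * r + t) = k * (h * p + r) + (h * q + t).
Proof. by ring. Qed.

Let cutPl i k a a' w b : cut i (k *: a + a') w b = k * cut i a w b + cut i a' w b.
Proof.
elim/A_ind: w => [|h w w' IH IH'|w]; first by rewrite !cut0 mulr0 addr0.
  by rewrite !cutP IH IH' comb.
rewrite !cut_word mulr_sumr -big_split /=; apply: eq_bigr => p _.
by rewrite mulrDl -scalerAl planarP mulrDl -mulrA.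
Qed.

Let cutPr i k a w b b' : cut i a w (k *: b + b') = k * cut i a w b + cut i a w b'.
Proof.
elim/A_ind: w => [|h w w' IH IH'|w]; first by rewrite !cut0 mulr0 addr0.
  by rewrite !cutP IH IH' comb.
rewrite !cut_word mulr_sumr -big_split /=; apply: eq_bigr => p _.
by rewrite mulrDr -scalerAr planarP mulrDr mulrCA.
Qed.

Let cut0l i w b : cut i 0 w b = 0.
Proof. by have := cutPl i (-1) 0 0 w b; rewrite scaler0 addr0 mulN1r addNr. Qed.

Let cut0r i a w : cut i a w 0 = 0.
Proof. by have := cutPr i (-1) a w 0 0; rewrite scaler0 addr0 mulN1r addNr. Qed.

(** Linearity in every argument reduces [w] and [w'] to words, where the formula is [splits_cat]. *)
Let cutM i a w w' b : cut i a (w * w') b = cut i a w (w' * b) + cut i (a * w) w' b.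
Proof.
elim/A_ind: w => [|h v v' IH IH'|u].
- by rewrite mul0r mulr0 !cut0 cut0l addr0.
- by rewrite mulrDl mulrDr -scalerAl -scalerAr !cutP cutPl IH IH' mulrDr addrACA.
elim/A_ind: w' => [|h v v' IH IH'|w].
- by rewrite mulr0 mul0r !cut0 cut0r addr0.
- by rewrite mulrDr mulrDl -scalerAr -scalerAl !cutP cutPr IH IH' mulrDr addrACA.
rewrite wordM !cut_word splits_cat big_cat !big_map /=.
congr (_ + _); apply: eq_bigr => p _; first by rewrite -wordM mulrA.
by rewrite -mulrA wordM rcons_cat.
Qed.

Let cut_var i j a b : cut i a (nvar j) b = (i == j)%:R * (planar (a * nvar i) * planar b).
Proof.
rewrite /nvar cut_word /= cats0 eq_sym.
by case: eqP => _; rewrite ?big_nil ?mul0r// big_seq1 /= word_nil !mul1r.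
Qed.

Let planar_loop i w : planar (nvar i * w) = c * planar w + cut i 1 w 1.
Proof.
elim/A_ind: w => [|k w w' IH IH'|w].
- by rewrite mulr0 planar0 cut0 mulr0 addr0.
- by rewrite mulrDr -scalerAr !planarP cutP IH IH' !mulrDr addrACA mulrCA.
rewrite /nvar wordM !planar_word wval_cons cut_word; congr (_ + _).
by apply: eq_bigr => p _; rewrite mul1r mulr1 !planar_word.
Qed.

Let freeness_of_cut i f l : alternating i l -> centered nvar planar ((i, f) :: l) ->
  planar (prod_alg nvar ((i, f) :: l)) = 0.
Proof.
have p1 : planar 1 = 1 by rewrite -word_nil planar_word.
have := @freeness K A I nvar c planar cut planarP p1 (fun i a k => cutP i k a) cutM cut_var planar_loop i f l.
exact.
Qed.

Lemma planar_free (l : seq (I * A)) : l != [::] -> alternates l ->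
  (forall p, p \in l -> poly_in nvar p.1 p.2 /\ planar p.2 = 0) -> planar (prod_seq l) = 0.
Proof.
move=> l0 al h.
have [L lE] : exists L : seq (I * {poly K}), l = [seq (p.1, alg_poly nvar p.1 p.2) | p <- L].
  elim: l h {l0 al} => [|p l IH] h; first by exists [::].
  have [[f pf] _] := h p (mem_head _ _).
  have [q ql|L ->] := IH; first by apply: h; rewrite inE ql orbT.
  by exists ((p.1, f) :: L); rewrite /= -pf -surjective_pairing.
rewrite lE {l0} in al h l0 *; case: L {lE} al h l0 => // -[i f] L al h _.
have -> : prod_seq [seq (p.1, alg_poly nvar p.1 p.2) | p <- (i, f) :: L] =
    prod_alg nvar ((i, f) :: L) by rewrite /prod_seq big_map.
apply: freeness_of_cut; first by move: al; rewrite /alternates /alternating /= -map_comp.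
apply/allP => p pL; apply/eqP.
have pm : (p.1, alg_poly nvar p.1 p.2) \in [seq (p.1, alg_poly nvar p.1 p.2) | p <- (i, f) :: L].
  by apply/mapP; exists p.
by have [_ /= ->] := h _ pm.
Qed.

End planar_functional.

Section ncpoly_planar.
Variables (I : choiceType) (K : comNzRingType) (c : K).
Implicit Types (a b : ncpoly I K).

Definition planar a : K := ncpoly_lin (wval c) a.
Definition nvar (i : I) : ncpoly I K := word K [:: i].

Lemma planarP k a b : planar (k *: a + b) = k * planar a + planar b.
Proof. exact: ncpoly_linP. Qed.

Lemma planar_word (w : seq I) : planar (word K w) = wval c w.
Proof. exact: ncpoly_lin_word. Qed.

Lemma planar1 : planar 1 = 1.
Proof. by rewrite -word_nil planar_word. Qed.

Lemma ncpoly_free (l : seq (I * ncpoly I K)) : l != [::] -> alternates l ->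
  (forall p, p \in l -> poly_in nvar p.1 p.2 /\ planar p.2 = 0) -> planar (prod_seq l) = 0.
Proof.
(* The functional [cut] is the linear extension, in the middle argument, of the sum over the
   occurrences of the letter. *)
apply: (@planar_free I K (ncpoly I K) c (@word I K) (@wordM I K) (@word_nil I K)
  (@ncpoly_ind I K) planar (fun i a w b => ncpoly_lin (fun m => \sum_(p <- splits i m)
  planar (a * word K (rcons p.1 i)) * planar (word K p.2 * b)) w) planarP planar_word).
- by move=> *; exact: ncpoly_linP.
- by move=> *; exact: ncpoly_lin_word.
Qed.

End ncpoly_planar.

(* The scalars of [ncpoly I {poly C}] are restricted to the constants. *)
Definition ncalg (I : choiceType) (C : comNzRingType) : Type := ncpoly I {poly C}.

Section ncalg.
Variables (I : choiceType) (C : comNzRingType).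
HB.instance Definition _ := GRing.NzRing.on (ncalg I C).

Let scale (z : C) (a : ncalg I C) : ncalg I C := (z%:P : {poly C}) *: (a : ncpoly I {poly C}).

Let scaleA z w a : scale z (scale w a) = scale (z * w) a.
Proof. by rewrite /scale scalerA polyCM. Qed.

Let scale1 : left_id 1 scale.
Proof. by move=> a; rewrite /scale scale1r. Qed.

Let scaleDr : right_distributive scale +%R.
Proof. by move=> z a b; rewrite /scale scalerDr. Qed.

Let scaleDl a : {morph scale^~ a : z w / z + w}.
Proof. by move=> z w; rewrite /scale polyCD scalerDl. Qed.

HB.instance Definition _ := GRing.Zmodule_isLmodule.Build C (ncalg I C) scaleA scale1 scaleDr scaleDl.

Let scaleAl z (a b : ncalg I C) : z *: (a * b) = (z *: a) * b.
Proof. exact: (@scalerAl {poly C} (ncpoly I {poly C}) z%:P a b). Qed.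

HB.instance Definition _ := GRing.Lmodule_isLalgebra.Build C (ncalg I C) scaleAl.

Let scaleAr z (a b : ncalg I C) : z *: (a * b) = a * (z *: b).
Proof. exact: (@scalerAr {poly C} (ncpoly I {poly C}) z%:P a b). Qed.

HB.instance Definition _ := GRing.Lalgebra_isAlgebra.Build C (ncalg I C) scaleAr.

Lemma ncalg_scaleE z (a : ncalg I C) : z *: a = (z%:P : {poly C}) *: (a : ncpoly I {poly C}).
Proof. by []. Qed.

Variables (c c' : C).

Definition nc_state (a : ncalg I C) : C := (planar 'X a).[c].
(** Differentiation is linear over constants only; this is what restricting the scalars is for. *)
Definition nc_state' (a : ncalg I C) : C := c' * (planar 'X a)^`().[c].

Let nc_state_linear : linear_for *%R nc_state.
Proof.
by move=> z a b; rewrite ncalg_scaleE /nc_state planarP hornerD hornerM hornerC.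
Qed.

Let nc_state'_linear : linear_for *%R nc_state'.
Proof.
move=> z a b; rewrite ncalg_scaleE /nc_state' planarP derivD derivM derivC mul0r add0r.
by rewrite hornerD hornerM hornerC mulrDr mulrCA.
Qed.

HB.instance Definition _ := GRing.isLinear.Build C (ncalg I C) C *%R nc_state nc_state_linear.
HB.instance Definition _ := GRing.isLinear.Build C (ncalg I C) C *%R nc_state' nc_state'_linear.

Lemma nc_state1 : nc_state 1 = 1.
Proof. by rewrite /nc_state planar1 hornerC. Qed.

Lemma nc_state'1 : nc_state' 1 = 0.
Proof. by rewrite /nc_state' planar1 derivC horner0 mulr0. Qed.

Definition ncvar (i : I) : ncalg I C := nvar _ i.

Lemma ncvar_word n (w : 'I_n -> I) :
  \prod_(k < n) ncvar (w k) = word {poly C} [seq w k | k <- enum 'I_n] :> ncalg I C.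
Proof.
transitivity (\prod_(k <- enum 'I_n) ncvar (w k)); first by rewrite [index_enum _]unlock -enumT.
rewrite -(big_map w xpredT ncvar); elim: [seq w k | k <- _] => [|i l IH].
  by rewrite big_nil -word_nil.
by rewrite big_cons IH /ncvar /nvar; exact: (@wordM I {poly C}).
Qed.

(** The subalgebra over the constants is embedded in the polynomials with coefficients in
    [{poly C}], because recentring subtracts a scalar that is a polynomial in the parameter. *)
Lemma gen_subalg_poly_in i (a : ncalg I C) : gen_subalg (ncvar i) a ->
  poly_in (@nvar I {poly C}) i (a : ncpoly I {poly C}).
Proof.
move=> /(_ [set b : ncalg I C | poly_in (@nvar I {poly C}) i (b : ncpoly I {poly C})]); apply; split.
  split=> [|z u v|u v]; rewrite !inE.
  - exact: poly_in1.
  - by move=> pu pv; exact: poly_inP.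
  - by move=> pu pv; exact: poly_inM.
by move=> b /= ->; exact: poly_in_var.
Qed.

Lemma nc_infinitesimal_freeness n (j : nat -> I) (a : nat -> ncalg I C) : (0 < n)%N ->
  (forall k, (k < n)%N -> gen_subalg (ncvar (j k)) (a k)) ->
  (forall k, (k.+1 < n)%N -> j k <> j k.+1) ->
  (forall k, (k < n)%N -> nc_state (a k) = 0) ->
  [/\ nc_state (\prod_(k < n) a k) = 0,
      ~~ odd n -> nc_state' (\prod_(k < n) a k) = 0 &
      forall m, n = m.*2.+1 ->
        nc_state' (\prod_(k < n) a k) =
        (\prod_(k < m) nc_state (a k * a (m.*2 - k)%N)) * nc_state' (a m)].
Proof.
move=> n0 Ba jj a0.
pose dv (p : {poly C}) : C := c' * p^`().[c].
have dvD p q : dv (p + q) = dv p + dv q by rewrite /dv derivD hornerD mulrDr.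
have dvM p q : dv (p * q) = dv p * horner_eval c q + horner_eval c p * dv q.
  rewrite /dv derivM hornerD !hornerM /horner_eval mulrDr mulrA; congr (_ + _).
  exact: mulrCA.
have BM i x y := @poly_inM I _ _ (@nvar I {poly C}) i x y.
have BC i x k : poly_in (@nvar I {poly C}) i x -> poly_in (@nvar I {poly C}) i (x - k *: 1).
  by move=> px; rewrite addrC -scaleNr; apply: poly_inP => //; exact: poly_in1.
apply: (@infinitesimal_freeness {poly C} C (ncpoly I {poly C}) I (planar 'X)
  (poly_in (@nvar I {poly C})) (horner_eval c) dv (planarP _) (planar1 _ _) BM BC dvD dvM
  (@ncpoly_free I _ _) n j a) => //.
by move=> k kn; apply: gen_subalg_poly_in; exact: Ba.
Qed.
End ncalg.

Section wishart_space.
Variables (R : realType) (s : nat) (c c' : R).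

Lemma wpoly_real_complex (I : eqType) (w : seq I) :
  map_poly (real_complex R) (wpoly R w) = wpoly R[i] w.
Proof. by rewrite /wpoly wval_rmorph /= map_polyX. Qed.

Lemma horner_wpoly_real_complex (I : eqType) (w : seq I) :
  (wpoly R[i] w).[c%:C] = ((wpoly R w).[c])%:C.
Proof. by rewrite -wpoly_real_complex horner_map. Qed.

Lemma deriv_wpoly_real_complex (I : eqType) (w : seq I) :
  (wpoly R[i] w)^`().[c%:C] = ((wpoly R w)^`().[c])%:C.
Proof. by rewrite -wpoly_real_complex deriv_map horner_map. Qed.

Definition wishart_space : inf_prob_space R :=
  @InfProbSpace R (ncalg 'I_s R[i]) (nc_state c%:C) (nc_state' c%:C c'%:C)
    (nc_state1 _ _) (nc_state'1 _ _ _).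

Definition limit_var (i : 'I_s) : wishart_space := ncvar R[i] i.

Lemma limit_var_inf_free : inf_free_elements limit_var.
Proof.
move=> n j a n0 Ba jj a0.
exact: (@nc_infinitesimal_freeness 'I_s R[i] c%:C c'%:C n j a n0 Ba jj a0).
Qed.

Lemma wishart_space_word n (w : 'I_n -> 'I_s) (p := wpoly R [seq w k | k <- enum 'I_n]) :
  ips_phi wishart_space (\prod_(k < n) limit_var (w k)) = (p.[c])%:C /\
  ips_phi' wishart_space (\prod_(k < n) limit_var (w k)) = (c' * p^`().[c])%:C.
Proof.
have e := @ncvar_word 'I_s R[i] n w.
split.
  rewrite /= /nc_state /limit_var e planar_word.
  exact: horner_wpoly_real_complex.
rewrite /= /nc_state' /limit_var e planar_word.
rewrite -/(wpoly R[i] _) deriv_wpoly_real_complex.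
by rewrite -[RHS]/((real_complex R) _) rmorphM.
Qed.

End wishart_space.

(** * Asymptotic infinitesimal freeness and the limit moments *)

Section limits.
Context (R : realType) (s : nat) (d : nat -> measure_display).
Context (T : forall N, measurableType (d N)) (P : forall N, probability (T N) R).
Variables (M : nat -> nat) (X : forall N, 'I_s -> T N -> 'M[R[i]]_N) (c c' : R).
Hypothesis hW : forall N (i : 'I_s), complex_wishart (P N) (M N) (@X N i).
Hypothesis hX : forall N,
  mutually_independent (P N) (fun i : 'I_s => events_of_mx (@X N i)).
Hypothesis hM : (M N)%:R / N%:R @[N --> \oo] --> c.
Hypothesis hM' : (M N)%:R - N%:R * c @[N --> \oo] --> c'.

Lemma wishart_inf_free : asymptotically_inf_free P X.
Proof.
exists (wishart_space s c c'), (@limit_var R s c c'); split.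
  exact: limit_var_inf_free.
move=> n w n0 l l'; rewrite /l /l'.
have [-> ->] := wishart_space_word c c' w.
exact: (word_moment_cvg hW hX hM hM' w).
Qed.

Variables (S : inf_prob_space R) (x : 'I_s -> S).
Hypothesis xlim : inf_limit P X x.

(** Uniqueness of limits determines the moments in any limit space. Order 0 is treated apart, as
    [inf_limit] concerns nonempty words; it follows from the values of the two functionals at 1. *)
Lemma inf_limit_moment i n (p := wpoly R (nseq n tt)) :
  ips_phi S (x i ^+ n) = (p.[c])%:C /\ ips_phi' S (x i ^+ n) = (c' * p^`().[c])%:C.
Proof.
have [n0|n0] := posnP n.
  rewrite /p n0 expr0 ips_phi1 ips_phi'1 deriv_wpoly_nseq0 mulr0.
  by rewrite horner_wpoly_nseq mom0.
have [c1 c2] := xlim (fun=> i) n0.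
have [d1 d2] := word_moment_cvg hW hX hM hM' (fun _ : 'I_n => i).
have e : \prod_(k < n) x i = x i ^+ n by rewrite prodr_const card_ord.
have pE : wpoly R [seq i | k <- enum 'I_n] = p.
  rewrite /p -[RHS](@wval_map _ 'I_s _ 'X (fun=> i)).
    rewrite map_nseq -[in RHS](size_enum_ord n); congr (wval 'X _).
    by elim: (enum 'I_n) => //= k l ->.
  by move=> [] [].
have H : hausdorff_space R[i]^o by exact: norm_hausdorff.
have l1 : ips_phi S (\prod_(k < n) x i) = (p.[c])%:C.
  by rewrite -pE; exact: (cvg_unique H c1 d1).
split; first by rewrite -e.
rewrite -e; apply: (cvg_unique H c2); rewrite l1 -pE.
exact: d2.
Qed.

Lemma inf_limit_cumulants i : inf_free_cumulants (fun n => ips_phi S (x i ^+ n))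
  (fun n => ips_phi' S (x i ^+ n)) (fun=> c%:C) (fun=> c'%:C).
Proof.
move=> n n0; have [-> ->] := inf_limit_moment i n; split.
  by rewrite sum_NC_cst horner_wpoly_real_complex.
rewrite sum_NC_deriv deriv_wpoly_real_complex.
by rewrite -[LHS]/((real_complex R) _) rmorphM.
Qed.

End limits.

(** * The limit distributions *)

Section circle_integrals.
Context (R : realType).
Local Notation mu := (@lebesgue_measure R).
Implicit Types (f g F : R -> R) (r s t : R).

Definition circ f : R := \int[mu]_(t in `[0, pi]) f t.

Let circ_integrable f : continuous f -> mu.-integrable `[0, pi]%classic (EFin \o f).
Proof.
move=> cf; apply: continuous_compact_integrable; first exact: segment_compact.
exact: continuous_subspaceT.
Qed.

Lemma circP r f g : continuous f -> continuous g ->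
  circ (fun t => r * f t + g t) = r * circ f + circ g.
Proof.
move=> cf cg; have crf : continuous (fun t => r * f t).
  by move=> t; apply: cvgM; [exact: cvg_cst|exact: cf].
rewrite /circ RintegralD//=; [|exact: circ_integrable|exact: circ_integrable].
by rewrite RintegralZl//; exact: circ_integrable.
Qed.

Lemma circZ r f : continuous f -> circ (fun t => r * f t) = r * circ f.
Proof. by move=> cf; rewrite /circ RintegralZl//; exact: circ_integrable. Qed.

Lemma circ_FTC f F : continuous f -> (forall t, is_derive t 1 F (f t)) ->
  circ f = F pi - F 0.
Proof.
move=> cf dF; rewrite /circ /Rintegral (@continuous_FTC2 _ f F) //.
- exact: pi_gt0.
- exact: continuous_subspaceT.
- split.
  + by move=> t _; exact: ex_derive.
  + by apply: cvg_at_right_filter; apply: differentiable_continuous; exact/derivable1_diffP.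
  + by apply: cvg_at_left_filter; apply: differentiable_continuous; exact/derivable1_diffP.
- by move=> t _; rewrite derive1E; exact: derive_val.
Qed.

Lemma sin_pi_natmul n : sin (n%:R * pi) = 0 :> R.
Proof.
elim: n => [|n IH]; first by rewrite mul0r sin0.
by rewrite -natr1 mulrDl mul1r sinDpi IH oppr0.
Qed.

Let is_derive_scale r t : is_derive t 1 (fun u => r * u) r.
Proof.
have := is_deriveM (is_derive_cst r t 1) (is_derive_id t (1 : R)).
by move/is_derive_eq; apply; rewrite scaler0 addr0 /cst /GRing.scale /= mulr1.
Qed.

Lemma continuous_cos_scale r : continuous (fun t => cos (r * t)).
Proof.
move=> t; apply: continuous_comp; last exact: continuous_cos.
by apply: cvgM; [exact: cvg_cst|exact: cvg_id].
Qed.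

Lemma circ_cos n : circ (fun t => cos (n%:R * t)) = (n == 0%N)%:R * pi.
Proof.
case: n => [|n].
  have d0 t : is_derive t 1 id (cos (0%:R * t) : R).
    by rewrite mul0r cos0; exact: is_derive_id.
  by rewrite (circ_FTC (@continuous_cos_scale 0%:R) d0) subr0 mul1r.
have dn t : is_derive t 1 (fun t => n.+1%:R^-1 * sin (n.+1%:R * t)) (cos (n.+1%:R * t)).
  have := @is_derive1_comp _ (@sin R) (fun u => n.+1%:R * u) t _ _
    (is_derive_sin _) (is_derive_scale _ _).
  move=> /(is_deriveM (is_derive_cst (n.+1%:R^-1 : R) t 1))/is_derive_eq; apply.
  by rewrite scaler0 addr0 /cst /GRing.scale /= mulrCA mulVf ?mulr1//.
rewrite (circ_FTC (@continuous_cos_scale n.+1%:R) dn).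
by rewrite sin_pi_natmul !mulr0 sin0 !mulr0 subrr mul0r.
Qed.

(* |1 + s e^(it)|^2 *)
Definition mpx s t : R := 1 + s ^+ 2 + 2 * s * cos t.

Lemma continuous_mpx s : continuous (mpx s).
Proof.
move=> t; apply: cvgD; first exact: cvg_cst.
by apply: cvgM; [exact: cvg_cst|exact: continuous_cos].
Qed.

Lemma continuous_mpx_exp s n : continuous (fun t => mpx s t ^+ n).
Proof.
move=> t; apply: (@continuous_comp _ _ _ (mpx s) (fun y => y ^+ n)).
  exact: continuous_mpx.
exact: exprn_continuous.
Qed.

Let P s := mpoly_mp (s ^+ 2).

Let coefP1 s (F : {poly R}) : (P s * F)`_1 = s ^+ 2 * F`_1 + (1 + s ^+ 2) * F`_0.
Proof.
have -> : P s * F = s ^+ 2 *: F + (1 + s ^+ 2) *: (F * 'X) + F * 'X * 'X.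
  by rewrite /P /mpoly_mp -!mul_polyC polyCD; ring.
by rewrite !coefD !coefZ !coefMX addr0.
Qed.

Let natR n : n.+1%:R != 0 :> R. Proof. by rewrite pnatr_eq0. Qed.

(** With [z = s e^(it)] one has [mpx s t = P(z) / z], so the Fourier coefficients of its powers are
    coefficients of powers of [P]. The induction on [n] uses the product formula for cosines. *)
Lemma circ_mpx_cos s n j :
  circ (fun t => mpx s t ^+ n * cos (j%:R * t)) = pi * (s ^+ j * (P s ^+ n)`_(n + j)).
Proof.
have cc m k : continuous (fun t => mpx s t ^+ m * cos (k%:R * t)).
  by move=> t; apply: cvgM; [exact: continuous_mpx_exp|exact: continuous_cos_scale].
elim: n j => [|n IH] j.
  under [X in circ X]funext do rewrite expr0 mul1r.
  rewrite circ_cos expr0 add0n coef1; case: j => [|j]; last by rewrite !(mul0r, mulr0).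
  by rewrite mul1r expr0 mul1r mulr1.
case: j => [|j].
  have -> : (fun t => mpx s t ^+ n.+1 * cos (0%:R * t)) = (fun t =>
      (1 + s ^+ 2) * (mpx s t ^+ n * cos (0%:R * t)) +
      (2 * s) * (mpx s t ^+ n * cos (1%:R * t))).
    by apply/funext => t; rewrite exprS mul0r mul1r cos0 /mpx; ring.
  rewrite circP; [|exact: cc|].
    rewrite circZ; last exact: cc.
    rewrite !IH !addn0 expr0 expr1 !mul1r [P s ^+ n.+1]exprS.
    case: n {IH} => [|n].
      by rewrite expr0 coefP1 !coef1 /=; ring.
    (* At [j = 0] both neighbouring frequencies are [cos t]; the symmetry of the coefficients
       accounts for the lower one. *)
    have := coef_mp_shift (s ^+ 2) natR n.+1.
    rewrite mulrBr coefB coefMXn coefMC /= => /eqP; rewrite subr_eq0 => /eqP sh.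
    by rewrite coef_mp_mul addn1; move: sh; rewrite !subn2 /= => ->; ring.
  by move=> t; apply: cvgM; [exact: cvg_cst|exact: cc].
have -> : (fun t => mpx s t ^+ n.+1 * cos (j.+1%:R * t)) = (fun t =>
    (1 + s ^+ 2) * (mpx s t ^+ n * cos (j.+1%:R * t)) +
    (s * (mpx s t ^+ n * cos (j.+2%:R * t)) + s * (mpx s t ^+ n * cos (j%:R * t)))).
  apply/funext => t; have -> : j.+2%:R * t = j.+1%:R * t + t by rewrite -natr1; ring.
  have -> : j%:R * t = j.+1%:R * t - t by rewrite -natr1; ring.
  by rewrite cosD cosB exprS /mpx; ring.
have cs m : continuous (fun t => s * (mpx s t ^+ n * cos (m%:R * t))).
  by move=> t; apply: cvgM; [exact: cvg_cst|exact: cc].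
rewrite circP; [|exact: cc|by move=> t; apply: cvgD; exact: cs].
rewrite circP; [|exact: cc|exact: cs].
rewrite circZ; last exact: cc.
rewrite !IH [P s ^+ n.+1]exprS !addnS addSn coef_mp_mul !exprS.
by ring.
Qed.

Lemma circ_mpx s n : circ (fun t => mpx s t ^+ n) = pi * (P s ^+ n)`_n.
Proof.
have := circ_mpx_cos s n 0; rewrite addn0 expr0 mul1r => <-.
by congr circ; apply/funext => t; rewrite mul0r cos0 mulr1.
Qed.

(** Writing [sin^2 t] as [(1 - cos 2t) / 2] produces the same difference of two coefficients as the
    factor [X^2 - c] in [motz]. *)
Lemma circ_mpx_sin2 s n :
  circ (fun t => mpx s t ^+ n * sin t ^+ 2) = pi / 2 * motz (s ^+ 2) n 0.
Proof.
have -> : (fun t => mpx s t ^+ n * sin t ^+ 2) = (fun t =>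
    - 2^-1 * (mpx s t ^+ n * cos (2%:R * t)) + 2^-1 * mpx s t ^+ n).
  by apply/funext => t; rewrite mulr_natl cos_mulr2n sin2cos2 mulr2n; field.
have c1 : continuous (fun t => mpx s t ^+ n * cos (2%:R * t)).
  by move=> t; apply: cvgM; [exact: continuous_mpx_exp|exact: continuous_cos_scale].
have c2 : continuous (fun t => 2^-1 * mpx s t ^+ n).
  by move=> t; apply: cvgM; [exact: cvg_cst|exact: continuous_mpx_exp].
rewrite (circP (- 2^-1) c1 c2) circZ; last exact: continuous_mpx_exp.
rewrite circ_mpx_cos circ_mpx /motz mulrBr coefB coefMXn coefMC addn0 /=.
by rewrite subn2 /= addn2 /P; field.
Qed.

End circle_integrals.

Section circle_inverse.
Context (R : realType).
Implicit Types (r s t : R).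

Lemma mpx_gt0 s t : 0 <= s -> s != 1 -> 0 < mpx s t.
Proof.
move=> s0 s1; have h1 : 0 < (1 - s) ^+ 2.
  by rewrite lt_neqAle sqr_ge0 andbT eq_sym sqrf_eq0 subr_eq0 eq_sym.
have := cos_geN1 t; rewrite /mpx; nra.
Qed.

Lemma continuous_mpxV s : 0 <= s -> s != 1 -> continuous (fun t => (mpx s t)^-1).
Proof.
move=> s0 s1 t; apply: cvgV; first by rewrite gt_eqF// mpx_gt0.
exact: continuous_mpx.
Qed.

(* The argument of 1 + r e^(it) is an antiderivative of
   (1 - (1 - r^2) / |1 + r e^(it)|^2) / 2. *)
Let circ_mpxV_lt1 r : 0 <= r < 1 -> circ (fun t => (mpx r t)^-1) = pi / (1 - r ^+ 2).
Proof.
move=> /andP[r0 r1]; have r2 : 0 < 1 - r ^+ 2 by nra.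
pose F t := t + (- 2) * atan (r * sin t * (1 + r * cos t)^-1).
have rn1 : r != 1 by rewrite lt_eqF.
have cf := continuous_mpxV r0 rn1.
have dF t : is_derive t 1 F ((1 - r ^+ 2) * (mpx r t)^-1).
  have v0 : 0 < 1 + r * cos t by have := cos_geN1 t; nra.
  have vn0 : 1 + r * cos t != 0 by rewrite gt_eqF.
  have du : is_derive t 1 (fun t => r * sin t) (r * cos t).
    have := is_deriveM (is_derive_cst r t 1) (is_derive_sin t).
    by move/is_derive_eq; apply; rewrite scaler0 addr0.
  have dv : is_derive t 1 (fun t => 1 + r * cos t) (- (r * sin t)).
    have := is_deriveD (is_derive_cst (1 : R) t 1)
      (is_deriveM (is_derive_cst r t 1) (is_derive_cos t)).
    by move/is_derive_eq; apply; rewrite scaler0 addr0 add0r /GRing.scale /= mulrN.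
  have dq := is_deriveM du (@is_deriveV R (fun t => 1 + r * cos t) t _ 1 vn0 dv).
  have da := @is_derive1_comp _ (@atan R) (fun t => r * sin t * (1 + r * cos t)^-1) t _ _
    (is_derive1_atan _) dq.
  have := is_deriveD (is_derive_id t 1) (is_deriveM (is_derive_cst (- 2 : R) t 1) da).
  move/is_derive_eq; apply; rewrite scaler0 addr0 /cst /GRing.scale /=.
  have m0 := mpx_gt0 t r0 rn1; have := cos2Dsin2 t.
  move: m0 v0 vn0; rewrite /mpx; move: (cos t) (sin t) => C S m0 v0 vn0 cs.
  have S2 : S ^+ 2 = 1 - C ^+ 2 by rewrite -cs addrC addKr.
  have -> : (1 + (r * S * (1 + r * C)^-1) ^+ 2)^-1 =
      (1 + r * C) ^+ 2 * (1 + r ^+ 2 + 2 * r * C)^-1.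
    have -> : 1 + r ^+ 2 + 2 * r * C = (1 + r * C) ^+ 2 + (r * S) ^+ 2.
      by rewrite exprMn S2; ring.
    rewrite -[RHS]invrK; congr (_ ^-1); rewrite invfM invrK mulrDr mulVf ?expf_neq0//.
    by rewrite exprMn exprVn mulrC.
  have -> : r * S * (- (1 + r * C) ^- 2 * - (r * S)) + (1 + r * C)^-1 * (r * C) =
      (r * C + r ^+ 2) * (1 + r * C) ^- 2.
    have -> : r * C + r ^+ 2 = r * C * (1 + r * C) + r ^+ 2 * S ^+ 2 by rewrite S2; ring.
    by field.
  by field; rewrite vn0 gt_eqF.
have cf' : continuous (fun t => (1 - r ^+ 2) * (mpx r t)^-1).
  by move=> t; apply: cvgM; [exact: cvg_cst|exact: cf].
have := circ_FTC cf' dF; rewrite circZ// /F sinpi sin0 !mulr0 !mul0r atan0 mulr0 !addr0 subr0.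
by move=> <-; rewrite mulrAC mulfV ?mul1r// gt_eqF.
Qed.

Lemma circ_mpxV s : 0 < s -> s != 1 -> circ (fun t => (mpx s t)^-1) = pi / `|1 - s ^+ 2|.
Proof.
move=> s0 sn1; have [s1|s1|s1] := ltgtP s 1; last by rewrite s1 eqxx in sn1.
  by rewrite circ_mpxV_lt1 ?ltW//= ger0_norm//; nra.
(* For [s > 1], the factor [s ^+ 2] is taken out of [mpx s t], which reduces to the radius
   [1 / s]. *)
have sV : 0 <= s^-1 < 1 by rewrite invr_ge0 ltW//= invf_lt1.
have -> : (fun t => (mpx s t)^-1) = (fun t => s ^- 2 * (mpx s^-1 t)^-1).
  apply/funext => t; rewrite -invfM; congr (_ ^-1); rewrite /mpx; field.
  by rewrite gt_eqF.
have sVn1 : s^-1 != 1 by rewrite lt_eqF//; case/andP: sV.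
rewrite circZ; last by apply: continuous_mpxV => //; case/andP: sV.
rewrite circ_mpxV_lt1// ler0_norm; last by nra.
have s2 : 1 < s ^+ 2 by rewrite expr_gt1// ltW.
field; apply/and3P; split; last by rewrite subr_eq0 gt_eqF.
  by rewrite subr_eq0 lt_eqF.
by rewrite gt_eqF.
Qed.

End circle_inverse.

Section substitution.
Context (R : realType) (s : R).
Hypothesis s0 : 0 < s.
Local Notation mu := (@lebesgue_measure R).
Local Notation F := (mpx s).
Local Notation el := ((1 - s) ^+ 2).
Local Notation er := ((1 + s) ^+ 2).

Implicit Types (t x y : R).

Lemma is_derive_mpx t : is_derive t 1 F (- (2 * s * sin t)).
Proof.
have := is_deriveD (is_derive_cst (1 + s ^+ 2 : R) t 1)
  (is_deriveM (is_derive_cst (2 * s : R) t 1) (is_derive_cos t)).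
by move/is_derive_eq; apply; rewrite scaler0 addr0 add0r /GRing.scale /= mulrN.
Qed.

Lemma derive1_mpx : derive1 F = fun t => - (2 * s * sin t).
Proof. by apply/funext => t; rewrite derive1E; apply: derive_val; exact: is_derive_mpx. Qed.

Lemma mpx_decr : {in `[0, pi] &, {homo F : x y /~ x < y}}.
Proof.
move=> x y x0 y0 yx; have : cos x < cos y by rewrite ltr_cos.
by rewrite /mpx ltrD2l ltr_pM2l// mulr_gt0.
Qed.

Lemma mpx_pi : F pi = el.
Proof. by rewrite /mpx cospi; ring. Qed.

Lemma mpx0 : F 0 = er.
Proof. by rewrite /mpx cos0; ring. Qed.

Lemma mpx_itv t : t \in `]0, pi[ -> F t \in `]el, er[.
Proof.
move=> t0; have tc : t \in `[0, pi] by exact: subset_itv_oo_cc t0.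
move: t0; rewrite !in_itv /= => /andP[t0 tpi]; rewrite -mpx_pi -mpx0.
by rewrite !mpx_decr// in_itv/= ?lexx ?pi_ge0.
Qed.

Lemma mpx_surj x : x \in `]el, er[ -> exists2 t, t \in `]0, pi[ & F t = x.
Proof.
rewrite in_itv/= => /andP[xl xr]; pose y := (x - (1 + s ^+ 2)) / (2 * s).
have s2 : 0 < 2 * s by rewrite mulr_gt0.
have y1 : -1 < y by rewrite ltr_pdivlMr//; nra.
have y2 : y < 1 by rewrite ltr_pdivrMr//; nra.
exists (acos y).
  by rewrite in_itv/= acos_gt0 ?acos_ltpi ?y1 ?y2 ?ltW.
rewrite /mpx acosK; last by rewrite in_itv/= !ltW.
by rewrite /y mulrC divfK ?gt_eqF// addrC subrK.
Qed.

Let eps (k : nat) : R := pi / 2 / k.+1%:R.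

Let eps_gt0 k : 0 < eps k.
Proof. by rewrite !divr_gt0// pi_gt0. Qed.

Let eps_le k l : (k <= l)%N -> eps l <= eps k.
Proof.
move=> kl; rewrite ler_wpM2l ?divr_ge0 ?pi_ge0//.
by rewrite lef_pV2 ?posrE// ler_nat.
Qed.

Let eps_pi k : eps k <= pi - eps k.
Proof.
have := eps_le (leq0n k); rewrite {2}/eps divr1; lra.
Qed.

Let eps_in k : eps k \in `[0, pi].
Proof. by rewrite in_itv/= ltW//=; have := eps_pi k; have := eps_gt0 k; lra. Qed.

Let eps'_in k : pi - eps k \in `[0, pi].
Proof. by rewrite in_itv/=; have := eps_pi k; have := eps_gt0 k; lra. Qed.

Let bigcup_eps : \bigcup_k `[eps k, pi - eps k]%classic = `]0, pi[%classic.
Proof.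
apply/seteqP; split=> t.
  move=> [k _] /=; rewrite !in_itv/= => /andP[h1 h2].
  by have := eps_gt0 k; move: h1 h2; lra.
rewrite /= in_itv/= => /andP[t0 tpi].
have m0 : 0 < Num.min t (pi - t) by rewrite lt_min t0 subr_gt0.
have [k kP] : exists k, eps k <= Num.min t (pi - t).
  exists (Num.bound (pi / 2 / Num.min t (pi - t))).
  rewrite ler_pdivrMr// -ler_pdivrMl// mulrC.
  apply: (@le_trans _ _ (Num.bound (pi / 2 / Num.min t (pi - t)))%:R); last by rewrite ler_nat.
  by rewrite ltW// archi_boundP// !divr_ge0 ?pi_ge0// ltW.
exists k => //=; rewrite in_itv/=; move: kP; rewrite le_min; lra.
Qed.

Let bigcup_mpx_eps : \bigcup_k `[F (pi - eps k), F (eps k)]%classic = `]el, er[%classic.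
Proof.
have dec := mpx_decr.
have mono x y : x \in `[0, pi] -> y \in `[0, pi] -> y <= x -> F x <= F y.
  by move=> x0 y0; rewrite le_eqVlt => /orP[/eqP -> //|yx]; rewrite ltW// dec.
apply/seteqP; split=> x.
  move=> [k _] /=; rewrite !in_itv/= -mpx_pi -mpx0 => /andP[h1 h2].
  rewrite (lt_le_trans _ h1) ?(le_lt_trans h2)//; apply: dec => //.
  - by rewrite in_itv/= lexx pi_ge0.
  - by rewrite in_itv/= lexx pi_ge0.
  - by rewrite ltrBlDr ltrDl.
move=> /= /mpx_surj[t t0 <-].
have : (`]0, pi[%classic : set R) t by [].
rewrite -bigcup_eps => -[k _]; rewrite /= in_itv/= => /andP[h1 h2].
exists k => //=; rewrite in_itv/=.
have tc : t \in `[0, pi] by exact: subset_itv_oo_cc t0.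
by rewrite !mono.
Qed.

(** [G] may be singular at both ends, so the substitution is made on the compact intervals from
    [eps k] to [pi - eps k], which exhaust the open arc, and monotone convergence concludes. *)
Lemma mpx_substitution (G : R -> R) : {in `]el, er[, continuous G} ->
  (forall x, x \in `]el, er[ -> 0 <= G x) ->
  (\int[mu]_(x in `]el, er[) (G x)%:E =
   \int[mu]_(t in `]0%R, pi[) (G (F t) * (2 * s * sin t))%:E)%E.
Proof.
move=> cG G0.
have mB k : (`[F (pi - eps k), F (eps k)] `<=` `]el, er[)%classic.
  by rewrite -bigcup_mpx_eps => x hx; exists k.
have mA k : (`[eps k, pi - eps k] `<=` `]0, pi[)%classic.
  by rewrite -bigcup_eps => x hx; exists k.
have mG : measurable_fun `]el, er[%classic G.
  apply: open_continuous_measurable_fun; first exact: interval_open.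
  by move=> x; rewrite inE /= => hx; exact: cG.
have mGF : measurable_fun `]0, pi[%classic (fun t => G (F t) * (2 * s * sin t)).
  apply: open_continuous_measurable_fun; first exact: interval_open.
  move=> t; rewrite inE /= => ht; apply: cvgM.
    apply: continuous_comp; first exact: continuous_mpx.
    by apply: cG; exact: mpx_itv.
  by apply: cvgM; [exact: cvg_cst|exact: continuous_sin].
have nA : nondecreasing_seq (fun k => `[eps k, pi - eps k]%classic).
  move=> k l kl; apply/subsetPset => t /=; rewrite !in_itv/=.
  by have := eps_le kl; lra.
have mono x y : x \in `[0, pi] -> y \in `[0, pi] -> y <= x -> F x <= F y.
  by move=> x0 y0; rewrite le_eqVlt => /orP[/eqP -> //|yx]; rewrite ltW// mpx_decr.
have nB : nondecreasing_seq (fun k => `[F (pi - eps k), F (eps k)]%classic).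
  move=> k l kl; apply/subsetPset => t /=; rewrite !in_itv/= => /andP[h1 h2].
  rewrite (le_trans _ h1) ?(le_trans h2)//; apply: mono => //.
    exact: eps_le.
  by rewrite lerD2l lerN2 eps_le.
have c1 : (\int[mu]_(x in `[F (pi - eps k)%R, F (eps k)]) (G x)%:E)%E @[k --> \oo] -->
    (\int[mu]_(x in `]el, er[) (G x)%:E)%E.
  rewrite -bigcup_mpx_eps; apply: ge0_nondecreasing_set_cvg_integral => //.
  - by move=> k; apply/measurable_EFinP; exact: measurable_funS (mB k) mG.
  - by move=> k x /mB /G0; rewrite /= lee_fin.
have c2 : (\int[mu]_(t in `[eps k, (pi - eps k)%R]) (G (F t) * (2 * s * sin t))%:E)%E
    @[k --> \oo] --> (\int[mu]_(t in `]0%R, pi[) (G (F t) * (2 * s * sin t))%:E)%E.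
  rewrite -bigcup_eps; apply: ge0_nondecreasing_set_cvg_integral => //.
  - by move=> k; apply/measurable_EFinP; exact: measurable_funS (mA k) mGF.
  - move=> k t tk; have ht : t \in `]0, pi[ := mA k t tk.
    rewrite lee_fin; apply: mulr_ge0; first by apply: G0; exact: mpx_itv.
    apply: mulr_ge0; first by rewrite mulr_ge0// ltW.
    by rewrite ltW// sin_gt0_pi//; rewrite in_itv in ht.
apply: (cvg_unique _ c1) => //.
suff -> : (fun k => \int[mu]_(x in `[F (pi - eps k)%R, F (eps k)]) (G x)%:E)%E =
    (fun k => \int[mu]_(t in `[eps k, (pi - eps k)%R]) (G (F t) * (2 * s * sin t))%:E)%E.
  exact: c2.
apply/funext => k.
rewrite /= integration_by_substitution_decreasing//.
- by apply: eq_integral => t _; rewrite derive1_mpx /= opprK.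
- move=> x y xk yk; apply: mpx_decr.
    exact: subset_itv_oo_cc (mA k x xk).
  exact: subset_itv_oo_cc (mA k y yk).
- rewrite derive1_mpx => t _; apply: cvgN.
  by apply: cvgM; [exact: cvg_cst|exact: continuous_sin].
- rewrite derive1_mpx; apply/cvg_ex; exists (- (2 * s * sin (eps k))).
  apply: cvg_at_right_filter; apply: cvgN.
  by apply: cvgM; [exact: cvg_cst|exact: continuous_sin].
- rewrite derive1_mpx; apply/cvg_ex; exists (- (2 * s * sin (pi - eps k))).
  apply: cvg_at_left_filter; apply: cvgN.
  by apply: cvgM; [exact: cvg_cst|exact: continuous_sin].
- split.
  + by move=> t _; apply: ex_derive; exact: is_derive_mpx.
  + by apply: cvg_at_right_filter; exact: continuous_mpx.
  + by apply: cvg_at_left_filter; exact: continuous_mpx.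
- apply: continuous_in_subspaceT => x; rewrite inE => hx; apply: cG.
  exact: mB hx.
Qed.

End substitution.

(** * Moments of measures, charges and densities *)

Section measure_combinations.
Context (d : measure_display) (T : measurableType d) (R : realType).
Implicit Types (m : {measure set T -> \bar R}) (f : T -> R).

Definition has_Rintegral m f (v : R) :=
  m.-integrable setT (EFin \o f) /\ \int[m]_x f x = v.

Lemma has_Rintegral_measure_add m1 m2 f v1 v2 :
  has_Rintegral m1 f v1 -> has_Rintegral m2 f v2 ->
  has_Rintegral (measure_add m1 m2) f (v1 + v2).
Proof.
move=> [i1 <-] [i2 <-]; have mf := measurable_int _ i1.
have mnf : measurable_fun setT (abse \o (EFin \o f)) by exact: measurableT_comp.
split.
  apply/integrableP; split => //; rewrite ge0_integral_measure_add//.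
  by have /integrableP[_ ?] := i1; have /integrableP[_ ?] := i2; exact: lte_add_pinfty.
rewrite /Rintegral integral_measure_add// fineD//; exact: integrable_fin_num.
Qed.

Lemma has_Rintegral_mscale (k : {nonneg R}) m f v :
  has_Rintegral m f v -> has_Rintegral (mscale k m) f (k%:num * v).
Proof.
move=> [i <-]; have mf := measurable_int _ i.
have mnf : measurable_fun setT (abse \o (EFin \o f)) by exact: measurableT_comp.
have ik : (mscale k m).-integrable setT (EFin \o f).
  apply/integrableP; split => //; rewrite ge0_integral_mscale//.
  by have /integrableP[_ h] := i; rewrite lte_mul_pinfty// ge0_fin_numE.
split=> //; rewrite /Rintegral integralE [in RHS]integralE !ge0_integral_mscale//; first last.
- exact: measurable_funepos.
- exact: measurable_funeneg.
rewrite -(fineK (integrable_pos_fin_num measurableT i)).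
rewrite -(fineK (integrable_neg_fin_num measurableT i)).
by rewrite -!EFinM -!EFinB /= mulrBr.
Qed.

Lemma has_Rintegral_dirac (a : T) f : measurable_fun setT f ->
  has_Rintegral (\d_a : {measure set T -> \bar R}) f (f a).
Proof.
move=> mf; have mEf : measurable_fun setT (EFin \o f) by exact/measurable_EFinP.
split; last by rewrite /Rintegral integral_dirac// diracT mul1e.
apply/integrableP; split => //; rewrite integral_dirac//; last exact: measurableT_comp.
by rewrite diracT mul1e ltry.
Qed.

Definition finite_meas m (mfin : fin_num_fun m) : set T -> \bar R := m.

Section finite_meas.
Variables (m : {measure set T -> \bar R}) (mfin : fin_num_fun m).
HB.instance Definition _ := Measure.on (finite_meas mfin).
HB.instance Definition _ := Measure_isFinite.Build _ _ _ (finite_meas mfin) mfin.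
End finite_meas.

Definition prob_meas m (m1 : m setT = 1%E) : set T -> \bar R := m.

Section prob_meas.
Variables (m : {measure set T -> \bar R}) (m1 : m setT = 1%E).
HB.instance Definition _ := Measure.on (prob_meas m1).
HB.instance Definition _ := Measure_isProbability.Build _ _ _ (prob_meas m1) m1.
End prob_meas.

Lemma charge_of_difference (m1 m2 : {finite_measure set T -> \bar R}) :
  exists nu : {charge set T -> \bar R}, forall A, measurable A -> nu A = (m1 A - m2 A)%E.
Proof.
exists (cadd (charge_of_finite_measure m1) (copp (charge_of_finite_measure m2))).
by [].
Qed.

(** [m1 - m2] need not be the Jordan decomposition. The Jordan parts are dominated by [m1] and [m2],
    which gives integrability, and the equality of [jordan_pos + m2] with [jordan_neg + m1] compares
    the integrals. *)
Lemma jordan_has_Rintegral (nu : {charge set T -> \bar R})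
    (m1 m2 : {finite_measure set T -> \bar R}) f v1 v2 :
  (forall A, measurable A -> nu A = (m1 A - m2 A)%E) ->
  has_Rintegral m1 f v1 -> has_Rintegral m2 f v2 ->
  exists (D N : set T) (nuDN : hahn_decomposition nu D N),
  [/\ (jordan_pos nuDN).-integrable setT (EFin \o f),
      (jordan_neg nuDN).-integrable setT (EFin \o f) &
      v1 - v2 = \int[jordan_pos nuDN]_t f t - \int[jordan_neg nuDN]_t f t].
Proof.
move=> nuE f1 f2; have [D [N nuDN]] := Hahn_decomposition nu.
exists D, N, nuDN.
have [[mD _] [mN _] _ _] := nuDN.
have leI (m : {measure set T -> \bar R}) A B : measurable A -> measurable B ->
    (m (A `&` B) <= m A)%E.
  by move=> mA mB; apply: le_measure; rewrite ?inE//; exact: measurableI.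
have pos1 A : measurable A -> (jordan_pos nuDN A <= m1 A)%E.
  move=> mA; rewrite jordan_posE cjordan_posE /crestr0 mem_set// /crestr nuE; last exact: measurableI.
  by apply: le_trans (leI m1 _ _ mA mD); rewrite leeBlDr ?fin_num_measure ?leeDl//; exact: measurableI.
have neg2 A : measurable A -> (jordan_neg nuDN A <= m2 A)%E.
  move=> mA; rewrite jordan_negE cjordan_negE /crestr0 mem_set// /crestr nuE; last exact: measurableI.
  rewrite fin_num_oppeB; last by rewrite fin_num_measure//; exact: measurableI.
  apply: le_trans (leI m2 _ _ mA mN); rewrite addeC leeBlDr ?fin_num_measure ?leeDl//; exact: measurableI.
have mf := measurable_int _ f1.1.
have mnf : measurable_fun setT (abse \o (EFin \o f)) by exact: measurableT_comp.
have ipos : (jordan_pos nuDN).-integrable setT (EFin \o f).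
  apply/integrableP; split => //; have /integrableP[_] := f1.1.
  by apply: le_lt_trans; apply: ge0_le_measure_integral.
have ineg : (jordan_neg nuDN).-integrable setT (EFin \o f).
  apply/integrableP; split => //; have /integrableP[_] := f2.1.
  by apply: le_lt_trans; apply: ge0_le_measure_integral.
split => //.
have [_ e1] := has_Rintegral_measure_add (conj ipos erefl) f2.
have [_ e2] := has_Rintegral_measure_add (conj ineg erefl) f1.
suff e : \int[measure_add (jordan_pos nuDN) m2]_x f x = \int[measure_add (jordan_neg nuDN) m1]_x f x.
  by move: e; rewrite e1 e2; lra.
congr fine; apply: eq_measure_integral => A mA _.
rewrite -[LHS]/(measure_add (jordan_pos nuDN) m2 A) -[RHS]/(measure_add (jordan_neg nuDN) m1 A).
rewrite !measure_addE.
have aux (a b p q : \bar R) : a \is a fin_num -> b \is a fin_num -> p \is a fin_num ->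
    q \is a fin_num -> (a - b = p - q -> p + b = q + a)%E.
  move: a b p q => [a||] [b||] [p||] [q||] // _ _ _ _ [] h.
  by rewrite -!EFinD; apply: f_equal; lra.
apply: aux; rewrite ?fin_num_measure//.
by rewrite -nuE// (jordan_decomp nuDN)// /cadd /= cscaleN1.
Qed.

End measure_combinations.

Section density_measure.
Context (R : realType).
Local Notation mu := (@lebesgue_measure R).

Definition density_meas (h : R -> R) (mh : measurable_fun setT h) (h0 : forall x, 0 <= h x)
  (A : set (measurableTypeR R)) : \bar R := (\int[mu]_(x in A) (h x)%:E)%E.

Section density_meas.
Variables (h : R -> R) (mh : measurable_fun setT h) (h0 : forall x, 0 <= h x).
Local Notation m := (density_meas mh h0).

Let m0 : m set0 = 0%E. Proof. by rewrite /density_meas integral_set0. Qed.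

Let m_ge0 A : (0 <= m A)%E.
Proof. by apply: integral_ge0 => x _; rewrite lee_fin. Qed.

Let m_sigma_additive : semi_sigma_additive m.
Proof.
move=> /= A mA tA mUA; rewrite /density_meas ge0_integral_bigcup//.
- apply: is_cvg_ereal_nneg_natsum_cond => n _ _.
  by apply: integral_ge0 => x _; rewrite lee_fin.
- by apply: measurable_funTS; exact/measurable_EFinP.
- by move=> x _; rewrite lee_fin.
Qed.

HB.instance Definition _ := isMeasure.Build _ _ _ m m0 m_ge0 m_sigma_additive.
End density_meas.

Variables (s : R) (h w : R -> R).
Hypothesis s0 : 0 < s.
Local Notation el := ((1 - s) ^+ 2).
Local Notation er := ((1 + s) ^+ 2).
Hypothesis ch : {in `]el, er[, continuous h}.
Hypothesis h0 : forall x, x \in `]el, er[ -> 0 <= h x.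
Hypothesis hel : h el = 0.
Hypothesis her : h er = 0.
Hypothesis hw : forall t, t \in `]0, pi[ -> h (mpx s t) * (2 * s * sin t) = w t.
Hypothesis cw : continuous w.

Let hh : R -> R := h \_ `]el, er[.

Let hhE x : hh x = if x \in `]el, er[ then h x else 0.
Proof. by rewrite /hh patchE mem_setE. Qed.

Let hh0 x : 0 <= hh x.
Proof. by rewrite hhE; case: ifP => // /h0. Qed.

Let mhh : measurable_fun setT hh.
Proof.
apply/(measurable_restrictT _ _).1 => //.
apply: open_continuous_measurable_fun; first exact: interval_open.
by move=> x; rewrite inE /= => hx; exact: ch.
Qed.

Let moment n : (\int[mu]_x (x ^+ n * hh x)%:E)%E = (circ (fun t => mpx s t ^+ n * w t))%:E.
Proof.
have cF : continuous (fun t => mpx s t ^+ n * w t).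
  by move=> t; apply: cvgM; [exact: continuous_mpx_exp|exact: cw].
transitivity (\int[mu]_(x in `]el, er[) (x ^+ n * h x)%:E)%E.
  rewrite [RHS]integral_mkcond; apply: eq_integral => x _.
  by rewrite patchE hhE mem_setE; case: ifP => //; rewrite mulr0.
rewrite (mpx_substitution s0); first last.
- move=> x hx; rewrite mulr_ge0 ?h0// exprn_ge0//.
  by move: hx; rewrite in_itv/= => /andP[hx _]; rewrite (le_trans _ (ltW hx))// sqr_ge0.
- by move=> x hx; apply: cvgM; [exact: exprn_continuous|exact: ch].
transitivity (\int[mu]_(t in `]0%R, pi[) (mpx s t ^+ n * w t)%:E)%E.
  by apply: eq_integral => t; rewrite inE /= => ht; rewrite -hw// !mulrA.
have mF : measurable_fun (`]0, pi[%classic : set R) (EFin \o (fun t => mpx s t ^+ n * w t)).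
  by apply/measurable_EFinP; apply: measurable_funTS; exact: continuous_measurable_fun.
rewrite /circ /Rintegral -(@integral_itv_bndoo R 0 pi _ true false mF).
rewrite fineK// integrable_fin_num//.
apply: continuous_compact_integrable; first exact: segment_compact.
exact: continuous_subspaceT.
Qed.

Let integrable_moment n : mu.-integrable setT (EFin \o (fun x : R => x ^+ n * hh x)).
Proof.
have mm : measurable_fun setT (fun x : R => x ^+ n * hh x).
  by apply: measurable_funM => //; exact: exprn_measurable.
apply/integrableP; split; first exact/measurable_EFinP.
apply: (@le_lt_trans _ _ (\int[mu]_x (x ^+ n * hh x)%:E)%E); last by rewrite moment ltry.
rewrite le_eqVlt; apply/orP; left; apply/eqP; apply: eq_integral => x _ /=; congr EFin.
rewrite ger0_norm// hhE; case: ifP => hx; last by rewrite mulr0.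
rewrite mulr_ge0 ?h0// exprn_ge0//.
by move: hx; rewrite in_itv/= => /andP[hx _]; rewrite (le_trans _ (ltW hx))// sqr_ge0.
Qed.

(** [h] may be unbounded near the ends of the interval, but multiplied by the Jacobian it becomes
    [w], continuous on the whole closed arc, so all moments are finite circle integrals. The values
    0 at the end points make the open and the closed interval interchangeable. *)
Lemma density_measure : exists nu : {finite_measure set (measurableTypeR R) -> \bar R},
  [/\ forall A, measurable A -> nu A = (\int[mu]_(x in A `&` `[el, er]) (h x)%:E)%E,
      mu.-integrable `[el, er]%classic (EFin \o h) &
      forall n, has_Rintegral nu (fun x : R => x ^+ n) (circ (fun t => mpx s t ^+ n * w t))].
Proof.
have hi : mu.-integrable setT (EFin \o hh).
  have := integrable_moment 0; apply: eq_integrable => // x _ /=.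
  by rewrite expr0 mul1r.
have fin : fin_num_fun (density_meas mhh hh0).
  move=> A mA; apply: integrable_fin_num => //; exact: integrableS hi.
have hhc x : x \in `[el, er] -> hh x = h x.
  rewrite hhE !in_itv/=.
  have [xl|xl|<-] := ltgtP el x => //=.
  by have [xr|xr|->] := ltgtP x er => //; rewrite her.
have hhn x : x \notin `[el, er] -> hh x = 0.
  by rewrite hhE => hx; rewrite ifN//; apply: contra hx; exact: subset_itv_oo_cc.
exists (finite_meas fin); split.
- move=> A mA; rewrite integral_mkcondr; apply: eq_integral => x _.
  by rewrite patchE mem_setE; case: ifPn => [/hhc|/hhn] ->.
- have mI : measurable (`[el, er]%classic : set (measurableTypeR R)) by exact: measurable_itv.
  have := integrableS measurableT mI (@subsetT _ _) hi.
  by apply: eq_integrable => // x; rewrite inE /= => /hhc ->.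
have mX n : measurable_fun (setT : set (measurableTypeR R)) (fun x : R => x ^+ n).
  exact: exprn_measurable.
have nuE A : measurable A -> finite_meas fin A = (\int[mu]_(x in A) (hh x)%:E)%E by [].
move=> n; split.
  have := @integrable_density _ _ _ (finite_meas fin) mu hh hh0 hi nuE _ (mX n).
  by apply; exact: integrable_moment.
rewrite (@Rintegral_density _ _ _ (finite_meas fin) mu hh hh0 hi nuE _ (mX n)).
by rewrite /Rintegral moment.
Qed.

End density_measure.

(** * The Marchenko-Pastur law and its infinitesimal companion *)

Section marchenko_pastur_measures.
Context (R : realType) (c : R).
Hypothesis c0 : 0 < c.
Local Notation mu := (@lebesgue_measure R).
Local Notation s := (Num.sqrt c).
Local Notation F := (mpx s).
Local Notation el := (edge_l c).
Local Notation er := (edge_r c).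
Let root x : R := Num.sqrt ((er - x) * (x - el)).

Let s0 : 0 < s. Proof. by rewrite sqrtr_gt0. Qed.

Let s2 : s ^+ 2 = c. Proof. by rewrite sqr_sqrtr// ltW. Qed.

Let sn1 : c != 1 -> s != 1.
Proof. by apply: contra_neq => e; rewrite -s2 e expr1n. Qed.

Let root_el : root el = 0. Proof. by rewrite /root subrr mulr0 sqrtr0. Qed.

Let root_er : root er = 0. Proof. by rewrite /root subrr mul0r sqrtr0. Qed.

Let root_mpx t : t \in `]0, pi[ -> root (F t) = 2 * s * sin t.
Proof.
rewrite in_itv/= => t0; rewrite /root.
have -> : (er - F t) * (F t - el) = (2 * s * sin t) ^+ 2.
  by rewrite exprMn sin2cos2 /mpx /edge_l /edge_r; ring.
by rewrite sqrtr_sqr ger0_norm// !mulr_ge0 ?(ltW s0)// sin_ge0_pi//; case/andP: t0 => *; rewrite !ltW.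
Qed.

Let itv_gt0 x : x \in `]el, er[ -> 0 < x.
Proof.
by rewrite in_itv/= => /andP[h _]; apply: le_lt_trans h; exact: sqr_ge0.
Qed.

Let root_gt0 x : x \in `]el, er[ -> 0 < root x.
Proof.
by rewrite in_itv/= => /andP[h1 h2]; rewrite sqrtr_gt0 mulr_gt0 ?subr_gt0.
Qed.

Let continuous_root : continuous root.
Proof.
move=> x; apply: (@continuous_comp _ _ _ (fun x => (er - x) * (x - el)) Num.sqrt).
  by apply: cvgM; apply: cvgB; by [exact: cvg_cst|exact: cvg_id].
exact: sqrt_continuous.
Qed.

Let sin_mpx t : t \in `]0, pi[ -> 0 < sin t /\ 0 < F t.
Proof.
move=> t0; split; first by rewrite sin_gt0_pi//; rewrite in_itv in t0.
by apply: itv_gt0; exact: mpx_itv.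
Qed.

Let continuous_mpxV_coef (k : R) : (c = 1 -> k = 0) -> continuous (fun t => k * (F t)^-1).
Proof.
move=> k0; have [c1|c1] := eqVneq c 1.
  rewrite (k0 c1); have -> : (fun t => 0 * (F t)^-1) = cst 0.
    by apply/funext => t; rewrite mul0r.
  exact: cst_continuous.
move=> t; apply: cvgM; first exact: cvg_cst.
by apply: continuous_mpxV; [exact: ltW|exact: sn1].
Qed.

Let P := mpoly_mp c.

Let circ_mpx1 : circ F = pi * (1 + c).
Proof.
have := circ_mpx s 1; rewrite s2 expr1 => e.
have -> : F = (fun t => F t ^+ 1) by apply/funext => t; rewrite expr1.
rewrite e; congr (_ * _); rewrite /mpoly_mp mulrDl mul1r coefD coefXM coefD coefX coefC /=.
by rewrite coefD coefX coefC /= add0r addr0.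
Qed.

(** From order 1 on, the factor [x] cancels the denominator of the density and [circ_mpx_sin2] gives
    the moments. The value at order 0 is [min(1, c)], the mass left by the atom. *)
Lemma marchenko_pastur_ac : exists nu : {finite_measure set (measurableTypeR R) -> \bar R},
  (forall A, measurable A -> nu A = ac_part c (mp_density c) A) /\
  forall n, has_Rintegral nu (fun x : R => x ^+ n)
    (if n is n'.+1 then mom c n else (1 + c - `|1 - c|) / 2).
Proof.
(* This is [2 c sin^2 t / (pi F)], expanded by [4 c sin^2 t = - F^2 + 2 (1 + c) F - (1 - c)^2]. At
   [c = 1], where [F] vanishes at [pi], the coefficient of the inverse is 0 and [w] stays
   continuous. *)
pose w t := (2 * pi)^-1 * (- F t + (2 * (1 + c) + - (1 - c) ^+ 2 * (F t)^-1)).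
have p0 : pi != 0 :> R by rewrite gt_eqF// pi_gt0.
have cw1 : continuous (fun t => 2 * (1 + c) + - (1 - c) ^+ 2 * (F t)^-1).
  move=> t; apply: cvgD; first exact: cvg_cst.
  by apply: continuous_mpxV_coef => ->; rewrite subrr expr0n oppr0.
have cw2 : continuous (fun t => - F t + (2 * (1 + c) + - (1 - c) ^+ 2 * (F t)^-1)).
  move=> t; apply: cvgD; last exact: cw1.
  by apply: cvgN; exact: continuous_mpx.
have cw : continuous w by move=> t; apply: cvgM; [exact: cvg_cst|exact: cw2].
have sin2 t : 4 * c * sin t ^+ 2 = - F t ^+ 2 + 2 * (1 + c) * F t - (1 - c) ^+ 2.
  by rewrite sin2cos2 /mpx; move: s2; move: s => r <-; ring.
have [|||||nu [nuE _ num]] := @density_measure R s (mp_density c) w s0 _ _ _ _ _ cw.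
- move=> x hx; apply: cvgM; first exact: continuous_root.
  apply: cvgV; first by rewrite !mulf_neq0// gt_eqF// itv_gt0.
  by apply: cvgM; [exact: cvg_cst|exact: cvg_id].
- move=> x hx; rewrite divr_ge0 ?sqrtr_ge0// !mulr_ge0 ?pi_ge0//.
  exact: ltW (itv_gt0 hx).
- by rewrite /mp_density -/(root el) root_el mul0r.
- by rewrite /mp_density -/(root er) root_er mul0r.
- move=> t ht; have [st Ft] := sin_mpx ht.
  rewrite /mp_density -/(root (F t)) root_mpx// /w.
  have -> : (1 - c) ^+ 2 = - F t ^+ 2 + 2 * (1 + c) * F t - 4 * s ^+ 2 * sin t ^+ 2.
    by rewrite s2 sin2; ring.
  by move: (@pi R) p0 => q q0; field; rewrite q0 gt_eqF.
exists nu; split; first exact: nuE.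
move=> [|n].
  have := num 0%N; congr (has_Rintegral _ _ _).
  have -> : (fun t => F t ^+ 0 * w t) = w by apply/funext => t; rewrite expr0 mul1r.
  rewrite circZ//.
  have -> : (fun t => - F t + (2 * (1 + c) + - (1 - c) ^+ 2 * (F t)^-1)) =
     (fun t => -1 * F t + (2 * (1 + c) + - (1 - c) ^+ 2 * (F t)^-1)).
    by apply/funext => t; rewrite mulN1r.
  rewrite circP//; last exact: continuous_mpx.
  rewrite circ_mpx1.
  have -> : (fun t => 2 * (1 + c) + - (1 - c) ^+ 2 * (F t)^-1) =
     (fun t => 2 * (1 + c) * cos (0%:R * t) + - (1 - c) ^+ 2 * (F t)^-1).
    by apply/funext => t; rewrite mul0r cos0 mulr1.
  rewrite circP; [|exact: continuous_cos_scale|].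
    rewrite circ_cos mul1r.
    have [c1|c1] := eqVneq c 1.
      have -> : (fun t => - (1 - c) ^+ 2 * (F t)^-1) = (fun t => 0 * cos (0%:R * t)).
        by apply/funext => t; rewrite c1 subrr expr0n oppr0 !mul0r.
      rewrite circZ; last exact: continuous_cos_scale.
      by rewrite c1 subrr normr0; move: (@pi R) p0 => q q0; field.
    rewrite circZ; last by apply: continuous_mpxV; [exact: ltW|exact: sn1].
    rewrite circ_mpxV ?sn1// s2 -[(1 - c) ^+ 2]real_normK ?num_real//.
    by move: (@pi R) p0 => q q0; field; rewrite q0 normr_eq0 subr_eq0 eq_sym c1.
  by apply: continuous_mpxV_coef => ->; rewrite subrr expr0n oppr0.
have := num n.+1; congr (has_Rintegral _ _ _).
have -> : (fun t => F t ^+ n.+1 * w t) = (fun t => 2 * c / pi * (F t ^+ n * sin t ^+ 2)).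
  apply/funext => t; rewrite /w exprSr.
  have -> : sin t ^+ 2 = (- F t ^+ 2 + 2 * (1 + c) * F t - (1 - c) ^+ 2) / (4 * c).
    by rewrite -sin2; field; rewrite gt_eqF.
  have [c1|c1] := eqVneq c 1.
    by rewrite c1 subrr expr0n oppr0 mul0r; move: (@pi R) p0 => q q0; field.
  have F0 : F t != 0 by rewrite gt_eqF// mpx_gt0 ?sn1// ltW.
  by move: (@pi R) p0 => q q0; field; rewrite q0 F0 gt_eqF.
rewrite circZ; last first.
  move=> t; apply: cvgM; first exact: continuous_mpx_exp.
  by rewrite expr2; apply: cvgM; exact: continuous_sin.
rewrite circ_mpx_sin2 s2 mom_motz; first by move: (@pi R) p0 => q q0; field.
by move=> k; rewrite pnatr_eq0.
Qed.

Let pi0 : pi != 0 :> R. Proof. by rewrite gt_eqF// pi_gt0. Qed.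

(** The square root is the Jacobian of [x = mpx s t], so this measure is uniform in [t]: an arcsine
    law of mass 1/2. *)
Let half_density : exists nu : {finite_measure set (measurableTypeR R) -> \bar R},
  [/\ forall A, measurable A -> nu A = ac_part c (fun x => (2 * pi * root x)^-1) A,
      mu.-integrable `[el, er]%classic (EFin \o (fun x => (2 * pi * root x)^-1)) &
      forall n, has_Rintegral nu (fun x : R => x ^+ n) ((P ^+ n)`_n / 2)].
Proof.
have cw : continuous (fun _ : R => (2 * pi)^-1 : R) by exact: cst_continuous.
have [|||||nu [nuE nui num]] :=
    @density_measure R s (fun x => (2 * pi * root x)^-1) _ s0 _ _ _ _ _ cw.
- move=> x hx; apply: cvgV; first by rewrite !mulf_neq0// gt_eqF// root_gt0.
  by apply: cvgM; [exact: cvg_cst|exact: continuous_root].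
- by move=> x hx; rewrite invr_ge0 !mulr_ge0 ?pi_ge0// sqrtr_ge0.
- by rewrite root_el mulr0 invr0.
- by rewrite root_er mulr0 invr0.
- move=> t ht; have [st _] := sin_mpx ht; rewrite root_mpx//.
  by move: (@pi R) pi0 => q q0; field; rewrite q0 !gt_eqF.
exists nu; split=> // n; have := num n; congr (has_Rintegral _ _ _).
have -> : (fun t => F t ^+ n * (2 * pi)^-1) = (fun t => (2 * pi)^-1 * F t ^+ n).
  by apply/funext => t; rewrite mulrC.
rewrite circZ; last exact: continuous_mpx_exp.
by rewrite circ_mpx s2; move: (@pi R) pi0 => q q0; field.
Qed.

(** Division by [x] lowers the order of each moment by one; what remains at order 0 is the inverse
    moment [circ_mpxV], available for [c != 1]. *)
Let half_density_inv : c != 1 -> exists nu : {finite_measure set (measurableTypeR R) -> \bar R},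
  [/\ forall A, measurable A -> nu A = ac_part c (fun x => (2 * pi * x * root x)^-1) A,
      mu.-integrable `[el, er]%classic (EFin \o (fun x => (2 * pi * x * root x)^-1)) &
      forall n, has_Rintegral nu (fun x : R => x ^+ n)
        ((if n is n'.+1 then (P ^+ n')`_n' else `|1 - c|^-1) / 2)].
Proof.
move=> c1; have cw : continuous (fun t => (2 * pi)^-1 * (F t)^-1).
  by apply: continuous_mpxV_coef => c1'; rewrite c1' eqxx in c1.
have [|||||nu [nuE nui num]] :=
    @density_measure R s (fun x => (2 * pi * x * root x)^-1) _ s0 _ _ _ _ _ cw.
- move=> x hx; have x0 := itv_gt0 hx; have r0 := root_gt0 hx.
  apply: cvgV; first by rewrite !mulf_neq0// gt_eqF.
  apply: cvgM; last exact: continuous_root.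
  by apply: cvgM; [exact: cvg_cst|exact: cvg_id].
- move=> x hx; have x0 := itv_gt0 hx.
  by rewrite invr_ge0 !mulr_ge0 ?pi_ge0// ?sqrtr_ge0// ltW.
- by rewrite root_el mulr0 invr0.
- by rewrite root_er mulr0 invr0.
- move=> t ht; have [st Ft] := sin_mpx ht; rewrite root_mpx//.
  by move: (@pi R) pi0 => q q0; field; rewrite q0 !gt_eqF.
exists nu; split=> // n; have := num n; congr (has_Rintegral _ _ _).
case: n => [|n].
  under [X in circ X]funext do rewrite expr0 mul1r.
  rewrite circZ; last by apply: continuous_mpxV; [exact: ltW|exact: sn1].
  rewrite circ_mpxV ?sn1// s2.
  by move: (@pi R) pi0 => q q0; field; rewrite q0 normr_eq0 subr_eq0 eq_sym c1.
have -> : (fun t => F t ^+ n.+1 * ((2 * pi)^-1 * (F t)^-1)) = (fun t => (2 * pi)^-1 * F t ^+ n).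
  apply/funext => t; rewrite exprSr.
  have F0 : F t != 0 by rewrite gt_eqF// mpx_gt0 ?sn1// ltW.
  by move: (@pi R) pi0 => q q0; field; rewrite q0 F0.
rewrite circZ; last exact: continuous_mpx_exp.
by rewrite circ_mpx s2; move: (@pi R) pi0 => q q0; field.
Qed.

Let el_gt0 : c != 1 -> 0 < el.
Proof. by move=> /sn1 h; rewrite /edge_l exprn_even_gt0//= subr_eq0 eq_sym. Qed.

(** The numerator [x + 1 - c] is separated into [x] and [1 - c]. The lower edge is positive, so [x]
    can be cancelled; at the edges the root vanishes and both sides are 0. *)
Let ac_mu'_density (nu1 nu2 : {finite_measure set (measurableTypeR R) -> \bar R}) A :
  c != 1 -> measurable A ->
  nu1 A = ac_part c (fun x => (2 * pi * root x)^-1) A ->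
  nu2 A = ac_part c (fun x => (2 * pi * x * root x)^-1) A ->
  mu.-integrable `[el, er]%classic (EFin \o (fun x => (2 * pi * root x)^-1)) ->
  mu.-integrable `[el, er]%classic (EFin \o (fun x => (2 * pi * x * root x)^-1)) ->
  ac_part c (mu'_density c) A = (nu1 A + (1 - c)%:E * nu2 A)%E.
Proof.
move=> c1 mA -> -> i1 i2.
have mI : measurable (`[el, er]%classic : set (measurableTypeR R)) by exact: measurable_itv.
have mD : measurable (A `&` `[el, er]%classic) by exact: measurableI.
have j1 := integrableS mI mD (@subIsetr _ _ _) i1.
have j2 := integrableS mI mD (@subIsetr _ _ _) i2.
rewrite /ac_part -integralZl// -integralD//; last exact: integrableZl.
apply: eq_integral => x; rewrite inE => -[_]; rewrite /= in_itv/= => /andP[xl _].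
have x0 : x != 0 by rewrite gt_eqF// (lt_le_trans _ xl)// el_gt0.
rewrite -EFinM -EFinD /mu'_density -/(root x); congr EFin.
have [->|r0] := eqVneq (root x) 0; first by rewrite !mulr0 invr0 !mulr0 addr0.
by move: (@pi R) pi0 => q q0; field; rewrite q0 x0 r0.
Qed.

(** The weight [k] of the atom is forced by total mass 0: the continuous part has mass
    [1/2 + (1 - c) / (2 |1 - c|)], that is 1 for [c < 1] and 0 for [c > 1], and mass 1/2 at
    [c = 1]. *)
Lemma wishart_mu'_decomposition (c' : R) :
  exists (nu1 nu2 : {finite_measure set (measurableTypeR R) -> \bar R}) (k : R) (g1 g2 : nat -> R),
  [/\ forall A : set (measurableTypeR R), measurable A -> wishart_mu' c c' A =
        ((- c' * k)%:E * \d_(0%R : R) A + (c'%:E * nu1 A + (c' * (1 - c))%:E * nu2 A))%E,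
      forall n, has_Rintegral nu1 (fun x : R => x ^+ n) (g1 n),
      forall n, has_Rintegral nu2 (fun x : R => x ^+ n) (g2 n) &
      forall n, g1 n + (1 - c) * g2 n - k * 0 ^+ n = (wpoly R (nseq n tt))^`().[c]].
Proof.
have [nu1 [nu1E i1 m1]] := half_density.
have dP n : (wpoly R (nseq n.+1 tt))^`().[c] = (P ^+ n.+1)`_n.+1 / 2 + (1 - c) * ((P ^+ n)`_n / 2).
  have := @deriv_wpoly_nseq R _ tt c n; rewrite mulr2n => e.
  by move: e; rewrite -/P; lra.
have fin1 (A : set (measurableTypeR R)) : measurable A -> nu1 A \is a fin_num by move=> mA; rewrite fin_num_measure.
have find (A : set (measurableTypeR R)) : measurable A -> (\d_(0%R : R) A : \bar R) \is a fin_num by rewrite diracE.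
have [c1|c1] := eqVneq c 1.
  (* At [c = 1] the second measure has coefficient 0, so [nu1] can fill its place. *)
  exists nu1, nu1, 2^-1, (fun n => (P ^+ n)`_n / 2), (fun n => (P ^+ n)`_n / 2); split => //.
    move=> A mA; rewrite /wishart_mu' c1 ltxx eqxx subrr mulr0 mul0e adde0.
    have -> : ac_part 1 (@mu'_density1 R) A = nu1 A.
      rewrite nu1E// c1; congr (ac_part _ _ _); apply/funext => x.
      rewrite /mu'_density1 /root /edge_l /edge_r c1 sqrtr1 subrr.
      by congr (_ ^-1); congr (_ * Num.sqrt _); ring.
    have e (a : R) (x y : \bar R) : x \is a fin_num -> y \is a fin_num ->
        ((- c')%:E * (a%:E * x - y) = (- c' * a)%:E * x + c'%:E * y)%E.
      move: x y => [x||] [y||] // _ _.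
      by apply: (@f_equal _ _ EFin (- c' * (a * x - y)) (- c' * a * x + c' * y)); ring.
    by apply: e; [exact: find|exact: fin1].
  move=> [|n].
    by rewrite deriv_wpoly_nseq0 !expr0 coef1 c1 subrr mul0r addr0 mulr1 mul1r subrr.
  by rewrite dP c1 subrr !mul0r expr0n /= mulr0; lra.
have [nu2 [nu2E i2 m2]] := half_density_inv c1.
have fin2 (A : set (measurableTypeR R)) : measurable A -> nu2 A \is a fin_num by move=> mA; rewrite fin_num_measure.
exists nu1, nu2, (if c < 1 then 1 else 0), (fun n => (P ^+ n)`_n / 2),
  (fun n => (if n is n'.+1 then (P ^+ n')`_n' else `|1 - c|^-1) / 2); split => //.
  move=> A mA; rewrite /wishart_mu' (negPf c1).
  rewrite (ac_mu'_density c1 mA (nu1E A mA) (nu2E A mA) i1 i2).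
  have e (a : R) (x y z : \bar R) : x \is a fin_num -> y \is a fin_num -> z \is a fin_num ->
      ((- c')%:E * (a%:E * x - (y + (1 - c)%:E * z)) =
       (- c' * a)%:E * x + (c'%:E * y + (c' * (1 - c))%:E * z))%E.
    move: x y z => [x||] [y||] [z||] // _ _ _.
    by apply: (@f_equal _ _ EFin (- c' * (a * x - (y + (1 - c) * z)))
      (- c' * a * x + (c' * y + c' * (1 - c) * z))); ring.
  rewrite -e; [|exact: find|exact: fin1|exact: fin2].
  by case: ifP => _; rewrite ?mul1e// mul0e add0e.
move=> [|n]; last by rewrite dP expr0n /= mulr0 subr0.
rewrite deriv_wpoly_nseq0 !expr0 coef1 mulr1 /=.
have [c1'|c1'] := ltP c 1.
  by rewrite ger0_norm ?subr_ge0 ?ltW//; field; rewrite subr_eq0 eq_sym c1.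
by rewrite ler0_norm ?subr_le0//; field; rewrite subr_eq0 eq_sym c1.
Qed.

End marchenko_pastur_measures.

Section measure_differences.
Context (d : measure_display) (T : measurableType d) (R : realType) (f : nat -> T -> R).

(** The signs of [c'] and [1 - c] are not fixed, so signed combinations are kept as differences of
    two finite measures with known moments, a form stable under scaling and addition. *)
Definition moments_of_difference (sg : set T -> \bar R) (v : nat -> R) :=
  exists (m1 m2 : {finite_measure set T -> \bar R}) (v1 v2 : nat -> R),
  [/\ forall A, measurable A -> sg A = (m1 A - m2 A)%E,
      forall n, has_Rintegral m1 (f n) (v1 n),
      forall n, has_Rintegral m2 (f n) (v2 n) &
      forall n, v n = v1 n - v2 n].

Lemma moments_of_difference_scale (k : R) (m : {finite_measure set T -> \bar R}) v :
  (forall n, has_Rintegral m (f n) (v n)) ->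
  moments_of_difference (fun A => k%:E * m A)%E (fun n => k * v n).
Proof.
move=> mv; have p0 : 0 <= Num.max k 0 by rewrite le_max lexx orbT.
have q0 : 0 <= Num.max (- k) 0 by rewrite le_max lexx orbT.
have fm (l : {nonneg R}) : fin_num_fun (mscale l m).
  by move=> A mA; rewrite /mscale /= fin_numM// fin_num_measure.
have kE : k = Num.max k 0 - Num.max (- k) 0.
  by have [k0|k0] := leP k 0; [rewrite max_l|rewrite max_r]; lra.
exists (finite_meas (fm (NngNum p0))), (finite_meas (fm (NngNum q0))).
exists (fun n => Num.max k 0 * v n), (fun n => Num.max (- k) 0 * v n); split.
- move=> A mA.
  have e (x : \bar R) : x \is a fin_num ->
      (k%:E * x = (Num.max k 0)%:E * x - (Num.max (- k) 0)%:E * x)%E.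
    case: x => // r _; apply: (@f_equal _ _ EFin (k * r)
      (Num.max k 0 * r - Num.max (- k) 0 * r)).
    by rewrite -mulrBl -kE.
  by apply: e; rewrite fin_num_measure.
- by move=> n; exact: (has_Rintegral_mscale (NngNum p0)).
- by move=> n; exact: (has_Rintegral_mscale (NngNum q0)).
- by move=> n; rewrite -mulrBl -kE.
Qed.

Lemma moments_of_differenceD sg sg' v v' :
  moments_of_difference sg v -> moments_of_difference sg' v' ->
  moments_of_difference (fun A => sg A + sg' A)%E (fun n => v n + v' n).
Proof.
move=> [m1 [m2 [v1 [v2 [sE h1 h2 vE]]]]] [m1' [m2' [v1' [v2' [sE' h1' h2' vE']]]]].
have fm (m m' : {finite_measure set T -> \bar R}) : fin_num_fun (measure_add m m').
  by move=> A mA; rewrite measure_addE fin_numD !fin_num_measure.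
exists (finite_meas (fm m1 m1')), (finite_meas (fm m2 m2')).
exists (fun n => v1 n + v1' n), (fun n => v2 n + v2' n); split.
- move=> A mA; rewrite sE// sE'// /finite_meas.
  rewrite -[X in (_ = X - _)%E]/(measure_add m1 m1' A) -[X in (_ = _ - X)%E]/(measure_add m2 m2' A).
  rewrite !measure_addE.
  have e (a b p q : \bar R) : a \is a fin_num -> b \is a fin_num -> p \is a fin_num ->
      q \is a fin_num -> (a - b + (p - q) = a + p - (b + q))%E.
    move: a b p q => [a||] [b||] [p||] [q||] // _ _ _ _.
    by apply: (@f_equal _ _ EFin (a - b + (p - q)) (a + p - (b + q))); ring.
  by apply: e; rewrite fin_num_measure.
- by move=> n; exact: has_Rintegral_measure_add.
- by move=> n; exact: has_Rintegral_measure_add.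
- by move=> n; rewrite vE vE'; ring.
Qed.

End measure_differences.

Lemma moments_of_difference_charge (R : realType) (sg : set (measurableTypeR R) -> \bar R)
    (v : nat -> R) :
  @moments_of_difference _ (measurableTypeR R) R (fun n t => t ^+ n) sg v ->
  exists nu : {charge set (measurableTypeR R) -> \bar R},
    (forall A, measurable A -> nu A = sg A) /\
    forall n, charge_integral nu (fun t => t ^+ n) (v n).
Proof.
move=> [m1 [m2 [v1 [v2 [sE h1 h2 vE]]]]]; have [nu nuE] := charge_of_difference m1 m2.
exists nu; split=> [A mA|n]; first by rewrite nuE// sE.
by rewrite vE; apply: (jordan_has_Rintegral nuE).
Qed.

Section limit_distribution.
Context (R : realType) (c c' : R).
Hypothesis c0 : 0 < c.
Let p n := wpoly R (nseq n tt).

Let mX n : measurable_fun (setT : set (measurableTypeR R)) (fun t : R => t ^+ n).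
Proof. exact: exprn_measurable. Qed.

Let atom n : has_Rintegral (\d_(0%R : measurableTypeR R) : {measure set (measurableTypeR R) -> \bar R})
  (fun t : R => t ^+ n) (0 ^+ n).
Proof. by have := has_Rintegral_dirac (0%R : measurableTypeR R) (mX n). Qed.

Lemma marchenko_pastur_probability : exists mu : probability (measurableTypeR R) R,
  (forall A, measurable A -> mu A = marchenko_pastur c A) /\
  forall n, has_Rintegral mu (fun t : R => t ^+ n) (p n).[c].
Proof.
have [nu [nuE num]] := marchenko_pastur_ac c0.
have k0 : 0 <= Num.max (1 - c) 0 by rewrite le_max lexx orbT.
pose m := measure_add (mscale (NngNum k0) (\d_(0%R : measurableTypeR R))) nu.
have mm n : has_Rintegral m (fun t : R => t ^+ n) (p n).[c].
  have := has_Rintegral_measure_add (has_Rintegral_mscale (NngNum k0) (atom n)) (num n).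
  congr (has_Rintegral _ _ _); rewrite /p horner_wpoly_nseq.
  case: n => [|n] /=; last by rewrite expr0n /= mulr0 add0r.
  rewrite expr0 mulr1 mom0; have [c1|c1] := leP (1 - c) 0.
    by rewrite ler0_norm//; field.
  by rewrite gtr0_norm//; field.
(* The total mass is read off from the moment of order 0. *)
have m1 : m setT = 1%E.
  have [mi] := mm 0%N; rewrite /p horner_wpoly_nseq mom0 /Rintegral.
  have fi := integrable_fin_num measurableT mi.
  move=> /(congr1 (@EFin R)); rewrite fineK// => <-.
  under eq_integral do rewrite /= expr0.
  by rewrite integral_cst// mul1e.
exists (prob_meas m1); split=> [A mA|n]; last exact: mm.
by rewrite /marchenko_pastur -nuE// -[LHS]/(m A) /m measure_addE.
Qed.

Lemma wishart_mu'_charge : exists mu' : {charge set (measurableTypeR R) -> \bar R},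
  (forall A, measurable A -> mu' A = wishart_mu' c c' A) /\
  forall n, charge_integral mu' (fun t => t ^+ n) (c' * (p n)^`().[c]).
Proof.
have [nu1 [nu2 [k [g1 [g2 [E h1 h2 gE]]]]]] := wishart_mu'_decomposition c0 c'.
have fm : fin_num_fun (\d_(0%R : measurableTypeR R) : {measure set (measurableTypeR R) -> \bar R}).
  by move=> A mA; rewrite /= /dirac.
have [nu [nuE nui]] := moments_of_difference_charge (moments_of_differenceD
  (@moments_of_difference_scale _ _ _ _ (- c' * k) (finite_meas fm) _ atom)
  (moments_of_differenceD (moments_of_difference_scale c' h1)
    (moments_of_difference_scale (c' * (1 - c)) h2))).
exists nu; split=> [A mA|n]; first by rewrite nuE// E.
by have := nui n; congr (charge_integral _ _ _); rewrite -gE; ring.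
Qed.

End limit_distribution.

Unset Implicit Arguments.

Theorem theorem30 (R : realType) (s : nat) (hs : (0 < s)%N)
    (d : nat -> measure_display) (T : forall N : nat, measurableType (d N))
    (P : forall N : nat, probability (T N) R)
    (M : nat -> nat) (X : forall N : nat, 'I_s -> T N -> 'M[R[i]]_N)
    (c c' : R)
    (hW : forall (N : nat) (i : 'I_s), complex_wishart (P N) (M N) (X N i))
    (hX : forall N : nat,
      mutually_independent (P N) (fun i : 'I_s => events_of_mx (X N i)))
    (hc : 0 < c)
    (hM : (M N)%:R / N%:R @[N --> \oo] --> c)
    (hM' : (M N)%:R - N%:R * c @[N --> \oo] --> c') :
  asymptotically_inf_free P X /\
  forall (S : inf_prob_space R) (x : 'I_s -> S), inf_limit P X x ->
  forall i : 'I_s,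
    (exists k k' : nat -> R[i],
       inf_free_cumulants (fun n => ips_phi S (x i ^+ n))
         (fun n => ips_phi' S (x i ^+ n)) k k' /\
       forall n, (0 < n)%N -> k' n = c'%:C) /\
    exists (mu : probability (measurableTypeR R) R)
      (mu' : {charge set (measurableTypeR R) -> \bar R}),
      [/\ forall A, measurable A -> mu A = marchenko_pastur c A,
          forall A, measurable A -> mu' A = wishart_mu' c c' A &
          inf_distribution (x i) mu mu'].
Proof.
split; first exact: (wishart_inf_free hW hX hM hM').
move=> S x xlim i; have mom n := inf_limit_moment hW hX hM hM' xlim i n.
split.
  exists (fun=> c%:C), (fun=> c'%:C); split => //.
  exact: (inf_limit_cumulants hW hX hM hM' xlim i).
have [mu [muE mum]] := marchenko_pastur_probability hc.
have [mu' [mu'E mu'm]] := wishart_mu'_charge c' hc.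
exists mu, mu'; split => // n.
have [-> ->] := mom n; have [mi mv] := mum n; split => //; first by rewrite mv.
by exists (c' * (wpoly R (nseq n tt))^`().[c]).
Qed.
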